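(* Any locally finite $6$-CH graph with girth $3$ and $c_2>1$ is CH.
   Context: All graphs are undirected and simple with non-empty vertex set (possibly infinite, not necessarily connected). A graph is locally finite if every vertex has finite valency. The girth is the length of a shortest cycle. For a positive integer $k$, a graph $\Gamma$ is $k$-CH if any isomorphism between connected induced subgraphs of $\Gamma$ of order at most $k$ extends to an automorphism of $\Gamma$; it is CH if it is $k$-CH for all $k$. $c_2=c_2(\Gamma)$ denotes the number of common neighbours of two vertices at distance two; this number is the same for all such pairs in any $3$-CH graph. *)

(* Defs.v *)
From mathcomp Require Import all_boot.
From mathcomp Require Import boolp classical_sets functions cardinality.

Set Implicit Arguments.
Unset Strict Implicit.
Unset Printing Implicit Defensive.

Local Open Scope classical_set_scope.
Local Open Scope card_scope.

(* The vertex type is arbitrary, so graphs may be infinite and disconnected.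
   Taking adjacency boolean-valued is no restriction classically (asbool). *)
Record graph := Graph {
  vertex :> Type;
  adj : rel vertex;
  adj_sym : symmetric adj;
  adj_irrefl : irreflexive adj;
  vertex_nonempty : inhabited vertex
}.

Definition nbrs (G : graph) (x : G) : set G := [set y | adj x y].

Definition locally_finite (G : graph) : Prop :=
  forall x : G, finite_set (nbrs x).

Definition walk (G : graph) (x y : G) (n : nat) : Prop :=
  exists p : seq G, [/\ path (@adj G) x p, last x p = y & size p = n].

Definition connected (G : graph) : Prop :=
  forall x y : G, exists n, walk x y n.

Definition at_distance (G : graph) (x y : G) (n : nat) : Prop :=
  walk x y n /\ forall m, walk x y m -> n <= m.

(* [ordS] is the cyclic successor i |-> i + 1 mod n. *)
Definition has_cycle (G : graph) (n : nat) : Prop :=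
  2 < n /\ exists c : 'I_n -> G,
    injective c /\ forall i : 'I_n, adj (c i) (c (ordS i)).

Definition has_girth (G : graph) (g : nat) : Prop :=
  has_cycle G g /\ forall n, has_cycle G n -> g <= n.

Definition order_at_most (G : graph) (k : nat) : Prop :=
  [set: G] #<= `I_k.

Definition is_iso (G H : graph) (f : G -> H) : Prop :=
  bijective f /\ forall x y : G, adj (f x) (f y) = adj x y.

Section Induced.
Variables (G : graph) (A : set G) (A0 : A !=set0).

Definition induced_adj : rel (set_type A) :=
  fun x y => adj (set_val x) (set_val y).

Lemma induced_adj_sym : symmetric induced_adj.
Proof. by move=> x y; apply: adj_sym. Qed.

Lemma induced_adj_irrefl : irreflexive induced_adj.
Proof. by move=> x; apply: adj_irrefl. Qed.

Lemma induced_nonempty : inhabited (set_type A).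
Proof. by case: A0 => x Ax; constructor; exists x; apply: mem_set. Qed.

Definition induced : graph :=
  Graph induced_adj_sym induced_adj_irrefl induced_nonempty.

End Induced.

Definition kCH (k : nat) (G : graph) : Prop :=
  forall (A B : set G) (A0 : A !=set0) (B0 : B !=set0)
         (f : induced A0 -> induced B0),
    connected (induced A0) -> connected (induced B0) ->
    order_at_most (induced A0) k -> order_at_most (induced B0) k ->
    is_iso f ->
    exists g : G -> G,
      is_iso g /\ forall x : induced A0, g (set_val x) = set_val (f x).

Definition CH (G : graph) : Prop := forall k, 0 < k -> kCH k G.

(* c_2(G) is defined and equal to c. The first conjunct is needed: without a
   pair of vertices at distance two every c would satisfy the second one. *)
Definition is_c2 (G : graph) (c : nat) : Prop :=
  (exists x y : G, at_distance x y 2) /\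
  forall x y : G, at_distance x y 2 -> (nbrs x `&` nbrs y) #= `I_c.

(* Main.v *)
(** The neighbourhood of a vertex is a finite 5-homogeneous graph, hence
    strongly regular, and so are its complement and the local graphs of both.
    If it is neither a disjoint union of cliques nor complete multipartite, a
    double count shows that each local graph retains an eigenvalue, and the
    resulting Diophantine conditions (Smith or Latin square parameters at every
    level), together with a geometric argument for generalized quadrangles,
    leave only the pentagon and the 3 x 3 rook graph. These two are excluded by
    counting, for vertices [u] and [w] at distance two, the edges between the
    common neighbours of [u] and [w] and the other neighbours of [w].

    If neighbourhoods are complete multipartite, vertices at distance two are
    twins. If they are unions of cliques, the cliques are the lines of a geometry
    in which a point at distance two from [a] has a neighbour on every line
    through [a]; counting centres of claws shows that only two lines pass
    through each point, so that the components of the graph are grids. In both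
    cases two vertices with the same neighbours in a connected set [S] are
    exchanged by an explicit automorphism fixing [S] pointwise, so that k-CH
    implies (k+1)-CH for [k >= 6]. *)

(* Fix a vertex [x]; let [N] be the adjacency matrix of its local graph and [B] the 0-1 matrix of
   adjacencies between neighbours and non-neighbours of [x]. Constant triple counts give
   [N B = (a2 - a1) B + a1 J], and [B B^T] is a combination of [I], [N], [J]. So [N] satisfies, off
   the all-one vector, a quadratic equation; one root is [a2 - a1], and the other turns out to be an
   eigenvalue of the whole graph. Only entries of these matrices occur below, so no linear algebra
   is needed. The complement has eigenvalues [-1 - r] and [-1 - s] and also retains one of them:
   Smith parameters arise if the two retained eigenvalues correspond, Latin square parameters
   otherwise. Each passage to a local graph costs one degree of homogeneity. The longest descent
   goes through three nested graphs, and the last still needs constant triple counts: this uses up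
   5-homogeneity. A set of neighbours of [x] becomes connected once [x] is added, whence the sixth
   vertex; for unions of cliques, six is also the order of the largest claw that is moved. *)
Require Import Defs.
From Stdlib Require Import ZArith Lia Psatz.

(** * Parameters of strongly regular graphs *)

Section IntegerParameters.
Local Open Scope Z_scope.

(* [k] is the valency of a strongly regular graph and [r], [s] are its other
   eigenvalues; the conditions say that it has the parameters of a Smith graph,
   resp. of a (negative) Latin square graph. *)
Definition smith (k r s : Z) := k * (s - r * r - 2 * r) = s * (r * r - s - 2 * r * s).
Definition latin (k r s : Z) := k = - s * (r - s - 1).
Definition opposite (r s : Z) := (1 <= r /\ s <= -2) \/ (r <= -2 /\ 1 <= s).

Lemma mul_cancel (a b c : Z) : a <> 0 -> a * b = a * c -> b = c.
Proof. intros H. apply Z.mul_reg_l; assumption. Qed.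

Lemma prod_eq0 (a b : Z) : a * b = 0 -> a <> 0 -> b = 0.
Proof. intros H1 H2. apply Z.mul_eq_0 in H1. tauto. Qed.

(* [l - m - r] and [r] are the nontrivial eigenvalues of the graph, [r] and
   [a2 - a1] those of its local graphs. *)
Lemma retained_root (k l m a3 a2 a1 : Z) :
  0 < k - 1 - l -> a2 <> l ->
  l * (l - 1 - a3) = a2 * (k - 1 - l) ->
  (k - 1 - l) + a3 * (l - 1 - a3) + (l - 1 - a3) * (m - 1 - a2)
    = a1 * (k - 1 - l) + (a2 - a1) * (l - 1 - a3) ->
  a2 * (l - 1 - a3) + (l - a2) * (m - 1 - a2)
    = a1 * (k - 1 - l) + (a2 - a1) * (m - 1 - a2) ->
  exists r, r + (a2 - a1) = a3 - a2 /\ r * (a2 - a1) = a2 - l /\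
    r * (l - m - r) = m - k /\ (a2 - a1) * (k + (l - m - r)) = l * (l - m - r).
Proof.
intros Hb Ha2 E0 E1 E2.
remember (k - 1 - l) as b eqn:Db. remember (l - 1 - a3) as p eqn:Dp.
remember (m - 1 - a2) as q eqn:Dq. remember (a2 - a1) as e eqn:De.
(* The roots of the local graph have sum [a3 - a2], and [e] is one of them. The count says
   [(N - e) ((b - q) + (p - q) N) = 0] off the all-one vector, and by [Hc0] the second factor has
   root [r]. *)
exists (a3 - a2 - e). set (r := a3 - a2 - e).
assert (Hc0 : b - q = - (p - q) * r) by (unfold r; nia).
assert (Hc1 : (p - q) * (l - a2 + e * r) = 0) by nia.
assert (Hpq : p - q <> 0).
{ intros H0. rewrite H0 in Hc0. assert (b = q) by lia. assert (p = b) by lia.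
  apply Ha2. subst p. apply (mul_cancel b); lia. }
assert (Hre : r * e = a2 - l) by (apply prod_eq0 in Hc1; lia).
assert (Hrs : r * (l - m - r) = m - k) by (unfold r in *; nia).
assert (Hr1 : r <> -1).
{ intros Hr1. rewrite Hr1 in Hrs. lia. }
repeat split; try assumption; try (unfold r; lia).
remember (l - m - r) as s eqn:Ds.
apply (mul_cancel (1 + r)); [lia|].
assert (H0 : b = - (1 + r) * (1 + s)) by lia.
assert (H1 : p = - (1 + r) * (1 + e)) by (unfold r in *; lia).
assert (Ha : a2 = l + r * e) by lia.
assert (E3 : l * (1 + r) * (1 + e) = (1 + r) * (1 + s) * (l + r * e)).
{ rewrite <- Ha. transitivity (- (l * p)); [rewrite H1; ring|].
  rewrite E0, H0. ring. }
assert (H2 : k + s = l - r - r * s) by lia.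
rewrite H2. lia.
Qed.

Section SmithLatin.
Variables (k l m n kb lb mb r s e : Z).
Hypotheses (Hk : 0 < k) (Hm : 0 < m) (Hop : opposite r s).
Hypotheses (Hs : r + s = l - m) (Hp : r * s = m - k) (Hsrg : k * (k - 1 - l) = kb * m).
Hypotheses (Hlb : lb = kb + r * s - 1) (He : e * (k + s) = l * s).

(** The hypothesis is [He] read in the complement when [-1 - r] is the root retained there. [E5] and
    [E6] both involve [e - r - s]; eliminating it leaves a condition on [k], [r], [s] alone. *)
Lemma smith_case : (e - 1 - r - s) * (kb - 1 - s) = lb * (-1 - s) -> smith k r s.
Proof.
intros Hb. unfold smith.
assert (Hs1 : 1 + s <> 0) by (unfold opposite in Hop; lia).
assert (Hl : l = k + r * s + r + s) by lia. assert (Hmm : m = k + r * s) by lia.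
assert (E1 : kb * m = - k * (1 + r) * (1 + s)) by (rewrite <- Hsrg, Hl; ring).
assert (E2 : m * (kb - 1 - s) = - (1 + s) * (2 * k + k * r + r * s)) by (transitivity (kb * m - (1 + s) * m); [ring|]; rewrite E1, Hmm; ring).
assert (E3 : m * lb = -2 * k - k * r - k * s - r * s + r * s * (r * s)) by (rewrite Hlb; transitivity (kb * m + (r * s - 1) * m); [ring|]; rewrite E1, Hmm; ring).
assert (E4 : (e - 1 - r - s) * (2 * k + k * r + r * s) = m * lb).
{ apply (mul_cancel (1 + s)); trivial.
  transitivity (- (e - 1 - r - s) * (m * (kb - 1 - s))); [rewrite E2; ring|].
  transitivity (- m * ((e - 1 - r - s) * (kb - 1 - s))); [ring|]. rewrite Hb. ring. }
assert (E5 : (e - r - s) * (2 * k + k * r + r * s) = s * (r * r * s - k)) by (rewrite E3 in E4; lia).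
assert (E6 : (e - r - s) * (k + s) = r * (s * s - k)) by (rewrite Hl in He; lia).
assert (E7 : r * (s * s - k) * (2 * k + k * r + r * s) = s * (r * r * s - k) * (k + s)).
{ rewrite <- E6, <- E5. ring. }
apply (mul_cancel k); lia.
Qed.

(** As for [smith_case], but with [-1 - s] as the root retained in the complement. *)
Lemma latin_case : (e - 1 - r - s) * (kb - 1 - r) = lb * (-1 - r) -> latin k r s.
Proof.
intros Hb. unfold latin.
assert (Hs1 : 1 + s <> 0 /\ 1 + r <> 0 /\ r <> 0) by (unfold opposite in Hop; lia).
assert (Hl : l = k + r * s + r + s) by lia. assert (Hmm : m = k + r * s) by lia.
assert (E1 : kb * m = - k * (1 + r) * (1 + s)) by (rewrite <- Hsrg, Hl; ring).
assert (E2 : m * (kb - 1 - r) = - (1 + r) * (2 * k + k * s + r * s)) by (transitivity (kb * m - (1 + r) * m); [ring|]; rewrite E1, Hmm; ring).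
assert (E3 : m * lb = -2 * k - k * r - k * s - r * s + r * s * (r * s)) by (rewrite Hlb; transitivity (kb * m + (r * s - 1) * m); [ring|]; rewrite E1, Hmm; ring).
assert (E4 : (e - 1 - r - s) * (2 * k + k * s + r * s) = m * lb).
{ apply (mul_cancel (1 + r)); [tauto|].
  transitivity (- (e - 1 - r - s) * (m * (kb - 1 - r))); [rewrite E2; ring|].
  transitivity (- m * ((e - 1 - r - s) * (kb - 1 - r))); [ring|]. rewrite Hb. ring. }
assert (E5 : (e - r - s) * (2 * k + k * s + r * s) = r * (s * s * r - k)) by (rewrite E3 in E4; lia).
assert (E6 : (e - r - s) * (k + s) = r * (s * s - k)) by (rewrite Hl in He; lia).
assert (E7 : r * (s * s - k) * (2 * k + k * s + r * s) = r * (s * s * r - k) * (k + s)).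
{ rewrite <- E6, <- E5. ring. }
apply (mul_cancel (k * (1 + s) * r)); [|lia].
intros H. apply Z.mul_eq_0 in H; destruct H as [H|H]; [apply Z.mul_eq_0 in H; destruct H|]; lia.
Qed.
End SmithLatin.

(** Multiplication by [D] turns [k + s] and the valency [k + r * s + r + s] of the local graphs into
    products containing [r * (s + 1)], which cancels. *)
Lemma smith_eps (k r s e : Z) : opposite r s -> smith k r s ->
  e * (k + s) = (k + r * s + r + s) * s -> 2 * e = s + r * r + 2 * r.
Proof.
unfold smith; intros Hop HS He.
set (D := s - r * r - 2 * r) in *.
assert (E1 : (k + s) * D = -2 * r * s * (s + 1)) by (unfold D in *; nia).
assert (E2 : (k + r * s + r + s) * D = - r * (s + 1) * (s + r * r + 2 * r)) by (unfold D in *; nia).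
apply (mul_cancel (- r * s * (s + 1))).
{ unfold opposite in Hop. intros H.
  apply Z.mul_eq_0 in H; destruct H as [H|H]; [apply Z.mul_eq_0 in H; destruct H|]; lia. }
transitivity (e * ((k + s) * D)); [rewrite E1; ring|].
transitivity ((e * (k + s)) * D); [ring|]. rewrite He.
transitivity (s * ((k + r * s + r + s) * D)); [ring|]. rewrite E2. ring.
Qed.

Lemma smith_val (k r s e : Z) : opposite r s -> smith k r s ->
  2 * e = s + r * r + 2 * r ->
  (k + r * s + r + s) * (e - r * r - 2 * r) = - r * e * (s + 1).
Proof.
unfold smith; intros Hop HS He.
assert (E2 : (k + r * s + r + s) * (s - r * r - 2 * r) = - r * (s + 1) * (s + r * r + 2 * r)) by nia.
assert (Hs : s = 2 * e - r * r - 2 * r) by lia.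
rewrite Hs in E2 |- *. nia.
Qed.

(** * Local graphs of Smith graphs *)

Section SmithLocal.
Variables (k r s e l : Z).
Hypotheses (Hr : r <= -2) (Hs : 1 <= s) (HS : smith k r s).
Hypotheses (He : 2 * e = s + r * r + 2 * r) (Hl : l = k + r * s + r + s).
Hypotheses (e1 : 1 <= e) (er : r * r + r - 1 <= e).

Let Hv : l * (e - r * r - 2 * r) = - r * e * (s + 1).
Proof. rewrite Hl. exact (smith_val k r s e (or_intror (conj Hr Hs)) HS He). Qed.

Let Ds : s = 2 * e - r * r - 2 * r.
Proof. lia. Qed.

Lemma smith_local_smith : smith l r e -> e = - r * (r * r + r - 1).
Proof.
unfold smith; intros H. rewrite Hv in H.
assert (- r * (s + 1) = r * r - e - 2 * r * e) by (apply (mul_cancel e); lia).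
rewrite Ds in H0. lia.
Qed.

Lemma smith_local_latin : latin l r e -> e = r * r + r.
Proof.
unfold latin; intros H. rewrite H in Hv.
assert (H0 : - (r - e - 1) * (e - r * r - 2 * r) = - r * (s + 1)) by (apply (mul_cancel e); lia).
assert (Z0 : (e + 1) * (e - (r * r + r)) = 0) by (rewrite Ds in H0; lia).
apply prod_eq0 in Z0; lia.
Qed.

Lemma smith_local_latin_swap : ~ latin l e r.
Proof.
unfold latin; intros H. rewrite H in Hv.
assert (H0 : - (e - r - 1) * (e - r * r - 2 * r) = - e * (s + 1)) by (apply (mul_cancel r); lia).
assert (Q : e * e + e * (2 + r) - r * ((r + 1) * (r + 2)) = 0) by (rewrite Ds in H0; lia).
(* By [Q] this square equals the discriminant [(r + 2) (4 r^2 + 5 r + 2)], which is negative for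
   [r < -2]. *)
assert (0 <= (2 * e + 2 + r) * (2 * e + 2 + r)) by apply Z.square_nonneg.
destruct (Z.eq_dec r (-2)) as [E|]; [rewrite E in Q; lia|].
assert (0 < r * (4 * r + 5)) by (apply Z.mul_neg_neg; lia).
assert ((r + 2) * (r * (4 * r + 5) + 2) < 0) by (apply Z.mul_neg_pos; lia).
lia.
Qed.

Lemma smith_local_smith_swap : ~ smith l e r.
Proof.
unfold smith; intros H.
assert (E : - r * e * (s + 1) * (r - e * e - 2 * e)
            = r * (e * e - r - 2 * r * e) * (e - r * r - 2 * r)).
{ rewrite <- Hv. transitivity (l * (r - e * e - 2 * e) * (e - r * r - 2 * r)); [ring|].
  rewrite H. ring. }
assert (exists R, r = - R) as [R Dr] by (exists (- r); lia).
rewrite Ds, Dr in E. rewrite Dr in er, Hr. clear - E er Hr e1.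
assert (R2 : 2 * R <= R * R) by (apply Z.mul_le_mono_nonneg_r; lia).
assert (E' : e * (2 * e - R * R + 2 * R + 1) * (e * e + 2 * e + R)
           = (e * e + R + 2 * R * e) * (e - R * R + 2 * R)).
{ apply (mul_cancel R); lia. }
clear E.
assert (P1 : 0 < e * (2 * e - R * R + 2 * R + 1) * (e * e + 2 * e + R)).
{ apply Z.mul_pos_pos; [apply Z.mul_pos_pos|]; lia. }
assert (P2 : 0 < e - R * R + 2 * R).
{ rewrite E' in P1. apply (Z.mul_pos_cancel_l (e * e + R + 2 * R * e)); [|exact P1].
  assert (0 <= R * e) by (apply Z.mul_nonneg_nonneg; lia). lia. }
set (q := e - R * R + 2 * R) in *.
assert (E'' : e * (e + 1 + q) * (e * e + 2 * e + R) = (e * e + R + 2 * R * e) * q)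
  by (rewrite <- E'; unfold q; ring).
assert (qe : q <= e) by (unfold q; lia).
assert (Re : R <= e + 1) by lia.
clear E' P1.
(* The two sides of [E''] cannot balance: the first factor on the right is below
   [3 (e^2 + 2 e + R)], while [3 q <= e (e + 1 + q)] on the left. *)
assert (G1 : e * e + R + 2 * R * e < 3 * (e * e + 2 * e + R)).
{ assert (R * e <= (e + 1) * e) by (apply Z.mul_le_mono_nonneg_r; lia). lia. }
assert (G2 : 3 * q <= e * (e + 1 + q)).
{ rewrite (Z.mul_comm e). apply Z.mul_le_mono_nonneg; lia. }
assert (G3 : 0 <= e * e + 2 * e + R) by lia.
apply (Z.mul_lt_mono_pos_r q) in G1; [|exact P2].
apply (Z.mul_le_mono_nonneg_r _ _ _ G3) in G2. lia.
Qed.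

End SmithLocal.

(* [e] stands for [a2 - a1], see [srg_triples]. *)
Definition local_data (k r s e : Z) :=
  opposite r s /\ e * (k + s) = (k + r * s + r + s) * s /\ (smith k r s \/ latin k r s).

Lemma roots_eq (r s r' s' : Z) : r' + s' = r + s -> r' * s' = r * s ->
  (r' = r /\ s' = s) \/ (r' = s /\ s' = r).
Proof.
intros H1 H2. assert (H : (r' - r) * (r' - s) = 0) by (replace s' with (r + s - r') in H2; lia).
apply Z.mul_eq_0 in H. lia.
Qed.

(** Of the four possibilities for the local graph, both swapped ones are impossible and the Latin
    one would require [e = r * r + r]. What survives is a Smith graph that retains the same [r]. *)
Lemma smith_step (k r s e l r' s' e' : Z) : r <= -2 -> 1 <= s -> smith k r s ->
  2 * e = s + r * r + 2 * r -> l = k + r * s + r + s ->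
  1 <= e -> r * r + r - 1 <= e -> e <> r * r + r ->
  r' + s' = r + e -> r' * s' = r * e -> local_data l r' s' e' ->
  r' = r /\ s' = e /\ e = - r * (r * r + r - 1) /\ smith l r e /\ 2 * e' = e + r * r + 2 * r.
Proof.
intros Hr Hs HS He Hl e1 er en Hsum Hprod [Hop [He' H]].
destruct (roots_eq _ _ _ _ Hsum Hprod) as [[Er Es]|[Er Es]]; subst r' s'; destruct H as [H|H].
- split; [trivial|split; [trivial|]].
  split; [exact (smith_local_smith k r s e l Hr Hs HS He Hl e1 H)|]. split; [trivial|]. exact (smith_eps l r e e' Hop H He').
- exfalso; apply en. exact (smith_local_latin k r s e l Hr Hs HS He Hl e1 H).
- exfalso. exact (smith_local_smith_swap k r s e l Hr Hs HS He Hl e1 er H).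
- exfalso. exact (smith_local_latin_swap k r s e l Hr Hs HS He Hl H).
Qed.

(** With [R = -r] one gets [2 e' = R^3 - 3 R]. The first three conclusions permit a second descent
    with the same [r]; the last one contradicts its outcome. *)
Lemma smith_twice (r e e' : Z) : r <= -2 ->
  e = - r * (r * r + r - 1) -> 2 * e' = e + r * r + 2 * r ->
  1 <= e' /\ r * r + r - 1 <= e' /\ e' <> r * r + r /\ e' <> - r * (r * r + r - 1).
Proof.
intros Hr Ee Ee1.
assert (exists R, r = - R) as [R Dr] by (exists (- r); lia). subst r.
assert (F1 : 2 * e' = R * R * R - 3 * R) by lia.
assert (F2 : 0 <= (R - 2) * ((R - 1) * (R + 1))).
{ apply Z.mul_nonneg_nonneg; [|apply Z.mul_nonneg_nonneg]; lia. }
assert (F3 : 2 * R <= R * R) by (apply Z.mul_le_mono_nonneg_r; lia).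
repeat split; try lia.
intros F4. assert (R * ((R - 2) * R - 1) = 0) by lia.
apply prod_eq0 in H; [|lia]. destruct (Z.eq_dec R 2) as [E|]; [rewrite E in H; lia|].
assert (1 * R <= (R - 2) * R) by (apply Z.mul_le_mono_nonneg_r; lia). lia.
Qed.

(** * Local graphs of Latin square graphs *)

Section LatinLocal.
Variables (a b d l e : Z).
Hypotheses (Hl : l = a * a + b - 1) (He : e = - 1 - d) (Hd : d * (a + b - 1) = a * (a - 1)).
Hypotheses (Ha : a <> 1) (Hb : b <> 0) (e0 : e <> 0).

Let Hl' : l = - e * (a + b - 1).
Proof. lia. Qed.

(** In this section [a = -1 - s] and [b = r] for the ambient graph, whose valency is then
    [(a + 1) (a + b)]; its local graphs have eigenvalues [b] and [e]. The parameters [a], [b] are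
    both positive or both negative in the applications. *)
Lemma latin_local_latin : latin l b e -> b = 1.
Proof.
unfold latin; rewrite Hl'; intros H.
assert (E : a + b - 1 = b - e - 1) by (apply (mul_cancel (- e)); lia).
apply (mul_cancel (a - 1)); [lia|]. rewrite He in E.
replace d with (a - 1) in Hd by lia. lia.
Qed.

Lemma latin_local_smith : smith l b e ->
  - (a + b - 1) * (e - b * b - 2 * b) = b * b - e - 2 * b * e.
Proof.
unfold smith; rewrite Hl'; intros H. apply (mul_cancel e); lia.
Qed.

Lemma latin_local_latin_swap : latin l e b -> (a - 1) * (a - 1) * (a + 1) = b * b * (a + b).
Proof.
unfold latin; rewrite Hl, He; intros H.
assert (E : (a * a + b - 1) * (a + b - 1) = b * ((b + 2) * (a + b - 1) + d * (a + b - 1)))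
  by (rewrite H; ring).
rewrite Hd in E. lia.
Qed.

Lemma latin_local_smith_swap : d <> 0 -> smith l e b ->
  (a - d) * (1 + 2 * d - a) = d * ((1 + d) * (1 + d)).
Proof.
unfold smith; intros d0 H.
assert (Db : d * b = (a - 1) * (a - d)) by lia.
assert (E : (d * (a + b - 1)) * ((1 + d) * (b + 1 - d * d))
            = (d * b) * ((1 + d) * (1 + d) + b * (1 + 2 * d))).
{ rewrite Hl', He in H. transitivity (d * (b * ((1 + d) * (1 + d) + b * (1 + 2 * d)))); [|ring].
  transitivity (d * (- (-1 - d) * (a + b - 1) * (b - (-1 - d) * (-1 - d) - 2 * (-1 - d)))); [ring|].
  rewrite H. ring. }
rewrite Hd, Db in E.
assert (E1 : a * ((1 + d) * (b + 1 - d * d)) = (a - d) * ((1 + d) * (1 + d) + b * (1 + 2 * d)))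
  by (apply (mul_cancel (a - 1)); lia).
assert (E2 : (d * b) * (1 + 2 * d - a) = d * ((1 + d) * (1 + d)) * (a - 1)).
{ lia. }
rewrite Db in E2. apply (mul_cancel (a - 1)); lia.
Qed.

End LatinLocal.

(** Since [a <= b], the equation for [d] forces [2 d < a], and in each of the four cases one side of
    the resulting equation is too small. *)
Lemma latin_pos (a b d l e r' s' e' : Z) : 2 <= a -> a <= b -> 1 <= d ->
  l = a * a + b - 1 -> e = -1 - d -> d * (a + b - 1) = a * (a - 1) ->
  r' + s' = b + e -> r' * s' = b * e -> ~ local_data l r' s' e'.
Proof.
intros a2 ab d1 Hl He Hd Hsum Hprod [Hop [He' H]].
assert (dd : 2 * d < a).
{ assert (d * (2 * a - 1) <= d * (a + b - 1)) by (apply Z.mul_le_mono_nonneg_l; lia).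
  destruct (Z_lt_le_dec (2 * d) a); [trivial|exfalso].
  assert (a * (2 * a - 1) <= 2 * d * (2 * a - 1)) by (apply Z.mul_le_mono_nonneg_r; lia). lia. }
destruct (roots_eq _ _ _ _ Hsum Hprod) as [[Er Es]|[Er Es]]; subst r' s'; destruct H as [H|H].
- apply (latin_local_smith a b d) in H; try lia.
  assert (F : (1 + d) * (b - a + 2) = b * ((a + b - 1) * (b + 2) - b)) by (subst e; lia).
  assert (P : (1 + d) * (b - a + 2) <= b * b) by (apply Z.mul_le_mono_nonneg; lia).
  rewrite F in P. apply (Z.mul_le_mono_pos_l _ _ b) in P; [|lia].
  assert ((b + 1) * (b + 2) <= (a + b - 1) * (b + 2)) by (apply Z.mul_le_mono_nonneg_r; lia).
  assert (0 <= b * b) by apply Z.square_nonneg. lia.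
- apply (latin_local_latin a b d) in H; lia.
- apply (latin_local_smith_swap a b d) in H; try lia.
  (* The factors [a - d] and [1 + 2 d - a] have sum [1 + d], so their product is at most a quarter
     of [(1 + d)^2]. *)
  assert (Sq : 0 <= (2 * a - 1 - 3 * d) * (2 * a - 1 - 3 * d)) by apply Z.square_nonneg.
  assert ((1 + d) * (1 + d) * 1 <= (1 + d) * (1 + d) * d) by (apply Z.mul_le_mono_nonneg_l; lia). lia.
- apply (latin_local_latin_swap a b d) in H; try lia.
  assert ((a - 1) * (a - 1) * (a + 1) < a * a * (a + b)).
  { apply (Z.lt_le_trans _ (a * a * (a + 1))).
    - apply Z.mul_lt_mono_pos_r; [lia|]. lia.
    - apply Z.mul_le_mono_nonneg_l; lia. }
  assert (a * a * (a + b) <= b * b * (a + b)).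
  { apply Z.mul_le_mono_nonneg_r; [lia|]. apply Z.mul_le_mono_nonneg; lia. }
  lia.
Qed.

(** Negative Latin square type, with [A = -a], [B = -b] and the sign of [d] changed. One side does
    not suffice here: the local graph of the graph leaves the swapped Smith case [S1], that of the
    complement the swapped Latin case, and together they bound [d] by 3. *)
Lemma latin_neg (A B d l e lb eb r' s' e' r'' s'' e'' : Z) :
  2 <= A -> A <= B -> 2 <= d ->
  l = A * A - B - 1 -> e = d - 1 -> d * (A + B + 1) = A * (A + 1) ->
  r' + s' = - B + e -> r' * s' = - B * e -> local_data l r' s' e' ->
  lb = B * B - A - 1 -> eb = d + B - A - 1 ->
  r'' + s'' = - A + eb -> r'' * s'' = - A * eb -> local_data lb r'' s'' e'' -> False.
Proof.
intros A2 AB d2 Hl He Hd Hsum Hprod [Hop [He' H]] Hlb Heb Hsum' Hprod' [Hop' [He'' H']].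
assert (B2 : A * A <= B * B) by (apply Z.mul_le_mono_nonneg; lia).
assert (AA : 2 * (A + B + 1) <= A * (A + 1)).
{ rewrite <- Hd. apply Z.mul_le_mono_nonneg_r; lia. }
assert (A4 : 4 <= A).
{ destruct (Z_lt_le_dec A 4); [|trivial]. assert (A = 2 \/ A = 3) as [->| ->] by lia; lia. }
assert (dd : 2 * d <= A).
{ assert (d * (2 * A + 1) <= d * (A + B + 1)) by (apply Z.mul_le_mono_nonneg_l; lia).
  destruct (Z_le_gt_dec (2 * d) A); [trivial|exfalso].
  assert ((A + 1) * (2 * A + 1) <= 2 * d * (2 * A + 1)) by (apply Z.mul_le_mono_nonneg_r; lia). lia. }
assert (S1 : (A - d) * (A + 1 - 2 * d) = d * ((d - 1) * (d - 1))).
{ destruct (roots_eq _ _ _ _ Hsum Hprod) as [[Er Es]|[Er Es]]; subst r' s'; destruct H as [H|H].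
  - exfalso. apply (latin_local_smith (- A) (- B) (- d)) in H; try lia.
    assert (F : (d - 1) * (A - B + 2) = B * B + (A + B + 1) * (B * (B - 2))) by (subst e; lia).
    assert ((d - 1) * (A - B + 2) <= (d - 1) * 2) by (apply Z.mul_le_mono_nonneg_l; lia).
    assert (0 <= (A + B + 1) * (B * (B - 2))).
    { apply Z.mul_nonneg_nonneg; [|apply Z.mul_nonneg_nonneg]; lia. }
    assert (4 * A <= A * A) by (apply Z.mul_le_mono_nonneg_r; lia). lia.
  - apply (latin_local_latin (- A) (- B) (- d)) in H; lia.
  - apply (latin_local_smith_swap (- A) (- B) (- d)) in H; lia.
  - exfalso. apply (latin_local_latin_swap (- A) (- B) (- d)) in H; try lia.
    assert (A * A * (2 * A) <= B * B * (A + B)) by (apply Z.mul_le_mono_nonneg; lia).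
    assert (4 * (A * A) <= A * (A * A)) by (apply Z.mul_le_mono_nonneg_r; lia). lia. }
assert (Hdb : (d + B - A) * (A + B + 1) = B * (B + 1)) by lia.
destruct (roots_eq _ _ _ _ Hsum' Hprod') as [[Er Es]|[Er Es]]; subst r'' s''; destruct H' as [H'|H'].
- apply (latin_local_smith (- B) (- A) (- (d + B - A))) in H'; try lia.
  assert (F : (d + B - A - 1) * (B - A + 2) = A * A + (A + B + 1) * (A * (A - 2))) by (subst eb; lia).
  assert (G : (d + B - A - 1) * (A + B + 1) = B * B - A - 1) by lia.
  assert (G1 : (B * B - A - 1) * (B - A + 2) = (A * A + (A + B + 1) * (A * (A - 2))) * (A + B + 1)).
  { rewrite <- F, <- G. ring. }
  assert (G2 : (B * B - A - 1) * (B - A + 2) <= B * B * B) by (apply Z.mul_le_mono_nonneg; lia).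
  assert (G3 : B * (B * B) <= (A * (A - 2)) * (B * B)).
  { apply Z.mul_le_mono_nonneg_r; [apply Z.square_nonneg|].
    assert (4 * A <= A * A) by (apply Z.mul_le_mono_nonneg_r; lia). lia. }
  assert (G4 : (A * (A - 2)) * (B * B) <= (A * (A - 2)) * ((A + B + 1) * (A + B + 1))).
  { apply Z.mul_le_mono_nonneg_l; [apply Z.mul_nonneg_nonneg; lia|]. apply Z.mul_le_mono_nonneg; lia. }
  assert (0 < A * A * (A + B + 1)) by (apply Z.mul_pos_pos; [apply Z.mul_pos_pos|]; lia). lia.
- apply (latin_local_latin (- B) (- A) (- (d + B - A))) in H'; lia.
- apply (latin_local_smith_swap (- B) (- A) (- (d + B - A))) in H'; try lia.
  set (D := d + B - A) in *.
  assert (BD : B + 1 <= 2 * D).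
  { assert (D * (A + B + 1) <= D * (2 * B + 1)) by (apply Z.mul_le_mono_nonneg_l; lia).
    destruct (Z_le_gt_dec (B + 1) (2 * D)); [trivial|exfalso].
    assert (2 * D * (2 * B + 1) <= B * (2 * B + 1)) by (apply Z.mul_le_mono_nonneg_r; lia). lia. }
  assert (0 <= (B - D) * (2 * D - B - 1)) by (apply Z.mul_nonneg_nonneg; unfold D in *; lia).
  assert (0 < D * ((D - 1) * (D - 1))) by (apply Z.mul_pos_pos; [|apply Z.mul_pos_pos]; unfold D; lia).
  lia.
- apply (latin_local_latin_swap (- B) (- A) (- (d + B - A))) in H'; try lia.
  assert (BA : B < 2 * A).
  { destruct (Z_lt_le_dec B (2 * A)); [trivial|exfalso].
    assert (2 * A * (2 * A) <= B * B) by (apply Z.mul_le_mono_nonneg; lia).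
    assert (4 * (A * A) * (2 * (A + B)) <= B * B * (3 * B)) by (apply Z.mul_le_mono_nonneg; lia).
    assert (8 * (B * B) <= B * (B * B)) by (apply Z.mul_le_mono_nonneg_r; lia).
    assert (8 * B <= B * B) by (apply Z.mul_le_mono_nonneg_r; lia). lia. }
  assert (Ad : A + 1 <= 3 * d).
  { destruct (Z_le_gt_dec (A + 1) (3 * d)); [trivial|exfalso].
    assert (d * (A + B + 1) <= d * (3 * A)) by (apply Z.mul_le_mono_nonneg_l; lia).
    assert (3 * d * A <= A * A) by (apply Z.mul_le_mono_nonneg_r; lia). lia. }
  assert (S2 : (A - d) * (A + 1 - 2 * d) <= (2 * d - 1) * d) by (apply Z.mul_le_mono_nonneg; lia).
  assert (d <= 3).
  { destruct (Z_le_gt_dec d 3); [trivial|exfalso].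
    assert (d * (2 * d - 1) < d * ((d - 1) * (d - 1))); [|lia].
    apply Z.mul_lt_mono_pos_l; [lia|]. assert (4 * d <= d * d) by (apply Z.mul_le_mono_nonneg_r; lia). lia. }
  assert (d = 2 \/ d = 3) as [->| ->] by lia.
  + assert (A = 4 \/ A = 5) as [->| ->] by lia; [|lia].
    (* The values [d = 2], [A = 4], [B = 5] satisfy all the polynomial conditions; they belong to 64
       vertices and valency 27. Integrality excludes them: [He''] becomes [16 e'' = -40]. *)
    assert (B = 5) by lia. subst B. lia.
  + assert (A <= 8) by lia. assert (A = 5 \/ A = 6 \/ A = 7 \/ A = 8) by lia. lia.
Qed.

(** For a strongly regular graph the products are [m - k] and [l + 1 - k]. *)
Lemma opposite_roots (r s : Z) : r * s < 0 -> (1 + r) * (1 + s) < 0 -> opposite r s.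
Proof.
intros H1 H2. unfold opposite.
destruct (Z_lt_le_dec r 1) as [Hr|Hr]; destruct (Z_lt_le_dec s 1) as [Hs|Hs].
- assert (0 <= (- r) * (- s)) by (apply Z.mul_nonneg_nonneg; lia). lia.
- destruct (Z_le_gt_dec r (-2)) as [|G]; [lia|].
  assert (0 <= (1 + r) * (1 + s)) by (apply Z.mul_nonneg_nonneg; lia). lia.
- destruct (Z_le_gt_dec s (-2)) as [|G]; [lia|].
  assert (0 <= (1 + r) * (1 + s)) by (apply Z.mul_nonneg_nonneg; lia). lia.
- assert (0 <= r * s) by (apply Z.mul_nonneg_nonneg; lia). lia.
Qed.

(** With [a = -1 - s] and [d = -1 - e], complementation exchanges [a] and [r] and replaces [d] by
    [r - a + d]. Hence the smaller of the two in absolute value may be put first. *)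
Lemma latin_contra (k l kb lb r s e r' s' e' r'' s'' e'' : Z) :
  opposite r s -> opposite r e -> opposite (-1 - s) (e - 1 - r - s) ->
  latin k r s -> latin kb (-1 - s) (-1 - r) ->
  l = k + r * s + r + s -> lb = kb + r * s - 1 -> e * (k + s) = l * s ->
  r' + s' = r + e -> r' * s' = r * e -> local_data l r' s' e' ->
  r'' + s'' = -1 - s + (e - 1 - r - s) -> r'' * s'' = (-1 - s) * (e - 1 - r - s) ->
  local_data lb r'' s'' e'' -> False.
Proof.
intros O1 O2 O3 L1 L2 Hl Hlb He Hsum Hprod Hloc Hsum' Hprod' Hloc'.
assert (exists a, s = - a - 1) as [a Da] by (exists (- s - 1); lia).
assert (exists d, e = - 1 - d) as [d Dd] by (exists (- 1 - e); lia).
unfold latin in L1, L2. subst s e.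
assert (El : l = a * a + r - 1) by (rewrite Hl, L1; ring).
assert (Elb : lb = r * r + a - 1) by (rewrite Hlb, L2; ring).
assert (Hd : d * (a + r - 1) = a * (a - 1)).
{ apply (mul_cancel (a + 1)); [unfold opposite in O1; lia|]. rewrite El, L1 in He. lia. }
clear He L1 L2 Hl Hlb k kb.
assert (Hd' : (r - a + d) * (a + r - 1) = r * (r - 1)) by lia.
unfold opposite in O1, O2, O3.
destruct (Z_le_gt_dec 1 r) as [r1|r1].
- destruct (Z_le_gt_dec a r) as [ar|ar].
  + apply (latin_pos a r d l (-1 - d) r' s' e'); trivial; try lia.
    destruct (Z.eq_dec a 1); [subst a|lia].
    assert (0 < d * r) by (apply Z.mul_pos_pos; lia). lia.
  + apply (latin_pos r a (r - a + d) lb (-1 - (r - a + d)) r'' s'' e''); trivial; try lia.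
    destruct (Z.eq_dec r 1); [subst r|lia].
    assert (0 < (1 - a + d) * a) by (apply Z.mul_pos_pos; lia). lia.
- destruct (Z_le_gt_dec r a) as [ar|ar].
  + apply (latin_neg (- a) (- r) (- d) l (- d - 1) lb (- d - r + a - 1) r' s' e' r'' s'' e''); trivial; try lia.
  + apply (latin_neg (- r) (- a) (- (r - a + d)) lb (- (r - a + d) - 1) l (- (r - a + d) - a + r - 1) r'' s'' e'' r' s' e'); trivial; try lia.
Qed.

End IntegerParameters.

From mathcomp Require Import all_boot perm zify boolp.

Set Implicit Arguments.
Unset Strict Implicit.
Unset Printing Implicit Defensive.

(** * Homogeneous finite graphs *)

Section SameType.
Variables (V : eqType) (e : rel V).
Hypotheses (e_sym : symmetric e) (e_irr : irreflexive e).

Definition nonadj : rel V := fun x y => (x != y) && ~~ e x y.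

Definition same_type (r : rel V) (s s' : seq V) :=
  (size s == size s') &&
  allrel (fun p q => ((p.1 == q.1) == (p.2 == q.2)) && (r p.1 q.1 == r p.2 q.2))
    (zip s s') (zip s s').

Lemma same_type_size r s s' : same_type r s s' -> size s = size s'.
Proof. by case/andP=> /eqP. Qed.

Lemma same_type_cons x s x' s' : same_type e (x :: s) (x' :: s') =
  all (fun q => ((x == q.1) == (x' == q.2)) && (e x q.1 == e x' q.2)) (zip s s')
  && same_type e s s'.
Proof.
rewrite /same_type /= eqSS [RHS]andbCA; congr (_ && _).
rewrite allrel_consl /= allrel_consr /= !eqxx !e_irr eqxx /=.
rewrite [X in _ && (X && _)](_ : _ =
  all (fun q => ((x == q.1) == (x' == q.2)) && (e x q.1 == e x' q.2)) (zip s s')).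
  by rewrite andbA andbb.
by apply: eq_all => q /=; rewrite ![_.1 == x]eq_sym ![_.2 == x']eq_sym ![e _ x]e_sym ![e _ x']e_sym.
Qed.

Lemma adj_neq x y : e x y -> (x == y) = false.
Proof. by apply: contraTF => /eqP->; rewrite e_irr. Qed.

Lemma nonadj_sym : symmetric nonadj.
Proof. by move=> x y; rewrite /nonadj eq_sym e_sym. Qed.

Lemma nonadj_irr : irreflexive nonadj.
Proof. by move=> x; rewrite /nonadj eqxx. Qed.

Lemma nonadjK x y : (x != y) && ~~ nonadj x y = e x y.
Proof. by rewrite /nonadj negb_and !negbK; case: eqVneq => //= ->; rewrite e_irr. Qed.

Lemma same_type_nonadj s s' : same_type nonadj s s' = same_type e s s'.
Proof.
rewrite /same_type; congr (_ && _); apply: eq_allrel => p q /=.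
rewrite /nonadj; case: (eqVneq p.1) => [->|_]; case: (eqVneq p.2) => [->|_] //=.
  by rewrite !e_irr.
by case: (e _ _); case: (e _ _).
Qed.

End SameType.

Section Homogeneous.
Variable T : finType.
Implicit Types (e : rel T) (A : {set T}) (s : seq T).

(** The extension acts on the whole type and stabilises [A], so that local graphs, and local graphs
    of these, are again subsets of the same type. *)
Definition hom k e A := forall s s',
  size s <= k -> {subset s <= A} -> {subset s' <= A} -> same_type e s s' ->
  exists g : {perm T}, [/\ forall x y, e (g x) (g y) = e x y,
    forall x, (g x \in A) = (x \in A) & map g s = s'].

Definition cn e A s := #|[set z in A | all (e z) s]|.
Definition nb e x := [set y | e x y].

Lemma hom_le e A k k' : k' <= k -> hom k e A -> hom k' e A.
Proof. by move=> le h s s' le'; apply: h; apply: leq_trans le. Qed.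

Lemma hom_cn e A k s s' : hom k e A -> size s <= k -> {subset s <= A} ->
  {subset s' <= A} -> same_type e s s' -> cn e A s = cn e A s'.
Proof.
move=> h le sA sA' st; have [g [ge gA <-]] := h s s' le sA sA' st.
rewrite /cn -(card_imset _ (@perm_inj _ g)); congr #|pred_of_set _|.
apply/setP=> z; rewrite !inE; apply/imsetP/andP => [[y]|[zA /allP az]].
  rewrite !inE => /andP[yA /allP ay] ->; rewrite gA; split=> //.
  by apply/allP=> w /mapP[x xs ->]; rewrite ge ay.
exists (perm_inv g z); last by rewrite permKV.
rewrite !inE -gA permKV zA; apply/allP=> x xs; rewrite -ge permKV az //.
exact: map_f.
Qed.

Lemma cn_perm e A s s' : perm_eq s s' -> cn e A s = cn e A s'.
Proof. by move=> p; apply: eq_card => z; rewrite !inE (perm_all _ p). Qed.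

Section Sym.
Variable e : rel T.
Hypotheses (e_sym : symmetric e) (e_irr : irreflexive e).

(** With [x] prepended to both lists, the automorphism fixes [x] and therefore stabilises its
    neighbourhood. *)
Lemma hom_nb A k x : hom k.+1 e A -> x \in A -> hom k e (A :&: nb e x).
Proof.
move=> h xA s s' le sN sN' st.
have sub (t : seq T) : {subset t <= A :&: nb e x} -> {subset x :: t <= A}.
  by move=> tN y; rewrite inE => /predU1P[->//|/tN]; rewrite inE => /andP[].
have adj (t : seq T) y : {subset t <= A :&: nb e x} -> y \in t -> e x y.
  by move=> tN /tN; rewrite !inE => /andP[].
have [|||g [ge gA [gx gs]]] := h (x :: s) (x :: s') le; [exact: sub|exact: sub| |].
  rewrite same_type_cons // st andbT; apply/allP => -[y y'] yy'.
  have sz := same_type_size st.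
  have [ys ys'] : y \in s /\ y' \in s'.
    split; [rewrite -[s](@unzip1_zip _ _ s s') ?sz //|rewrite -[s'](@unzip2_zip _ _ s s') ?sz //].
      exact: (map_f fst yy').
    exact: (map_f snd yy').
  have ey := adj _ _ sN ys; have ey' := adj _ _ sN' ys'.
  rewrite /= ey ey' eqxx andbT.
  have neq z : e x z -> (x == z) = false by apply: contraTF => /eqP->; rewrite e_irr.
  by rewrite !neq.
exists g; split=> // y; rewrite !inE gA; congr (_ && _).
by rewrite -{1}gx ge.
Qed.

Lemma hom_nonadj A k : hom k e A -> hom k (nonadj e) A.
Proof.
move=> h s s' le sA sA'; rewrite same_type_nonadj // => st.
have [g [ge gA gs]] := h s s' le sA sA' st.
by exists g; split=> // x y; rewrite /nonadj ge (inj_eq perm_inj).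
Qed.

Lemma cn_nb A x s : cn e (A :&: nb e x) s = cn e A (x :: s).
Proof. by apply: eq_card => z; rewrite !inE /= [e z x]e_sym andbA. Qed.

Lemma card_set_sum A (P : pred T) : #|[set z in A | P z]| = \sum_(z in A) P z.
Proof.
rewrite -sum1dep_card [LHS]big_mkcond /= [RHS]big_mkcond /=.
by apply: eq_bigr => z _; case: (z \in A); case: (P z).
Qed.

Lemma sum_pred1 A x : x \in A -> \sum_(z in A) (z == x : nat) = 1.
Proof. by move=> xA; rewrite (bigD1 x) //= eqxx big1 // => z /andP[_ /negPf->]. Qed.

Definition far A x s := #|[set y in A | nonadj e x y && all (e y) s]|.

(** The successor accounts for [x] itself, which is neither [nonadj] nor adjacent to [x]. *)
Lemma cn_split A x s : x \in A -> all (e x) s -> cn e A s = (far A x s + cn e A (x :: s)).+1.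
Proof.
move=> xA xs; rewrite /cn /far !card_set_sum -addn1 -(sum_pred1 xA) -!big_split /=.
apply: eq_bigr => y _; rewrite /nonadj [e y x]e_sym (eq_sym x).
by case: eqVneq => [->|_]; rewrite ?e_irr ?xs //=; case: (e x y); case: (all _ _).
Qed.

Record srg A n k l m : Prop := Srg {
  srg_n : #|A| = n;
  srg_k : forall x, x \in A -> cn e A [:: x] = k;
  srg_l : forall x y, x \in A -> y \in A -> e x y -> cn e A [:: x; y] = l;
  srg_m : forall x y, x \in A -> y \in A -> nonadj e x y -> cn e A [:: x; y] = m
}.

(* Triples inducing a triangle, a path with middle vertex [x], and an edge
   with the isolated vertex [x]. *)
Record srg_triples A a3 a2 a1 : Prop := SrgTriples {
  srg_a3 : forall x y z, x \in A -> y \in A -> z \in A ->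
    e x y -> e x z -> e y z -> cn e A [:: x; y; z] = a3;
  srg_a2 : forall x y z, x \in A -> y \in A -> z \in A ->
    e x y -> e x z -> nonadj e y z -> cn e A [:: x; y; z] = a2;
  srg_a1 : forall x y z, x \in A -> y \in A -> z \in A ->
    nonadj e x y -> nonadj e x z -> e y z -> cn e A [:: x; y; z] = a1
}.

Lemma exists_const (I : finType) (P : pred I) (f : I -> nat) :
  (forall i j, P i -> P j -> f i = f j) -> exists c, forall i, P i -> f i = c.
Proof.
by move=> Pf; case: (pickP P) => [i Pi|P0]; [exists (f i) => j Pj; exact: Pf|exists 0 => j; rewrite P0].
Qed.

Lemma hom_srg A k : 2 <= k -> hom k e A -> exists n k l m, srg A n k l m.
Proof.
move=> k2 h.
have [|k' Hk] := @exists_const T (mem A) (fun x => cn e A [:: x]).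
  move=> i j; rewrite !inE /= => iA jA.
  apply: (hom_cn h); rewrite ?(leq_trans _ k2) //; try by apply/allP; rewrite /= ?iA ?jA.
  by rewrite same_type_cons.
have [|l Hl] := @exists_const (T * T)%type (fun p => [&& p.1 \in A, p.2 \in A & e p.1 p.2])
  (fun p => cn e A [:: p.1; p.2]).
  move=> [x y] [x' y'] /= /and3P[xA yA xy] /and3P[xA' yA' xy'].
  apply: (hom_cn h) => //; try by apply/allP; rewrite /= ?xA ?yA ?xA' ?yA'.
  by rewrite !same_type_cons //= xy xy' !(adj_neq e_irr).
have [|m Hm] := @exists_const (T * T)%type (fun p => [&& p.1 \in A, p.2 \in A & nonadj e p.1 p.2])
  (fun p => cn e A [:: p.1; p.2]).
  move=> [x y] [x' y'] /= /and3P[xA yA /andP[/negPf xy1 /negPf xy2]] /and3P[xA' yA' /andP[/negPf xy1' /negPf xy2']].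
  apply: (hom_cn h) => //; try by apply/allP; rewrite /= ?xA ?yA ?xA' ?yA'.
  by rewrite !same_type_cons //= xy1 xy2 xy1' xy2'.
exists #|A|, k', l, m; split=> // [x y xA yA xy|x y xA yA xy].
  by rewrite (Hl (x, y)) //= xA yA xy.
by rewrite (Hm (x, y)) //= xA yA xy.
Qed.

Lemma hom_triples A k : 3 <= k -> hom k e A -> exists a3 a2 a1, srg_triples A a3 a2 a1.
Proof.
move=> k3 h.
have C (R1 R2 R3 : rel T) :
  (forall x y z x' y' z', R1 x y -> R2 x z -> R3 y z -> R1 x' y' -> R2 x' z' -> R3 y' z' ->
    same_type e [:: x; y; z] [:: x'; y'; z']) ->
  exists c, forall x y z, x \in A -> y \in A -> z \in A -> R1 x y -> R2 x z -> R3 y z ->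
    cn e A [:: x; y; z] = c.
  move=> st.
  have [|c Hc] := @exists_const (T * T * T)%type
    (fun p => [&& p.1.1 \in A, p.1.2 \in A, p.2 \in A, R1 p.1.1 p.1.2, R2 p.1.1 p.2 & R3 p.1.2 p.2])
    (fun p => cn e A [:: p.1.1; p.1.2; p.2]).
    move=> [[x y] z] [[x' y'] z'] /= /and5P[xA yA zA ? /andP[? ?]] /and5P[xA' yA' zA' ? /andP[? ?]].
    apply: (hom_cn h) => //; try by apply/allP; rewrite /= ?xA ?yA ?zA ?xA' ?yA' ?zA'.
    exact: st.
  exists c => x y z xA yA zA h1 h2 h3.
  by rewrite (Hc (x, y, z)) //= xA yA zA h1 h2 h3.
have [|a3 H3] := C e e e.
  move=> x y z x' y' z' h1 h2 h3 h1' h2' h3'.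
  by rewrite !same_type_cons //= h1 h2 h3 h1' h2' h3' !(adj_neq e_irr).
have [|a2 H2] := C e e (nonadj e).
  move=> x y z x' y' z' h1 h2 /andP[/negPf h3 /negPf h4] h1' h2' /andP[/negPf h3' /negPf h4'].
  by rewrite !same_type_cons //= h1 h2 h3 h4 h1' h2' h3' h4' !(adj_neq e_irr).
have [|a1 H1] := C (nonadj e) (nonadj e) e.
  move=> x y z x' y' z' /andP[/negPf h1 /negPf h2] /andP[/negPf h3 /negPf h4] h5.
  move=> /andP[/negPf h1' /negPf h2'] /andP[/negPf h3' /negPf h4'] h5'.
  by rewrite !same_type_cons //= h1 h2 h3 h4 h5 h1' h2' h3' h4' h5' !(adj_neq e_irr).
by exists a3, a2, a1; split.
Qed.

Lemma srg_nb A n k l m a3 a2 a1 x : srg A n k l m -> srg_triples A a3 a2 a1 -> x \in A ->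
  srg (A :&: nb e x) k l a3 a2.
Proof.
move=> sA tA xA; split=> [|y|y z|y z]; rewrite ?cn_nb // ?inE.
- rewrite -(srg_k sA xA); apply: eq_card => y; by rewrite !inE /= andbT e_sym.
- by case/andP=> yA xy; rewrite (srg_l sA).
- by case/andP=> yA xy /andP[zA xz] yz; rewrite (srg_a3 tA).
- by case/andP=> yA xy /andP[zA xz] yz; rewrite (srg_a2 tA).
Qed.

End Sym.
End Homogeneous.

(** * Double counts in strongly regular graphs *)

Section Counting.
Variables (T : finType) (e : rel T).
Hypotheses (e_sym : symmetric e) (e_irr : irreflexive e).
Implicit Types A : {set T}.

Lemma double_count A (P Q : pred T) (R : rel T) :
  \sum_(x in A | P x) #|[set y in A | Q y && R x y]| =
  \sum_(y in A | Q y) #|[set x in A | P x && R x y]|.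
Proof.
have card_cond (P' Q' : pred T) : #|[set y in A | P' y && Q' y]| = \sum_(y in A | P' y) Q' y.
  by rewrite card_set_sum [RHS]big_mkcondr; apply: eq_bigr => y _; case: (P' y).
under eq_bigr => x _ do rewrite card_cond.
by rewrite exchange_big /=; apply: eq_bigr => y _; rewrite card_cond.
Qed.

Lemma sum_cond_const A (P : pred T) (f : T -> nat) c :
  (forall x, x \in A -> P x -> f x = c) ->
  \sum_(x in A | P x) f x = #|[set x in A | P x]| * c.
Proof.
move=> fc; rewrite (eq_bigr (fun=> c)) => [|x /andP[]]; last exact: fc.
by rewrite -sum_nat_const; apply: eq_bigl => x; rewrite inE.
Qed.

Lemma srg_count A n k l m n' kb lb mb x z :
  srg e A n k l m -> srg (nonadj e) A n' kb lb mb ->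
  x \in A -> z \in A -> e x z -> k * (k - 1 - l) = kb * m /\ l < k.
Proof.
move=> sA sB xA zA xz.
have H z' : z' \in A -> e x z' -> k = (far e A x [:: z'] + l).+1.
  by move=> z'A xz'; rewrite -(srg_k sA z'A) (cn_split e_sym e_irr xA) /= ?xz' // (srg_l sA).
have Hf := H z zA xz; split; last by lia.
have E := double_count A (e x) (nonadj e x) e.
rewrite (@sum_cond_const _ _ _ (k - 1 - l)) in E; last first.
  move=> z' z'A xz'; have := H z' z'A xz'; rewrite /far.
  rewrite (_ : [set y in A | _ & all _ _] = [set y in A | nonadj e x y && e z' y]); first lia.
  by apply/setP=> y; rewrite !inE /= andbT [e y _]e_sym.
rewrite (@sum_cond_const _ _ _ m) in E; last first.
  move=> y yA xy; rewrite -(srg_m sA xA yA xy); apply: eq_card => w.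
  by rewrite !inE /= andbT [e w x]e_sym.
rewrite -(srg_k sA xA) -(srg_k sB xA) [X in X * (_ - 1 - _)]/cn [X in _ = X * _]/cn.
rewrite (_ : [set w in A | all (e w) [:: x]] = [set w in A | e x w]); last first.
  by apply/setP=> w; rewrite !inE /= andbT e_sym.
rewrite (_ : [set w in A | all (nonadj e w) [:: x]] = [set w in A | nonadj e x w]); last first.
  by apply/setP=> w; rewrite !inE /= andbT nonadj_sym.
by rewrite (srg_k sA xA).
Qed.

Lemma sum_by_adj A (S : pred T) (f : T -> nat) z p q : z \in A ->
  (forall w, w \in A -> S w -> e z w -> f w = p) ->
  (forall w, w \in A -> S w -> nonadj e z w -> f w = q) ->
  let N := #|[set w in A | S w && e z w]| in
  \sum_(w in A | S w) f w =
  S z * f z + N * p + (#|[set w in A | S w]| - S z - N) * q.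
Proof.
move=> zA fp fq /=.
have C : #|[set w in A | S w]| = S z + #|[set w in A | S w && e z w]|
    + #|[set w in A | S w && nonadj e z w]|.
  rewrite -[X in X + _ + _]muln1 -(sum_pred1 zA) big_distrr /= !card_set_sum -!big_split /=.
  apply: eq_bigr => w _; rewrite /nonadj [z == w]eq_sym.
  case: eqVneq => [->|_]; rewrite ?e_irr ?andbF ?muln1 ?muln0 //= ?addn0 //.
  by case: (S w); case: (e z w).
rewrite C; set N := #|_|; set M := #|_|.
rewrite (_ : S z + N + M - S z - N = M); last by lia.
rewrite [LHS]big_mkcondr /= -[X in _ = X * f z + _ + _]muln1 -(sum_pred1 zA) big_distrr /= big_distrl /=.
rewrite /N /M !card_set_sum !big_distrl /= -!big_split /=; apply: eq_bigr => w wA.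
rewrite /nonadj [z == w]eq_sym; case: eqVneq => [->|wz].
  by rewrite e_irr andbF /= muln1; case: (S z); rewrite ?mul1n ?mul0n ?addn0.
case Sw: (S w); case ew: (e z w); rewrite ?muln0 ?mul0n ?mul1n ?addn0 //=.
  by rewrite (fp w).
by rewrite (fq w) // /nonadj eq_sym wz ew.
Qed.

Section Triples.
Variables (A : {set T}) (n k l m a3 a2 a1 : nat).
Hypotheses (sA : srg e A n k l m) (tA : srg_triples e A a3 a2 a1).
Variables (x z z' : T).
Hypotheses (xA : x \in A) (zA : z \in A) (zA' : z' \in A) (xz : e x z) (xz' : e x z').

Let F w := far e A x [:: w; z'].

(** Edges are counted between the common neighbours [w] of [x] and [z] and the neighbours [y] of
    [z'] that are far from [x]. Such a [y] meets [a2] or [a1] of the [w], according to whether it is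
    adjacent to [z]. Adding [a1 * F z] avoids a subtraction. *)
Lemma triple_count : \sum_(w in A | e x w && e z w) F w + a1 * F z
  = a2 * F z + a1 * far e A x [:: z'].
Proof.
have E := double_count A (fun w => e x w && e z w) (fun y => nonadj e x y && e z' y) e.
have -> : \sum_(w in A | e x w && e z w) F w
    = \sum_(w in A | e x w && e z w) #|[set y in A | nonadj e x y && e z' y && e w y]|.
  apply: eq_bigr => w _; apply: eq_card => y.
  by rewrite !inE /= andbT [e y w]e_sym [e y z']e_sym; case: (nonadj _ _ _); case: (e w y); case: (e z' y).
rewrite E (bigID (e z)) /=.
rewrite (eq_bigl (fun y => (y \in A) && (nonadj e x y && e z' y && e z y))) => [|y]; last by rewrite !andbA.
rewrite (@sum_cond_const _ _ _ a2); last first.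
  move=> y yA /andP[/andP[xy z'y] zy]; rewrite -(srg_a2 tA zA xA yA _ zy xy) 1?e_sym //.
  apply: eq_card => w; rewrite !inE /= andbT [e w x]e_sym [e w z]e_sym.
  by case: (e x w); case: (e z w); case: (e w y); rewrite ?andbF.
rewrite [X in _ + X + _](eq_bigl (fun y => (y \in A) && (nonadj e x y && e z' y && ~~ e z y))) => [|y]; last by rewrite !andbA.
rewrite (@sum_cond_const _ _ _ a1); last first.
  move=> y yA /andP[/andP[xy z'y] zy]; have yz : nonadj e y z.
    rewrite /nonadj [e y z]e_sym zy andbT; apply: contraTneq xy => ->.
    by rewrite /nonadj xz andbF.
  rewrite -(srg_a1 tA yA xA zA _ yz xz) 1?nonadj_sym //.
  apply: eq_card => w; rewrite !inE /= andbT [e w x]e_sym [e w z]e_sym.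
  by case: (e x w); case: (e z w); case: (e w y); rewrite ?andbF.
have -> : #|[set y in A | nonadj e x y && e z' y && e z y]| = F z.
  apply: eq_card => y; rewrite !inE /= andbT [e y z]e_sym [e y z']e_sym.
  by case: (nonadj _ _ _); case: (e z y); case: (e z' y); rewrite ?andbF.
have -> : far e A x [:: z'] = #|[set y in A | nonadj e x y && e z' y && ~~ e z y]| + F z.
  rewrite /F /far !card_set_sum -big_split /=; apply: eq_bigr => y _.
  by rewrite !andbT [e y z']e_sym [e y z]e_sym; case: (nonadj _ _ _); case: (e z' y); case: (e z y).
lia.
Qed.

Lemma far1 : (far e A x [:: z'] + l).+1 = k.
Proof. by rewrite -(srg_k sA zA') (cn_split e_sym e_irr xA) /= ?xz' // (srg_l sA). Qed.

Lemma far_adj w : w \in A -> e x w -> e w z' -> (F w + a3).+1 = l.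
Proof.
move=> wA xw wz'; rewrite -(srg_l sA wA zA' wz') (cn_split e_sym e_irr xA) /= ?xw ?xz' //.
by rewrite (srg_a3 tA).
Qed.

Lemma far_nonadj w : w \in A -> e x w -> nonadj e w z' -> (F w + a2).+1 = m.
Proof.
move=> wA xw wz'; rewrite -(srg_m sA wA zA' wz') (cn_split e_sym e_irr xA) /= ?xw ?xz' //.
by rewrite (srg_a2 tA).
Qed.

Lemma far_diag : F z' = far e A x [:: z'].
Proof. by apply: eq_card => y; rewrite !inE /= andbT andbb. Qed.

(** This is the entry at [z], [z'] of [N B B^T = (a2 - a1) B B^T + a1 J B^T]. An entry of [B B^T] is
    [k - 1 - l], [l - 1 - a3] or [m - 1 - a2], according to whether the two neighbours of [x] are
    equal, adjacent or nonadjacent. *)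
Lemma triple_eq :
  (e z z') * (k - 1 - l) + cn e A [:: x; z; z'] * (l - 1 - a3)
  + (l - (e z z') - cn e A [:: x; z; z']) * (m - 1 - a2) + a1 * F z
  = a2 * F z + a1 * (k - 1 - l).
Proof.
have Eb : far e A x [:: z'] = k - 1 - l by have := far1; lia.
rewrite -Eb -triple_count (@sum_by_adj _ _ _ z' (l - 1 - a3) (m - 1 - a2)) //; last 2 first.
- by move=> w wA /andP[xw _] z'w; have := far_adj wA xw; rewrite e_sym z'w => /(_ isT); lia.
- by move=> w wA /andP[xw _] z'w; have := far_nonadj wA xw; rewrite nonadj_sym // z'w => /(_ isT); lia.
rewrite xz' far_diag /= -(srg_l sA xA zA xz).
congr (_ + _ * _ + (_ - _ - _) * _ + _); apply: eq_card => w; rewrite !inE /= andbT.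
- by rewrite [e w x]e_sym [e w z]e_sym [e w z']e_sym -!andbA.
- by rewrite [e w x]e_sym [e w z]e_sym.
- by rewrite [e w x]e_sym [e w z]e_sym [e w z']e_sym -!andbA.
Qed.
End Triples.
End Counting.

Lemma nonadj_nonadj (T : eqType) (e : rel T) : irreflexive e -> nonadj (nonadj e) = e.
Proof. by move=> e_irr; apply/funext=> x; apply/funext=> y; exact: nonadjK. Qed.

(** The three conditions exclude disjoint unions of cliques, complete multipartite graphs and
    complete graphs, respectively. *)
Definition nondeg (n k m : nat) := [&& 0 < m, m < k & k.+1 < n].

(* If the local graphs have edges, then [r] is an eigenvalue of theirs, and
   [a2 - a1] is the other one. *)
Definition side (k l m a3 a2 a1 : nat) (r s : Z) :=
  (let k := Z.of_nat k in let l := Z.of_nat l in let m := Z.of_nat m in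
   let a3 := Z.of_nat a3 in let a2 := Z.of_nat a2 in let ep := (a2 - Z.of_nat a1)%Z in
   [/\ r + s = l - m, r * s = m - k, ep * (k + s) = l * s &
     l <> 0 -> r + ep = a3 - a2 /\ r * ep = a2 - l])%Z.

(** * Parameters of the complement *)

Section Counts.
Variables (T : finType) (e : rel T).
Implicit Types A : {set T}.

Lemma cn_gt0P A s : reflect (exists2 z, z \in A & all (e z) s) (0 < cn e A s).
Proof.
rewrite /cn; apply: (iffP card_gt0P) => [[z]|[z zA az]]; last by exists z; rewrite inE zA.
by rewrite inE => /andP[]; exists z.
Qed.

Lemma cn_eq_adj A s w x : cn e A s <= cn e A (x :: s) -> w \in A -> all (e w) s -> e w x.
Proof.
move=> le wA ws; have sub : [set z in A | all (e z) (x :: s)] \subset [set z in A | all (e z) s].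
  by apply/subsetP=> z; rewrite !inE /= => /and3P[-> _ ->].
have : w \in [set z in A | all (e z) s] by rewrite inE wA.
have /eqP <- : [set z in A | all (e z) (x :: s)] == [set z in A | all (e z) s].
  by rewrite eqEcard sub.
by rewrite inE => /and3P[].
Qed.

Hypotheses (e_sym : symmetric e) (e_irr : irreflexive e).

Section Complement.
Variables (A : {set T}) (n k l m n' kb lb mb : nat).
Hypotheses (sA : srg e A n k l m) (sB : srg (nonadj e) A n' kb lb mb).

Let sum_eq f g : {in A, f =1 g} -> \sum_(w in A) f w = \sum_(w in A) g w.
Proof. by move=> fg; apply: eq_bigr. Qed.

Lemma compl_k x : x \in A -> k + kb + 1 = n.
Proof.
move=> xA; rewrite -(sum_pred1 xA) -(srg_k sA xA) -(srg_k sB xA) -(srg_n sA) -sum1_card.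
rewrite /cn !card_set_sum -!big_split; apply: sum_eq => w _ /=.
by rewrite /nonadj !andbT; case: eqVneq => [->|_]; rewrite ?e_irr //=; case: (e w x).
Qed.

(** Inclusion-exclusion, verified pointwise: each vertex [w] contributes equally to both sides. The
    identities for triples below are obtained in the same way. *)
Lemma compl_l x y : x \in A -> y \in A -> nonadj e x y -> lb + 2 + 2 * k = n + m.
Proof.
move=> xA yA xy; rewrite -(srg_m sA xA yA xy) -(srg_l sB xA yA xy) -(srg_n sA) -sum1_card.
rewrite (_ : 2 * k = k + k); last by lia.
rewrite -{1}(srg_k sA xA) -(srg_k sA yA) -{1}[2]/(1 + 1) -{1}(sum_pred1 xA) -{1}(sum_pred1 yA).
rewrite /cn !card_set_sum -!big_split; apply: sum_eq => w _ /=.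
move: xy; rewrite /nonadj !andbT => /andP[/negPf xy1 /negPf xy2].
case: (eqVneq w x) => [->|wx]; first by rewrite e_irr xy1 xy2.
case: (eqVneq w y) => [->|wy]; first by rewrite e_irr e_sym xy2.
by case: (e w x); case: (e w y).
Qed.

Lemma compl_m x y : x \in A -> y \in A -> e x y -> mb + 2 * k = n + l.
Proof.
move=> xA yA xy.
have xy' : nonadj (nonadj e) x y by rewrite nonadj_nonadj.
rewrite -(srg_l sA xA yA xy) -(srg_m sB xA yA xy') -(srg_n sA) -sum1_card.
rewrite (_ : 2 * k = k + k); last by lia.
rewrite -{1}(srg_k sA xA) -(srg_k sA yA).
rewrite /cn !card_set_sum -!big_split; apply: sum_eq => w _ /=.
have xy1 := adj_neq e_irr xy; have yx : e y x by rewrite e_sym.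
rewrite /nonadj !andbT; case: (eqVneq w x) => [->|wx]; first by rewrite e_irr xy xy1.
case: (eqVneq w y) => [->|wy]; first by rewrite e_irr yx.
by case: (e w x); case: (e w y).
Qed.

Section Triples.
Variables (a3 a2 a1 b3 b2 b1 : nat).
Hypotheses (tA : srg_triples e A a3 a2 a1) (tB : srg_triples (nonadj e) A b3 b2 b1).

Lemma compl_a1 x y z : x \in A -> y \in A -> z \in A ->
  nonadj e x y -> nonadj e x z -> e y z -> b2 + 3 * k + a1 + 1 = n + l + 2 * m.
Proof.
move=> xA yA zA xy xz yz.
have yz' : nonadj (nonadj e) y z by rewrite nonadj_nonadj.
have -> : b2 + 3 * k + a1 + 1 = b2 + k + k + k + a1 + 1 by lia.
have -> : n + l + 2 * m = n + m + m + l by lia.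
rewrite -(srg_a2 tB xA yA zA xy xz yz') -(srg_a1 tA xA yA zA xy xz yz).
rewrite -{1}(srg_k sA xA) -{1}(srg_k sA yA) -(srg_k sA zA) -(sum_pred1 xA).
rewrite -{1}(srg_m sA xA yA xy) -(srg_m sA xA zA xz) -(srg_l sA yA zA yz) -(srg_n sA) -sum1_card.
move: xy xz; rewrite /nonadj => /andP[xy1 /negPf xy2] /andP[xz1 /negPf xz2].
have zy : e z y by rewrite e_sym.
rewrite /cn !card_set_sum -!big_split; apply: sum_eq => w _ /=; rewrite !andbT.
case: (eqVneq w x) => [->|wx]; first by rewrite e_irr xy2 xz2.
case: (eqVneq w y) => [->|wy]; first by rewrite e_irr yz e_sym xy2.
case: (eqVneq w z) => [->|wz]; first by rewrite e_irr zy e_sym xz2.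
by case: (e w x); case: (e w y); case: (e w z).
Qed.

Lemma compl_a2 x y z : x \in A -> y \in A -> z \in A ->
  e x y -> e x z -> nonadj e y z -> b1 + 3 * k + a2 = n + 2 * l + m.
Proof.
move=> xA yA zA xy xz yz.
have xy' : nonadj (nonadj e) x y by rewrite nonadj_nonadj.
have xz' : nonadj (nonadj e) x z by rewrite nonadj_nonadj.
have -> : b1 + 3 * k + a2 = b1 + k + k + k + a2 by lia.
have -> : n + 2 * l + m = n + l + l + m by lia.
rewrite -(srg_a1 tB xA yA zA xy' xz' yz) -(srg_a2 tA xA yA zA xy xz yz).
rewrite -{1}(srg_k sA xA) -{1}(srg_k sA yA) -(srg_k sA zA).
rewrite -{1}(srg_l sA xA yA xy) -(srg_l sA xA zA xz) -(srg_m sA yA zA yz) -(srg_n sA) -sum1_card.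
move: yz; rewrite /nonadj => /andP[yz1 /negPf yz2].
have yx : e y x by rewrite e_sym.
have zx : e z x by rewrite e_sym.
rewrite /cn !card_set_sum -!big_split; apply: sum_eq => w _ /=; rewrite !andbT.
case: (eqVneq w x) => [->|wx]; first by rewrite e_irr xy xz.
case: (eqVneq w y) => [->|wy]; first by rewrite e_irr yx yz2.
case: (eqVneq w z) => [->|wz]; first by rewrite e_irr zx [e z y]e_sym yz2.
by case: (e w x); case: (e w y); case: (e w z).
Qed.
End Triples.
End Complement.
End Counts.

(** * Retained eigenvalues of nondegenerate graphs *)

Section Nondegenerate.
Variables (T : finType) (e : rel T) (A : {set T}) (n k l m kb lb mb : nat).
Hypotheses (e_sym : symmetric e) (e_irr : irreflexive e).
Hypotheses (sA : srg e A n k l m) (sB : srg (nonadj e) A n kb lb mb) (nd : nondeg n k m).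

Lemma nondeg_path : exists x y z, [/\ x \in A, y \in A, z \in A, e x y & e x z /\ nonadj e y z].
Proof.
case/and3P: nd => m0 mk kn; have : 0 < #|A| by rewrite (srg_n sA); lia.
case/card_gt0P=> y yA; have := compl_k e_irr sA sB yA => E.
have : 0 < cn (nonadj e) A [:: y] by rewrite (srg_k sB yA); lia.
case/cn_gt0P=> z zA /andP[zy _].
have : 0 < cn e A [:: y; z] by rewrite (srg_m sA) // nonadj_sym.
case/cn_gt0P=> x xA /and3P[xy xz _].
by exists x, y, z; rewrite nonadj_sym.
Qed.

Lemma nondeg_isolated : exists x y z, [/\ x \in A, y \in A, z \in A, e y z & nonadj e x y /\ nonadj e x z].
Proof.
have [_ [x [y [_ xA yA _ [_ xy]]]]] := nondeg_path.
case/and3P: nd => m0 mk _.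
have [z zA [yz xz]] : exists2 z, z \in A & e z y /\ ~~ e z x.
  case: (pickP [pred z | [&& z \in A, e z y & ~~ e z x]]) => [z /and3P[zA zy zx]|N]; first by exists z.
  suff : k <= m by rewrite leqNgt mk.
  rewrite -(srg_k sA yA) -(srg_m sA xA yA xy); apply: subset_leq_card; apply/subsetP=> z.
  rewrite !inE /= !andbT => /andP[zA zy]; have := N z; rewrite /= zA zy /=.
  by move/negbFE->.
exists x, y, z; split=> //; first by rewrite e_sym.
split=> //; rewrite /nonadj e_sym xz andbT; apply: contraTneq xy => ->.
by rewrite /nonadj yz andbF.
Qed.

Lemma nondeg_facts : [/\ k + kb + 1 = n, lb + 2 + 2 * k = n + m, mb + 2 * k = n + l,
  k * (k - 1 - l) = kb * m & l + 1 < k].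
Proof.
have [x [y [z [xA yA zA xy [xz yz]]]]] := nondeg_path.
have [H1 H2] := srg_count e_sym e_irr sA sB xA yA xy; split=> //.
- exact: (compl_k e_irr sA sB xA).
- exact: (compl_l e_sym e_irr sA sB yA zA yz).
- exact: (compl_m e_sym e_irr sA sB xA yA xy).
have := cn_split e_sym e_irr (s := [:: x]) yA; rewrite /= e_sym xy => /(_ isT).
rewrite (srg_k sA xA) (srg_l sA) // ?[e y x]e_sym //.
suff : 0 < far e A y [:: x] by lia.
by apply/card_gt0P; exists z; rewrite !inE zA yz /= e_sym xz.
Qed.

Lemma nondeg_compl : nondeg n kb mb.
Proof.
case/and3P: nd => m0 mk kn; have [E1 E2 E3 E4 E5] := nondeg_facts.
apply/and3P; split; [|lia|lia].
have [x [y [z [xA yA zA yz [xy xz]]]]] := nondeg_isolated.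
rewrite -(srg_m sB yA zA); last by rewrite nonadj_nonadj.
by apply/cn_gt0P; exists x => //=; rewrite xy xz.
Qed.

Section Triples.
Variables (a3 a2 a1 : nat).
Hypothesis (tA : srg_triples e A a3 a2 a1).

(** If [a2 = l] and [w] is a common neighbour of nonadjacent [u], [v], then every common neighbour
    of [u] and [w] is adjacent to [v] ([adjE]). This spreads to all neighbours of [u], whence
    [k <= m]. *)
Lemma nondeg_a2_neq : 0 < l -> a2 <> l.
Proof.
move=> l0 a2l.
have adjE u v w z : u \in A -> v \in A -> w \in A -> e w u -> e w v -> nonadj e u v ->
    z \in A -> e z w -> e z u -> e z v.
  move=> uA vA wA wu wv uv zA zw zu; apply: (@cn_eq_adj _ _ A [:: w; u]) => //=; last by rewrite zw zu.
  rewrite (srg_l sA) // (@cn_perm _ e A [:: v; w; u] [:: w; u; v]); last first.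
    by rewrite -(perm_rot 1); exact: perm_refl.
  by rewrite (srg_a2 tA) // a2l.
have [c [u [v [cA uA vA cu [cv uv]]]]] := nondeg_path.
have sub w : w \in A -> e w u -> e w v.
  move=> wA wu; case ew: (e w c); first exact: (adjE u v c).
  case: (eqVneq w c) => [->//|wc].
  have uw : e u w by rewrite e_sym.
  have uc : e u c by rewrite e_sym.
  (* As [a2 = l > 0], the path [w], [u], [c] has a common neighbour [w']; it is adjacent to [v] and
     takes over the role of [c]. *)
  have : 0 < cn e A [:: u; w; c] by rewrite (srg_a2 tA) // ?a2l // /nonadj wc ew.
  case/cn_gt0P=> w' w'A /and4P[w'u w'w w'c _].
  have w'v : e w' v by apply: (adjE u v c).
  by apply: (adjE u v w') => //; rewrite e_sym.
case/and3P: nd => _ + _; rewrite ltnNge => /negP; apply.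
rewrite -(srg_k sA uA) -(srg_m sA uA vA uv); apply: subset_leq_card; apply/subsetP=> w.
by rewrite !inE /= => /and3P[wA wu _]; rewrite wA wu sub.
Qed.

Lemma a2_le_l : a2 <= l /\ a1 <= l.
Proof.
have [x [y [z [xA yA zA xy [xz yz]]]]] := nondeg_path.
have [x' [y' [z' [xA' yA' zA' yz' [xy' xz']]]]] := nondeg_isolated.
have sub s s' : {subset s <= s'} -> cn e A s' <= cn e A s.
  move=> ss'; apply: subset_leq_card; apply/subsetP=> w; rewrite !inE => /andP[-> /allP aw] /=.
  by apply/allP=> v /ss' /aw.
split.
  rewrite -(srg_a2 tA xA yA zA xy xz yz) -(srg_l sA xA yA xy); apply: sub => w.
  by rewrite !inE => /orP[->|->] //; rewrite orbT.
rewrite -(srg_a1 tA xA' yA' zA' xy' xz' yz') -(srg_l sA yA' zA' yz'); apply: sub => w.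
by rewrite !inE => /orP[->|->]; rewrite !orbT.
Qed.

Lemma retained_side : 0 < l -> exists r, side k l m a3 a2 a1 r (Z.of_nat l - Z.of_nat m - r).
Proof.
move=> l0; have [E1 E2 E3 E4 E5] := nondeg_facts.
have [la2 la1] := a2_le_l.
have [x [y [z [xA yA zA xy [xz yz]]]]] := nondeg_path.
have T0 := triple_eq e_sym e_irr sA tA xA yA yA xy xy.
have T2 := triple_eq e_sym e_irr sA tA xA yA zA xy xz.
have [w wA [wx wy]] : exists2 w, w \in A & e w x /\ e w y.
  have : 0 < cn e A [:: x; y] by rewrite (srg_l sA).
  by case/cn_gt0P=> w wA /and3P[wx wy _]; exists w.
have xw : e x w by rewrite e_sym.
have yw : e y w by rewrite e_sym.
have T1 := triple_eq e_sym e_irr sA tA xA yA wA xy xw.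
have a2n := nondeg_a2_neq l0.
have F0 := far1 e_sym e_irr sA xA yA xy.
have F1 := far_adj e_sym e_irr sA tA xA wA xw yA xy yw.
have F2 := far_nonadj e_sym e_irr sA tA xA zA xz yA xy yz.
have yz' : e y z = false by case/andP: yz => _ /negPf.
rewrite e_irr far_diag in T0; rewrite yw (srg_a3 tA) // in T1.
rewrite yz' (srg_a2 tA) // in T2.
have C : cn e A [:: x; y; y] = l.
  by rewrite -(srg_l sA xA yA xy); apply: eq_card => v; rewrite !inE /= andbT andbb.
rewrite C in T0.
(* The truncated differences are actual cardinalities [b], [p], [q], so the equations carry over to
   the integers. *)
set b := far e A x [:: y] in F0 T0; set p := far e A x [:: y; w] in F1 T1.
set q := far e A x [:: y; z] in F2 T2.
have Eb : k - 1 - l = b by rewrite -F0; clear; lia.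
have Ep : l - 1 - a3 = p by rewrite -F1; clear; lia.
have Eq : m - 1 - a2 = q by rewrite -F2; clear; lia.
have Zb : (Z.of_nat k - 1 - Z.of_nat l = Z.of_nat b)%Z by rewrite -F0; clear; lia.
have Zp : (Z.of_nat l - 1 - Z.of_nat a3 = Z.of_nat p)%Z by rewrite -F1; clear; lia.
have Zq : (Z.of_nat m - 1 - Z.of_nat a2 = Z.of_nat q)%Z by rewrite -F2; clear; lia.
rewrite /= ?subn0 ?subnn ?mul0n ?mul1n ?add0n !(Eb, Ep, Eq) in T0 T1 T2.
have [|||||r [R1 [R2 [R3 R4]]]] := retained_root (Z.of_nat k) (Z.of_nat l) (Z.of_nat m)
  (Z.of_nat a3) (Z.of_nat a2) (Z.of_nat a1).
- by move: E5; clear; lia.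
- by move: a2n; clear; lia.
- by rewrite Zb Zp; move: T0; clear; lia.
- by rewrite Zb Zp Zq; move: T1; clear; lia.
- have la2q : a2 * q <= l * q by rewrite leq_mul2r la2 orbT.
  by rewrite Zb Zp Zq; move: T2 la2q; rewrite mulnBl; clear; lia.
by exists r; split=> //; move: R1 R2; clear; lia.
Qed.

End Triples.
End Nondegenerate.

Section SmithOrLatin.
Variables (T : finType) (e : rel T) (A : {set T}) (n k l m kb lb mb a3 a2 a1 b3 b2 b1 : nat).
Hypotheses (e_sym : symmetric e) (e_irr : irreflexive e).
Hypotheses (sA : srg e A n k l m) (sB : srg (nonadj e) A n kb lb mb) (nd : nondeg n k m).
Hypotheses (tA : srg_triples e A a3 a2 a1) (tB : srg_triples (nonadj e) A b3 b2 b1).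

Let ep := (Z.of_nat a2 - Z.of_nat a1)%Z.
Let epb := (Z.of_nat b2 - Z.of_nat b1)%Z.

Lemma compl_eps : epb = (ep - 1 - (Z.of_nat l - Z.of_nat m))%Z.
Proof.
have [x [y [z [xA yA zA xy [xz yz]]]]] := nondeg_path e_sym e_irr sA sB nd.
have [x' [y' [z' [xA' yA' zA' yz' [xy' xz']]]]] := nondeg_isolated e_sym e_irr sA sB nd.
have := compl_a1 e_sym e_irr sA tA tB xA' yA' zA' xy' xz' yz'.
have := compl_a2 e_sym e_irr sA tA tB xA yA zA xy xz yz.
rewrite /ep /epb; clear; lia.
Qed.

Local Open Scope Z_scope.

(** The roots retained by the graph and by its complement either correspond under [t -> -1 - t],
    which is the Smith case, or do not, which is the Latin case. *)
Lemma smith_or_latin : (0 < l)%N || (0 < lb)%N ->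
  exists r s rb sb, [/\ opposite r s, side k l m a3 a2 a1 r s, side kb lb mb b3 b2 b1 rb sb &
    (rb = -1 - r /\ sb = -1 - s /\ smith (Z.of_nat k) r s /\ smith (Z.of_nat kb) rb sb) \/
    [/\ (0 < l)%N, (0 < lb)%N & rb = -1 - s /\ sb = -1 - r /\ latin (Z.of_nat k) r s /\ latin (Z.of_nat kb) rb sb]].
Proof.
move=> ll; have [E1 E2 E3 E4 E5] := nondeg_facts e_sym e_irr sA sB nd.
have ndb := nondeg_compl e_sym e_irr sA sB nd.
have nsym : symmetric (nonadj e) := nonadj_sym e_sym.
have nirr : irreflexive (nonadj e) := @nonadj_irr _ e.
have sA' : srg (nonadj (nonadj e)) A n k l m by rewrite nonadj_nonadj.
have [_ _ _ E4' E5'] := nondeg_facts nsym nirr sB sA' ndb.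
have [la2 la1] := a2_le_l e_sym e_irr sA sB nd tA.
have [lb2 lb1] := a2_le_l nsym nirr sB sA' ndb tB.
have Eps := compl_eps.
have op (r s : Z) : r + s = Z.of_nat l - Z.of_nat m -> r * s = Z.of_nat m - Z.of_nat k -> opposite r s.
  by move: nd => /and3P[m0 mk kn] rs1 rs2; apply: opposite_roots; lia.
have srgZ : Z.of_nat k * (Z.of_nat k - 1 - Z.of_nat l) = Z.of_nat kb * Z.of_nat m by lia.
have srgZ' : Z.of_nat kb * (Z.of_nat kb - 1 - Z.of_nat lb) = Z.of_nat k * Z.of_nat mb by lia.
have fin (r s rb sb : Z) : side k l m a3 a2 a1 r s -> side kb lb mb b3 b2 b1 rb sb ->
  (rb = -1 - r /\ sb = -1 - s) \/ [/\ (0 < l)%N, (0 < lb)%N & rb = -1 - s /\ sb = -1 - r] ->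
  exists r s rb sb, [/\ opposite r s, side k l m a3 a2 a1 r s, side kb lb mb b3 b2 b1 rb sb &
    (rb = -1 - r /\ sb = -1 - s /\ smith (Z.of_nat k) r s /\ smith (Z.of_nat kb) rb sb) \/
    [/\ (0 < l)%N, (0 < lb)%N & rb = -1 - s /\ sb = -1 - r /\ latin (Z.of_nat k) r s /\ latin (Z.of_nat kb) rb sb]].
  move=> H Hb rel; have [H1 H2 H3 _] := H; have [B1 B2 B3 _] := Hb.
  have o := op r s H1 H2; exists r, s, rb, sb; split=> //.
  have ob : opposite rb sb.
    by move: o; rewrite /opposite; case: rel => [[-> ->]|[_ _ [-> ->]]]; clear; lia.
  move: nd => /and3P[m0 mk kn]; move: ndb => /and3P[m0' mk' kn'].
  rewrite -/ep in H3; rewrite -/epb in B3.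
  case: rel => [[R1 R2]|[l0 lb0 [R1 R2]]]; [left|right; split=> //];
    rewrite R1 R2 in B3 ob B1 B2 *; split=> //; split=> //; split.
  - apply: (smith_case (Z.of_nat k) (Z.of_nat l) (Z.of_nat m) (Z.of_nat kb) (Z.of_nat lb) r s ep) => //; lia.
  - apply: (smith_case (Z.of_nat kb) (Z.of_nat lb) (Z.of_nat mb) (Z.of_nat k) (Z.of_nat l) (-1 - r) (-1 - s) epb) => //; lia.
  - apply: (latin_case (Z.of_nat k) (Z.of_nat l) (Z.of_nat m) (Z.of_nat kb) (Z.of_nat lb) r s ep) => //; lia.
  - apply: (latin_case (Z.of_nat kb) (Z.of_nat lb) (Z.of_nat mb) (Z.of_nat k) (Z.of_nat l) (-1 - s) (-1 - r) epb) => //; lia.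
have pos0 (i : nat) : i = 0%N \/ (0 < i)%N by case: i => [|i]; [left|right].
case: (pos0 l) => [l0|l0]; last case: (pos0 lb) => [lb0|lb0].
(* For [l = 0] the local graphs have no edges and distinguish no root of the graph, so [r] may be
   chosen to match the one retained by the complement. *)
- have lb0 : (0 < lb)%N by move: ll; rewrite l0.
  have [rb Hb] := retained_side nsym nirr sB sA' ndb tB lb0.
  set sb := Z.of_nat lb - Z.of_nat mb - rb in Hb; have [B1 B2 B3 _] := Hb.
  apply: (fin (-1 - rb) (-1 - sb) rb sb) => //; last by left; lia.
  by rewrite /side l0; split; try lia; move: la2 la1; rewrite l0; case: (a2) (a1) => [|?] [|?].
- have [r H] := retained_side e_sym e_irr sA sB nd tA l0.
  set s := Z.of_nat l - Z.of_nat m - r in H; have [H1 H2 H3 _] := H.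
  apply: (fin r s (-1 - r) (-1 - s)) => //; last by left.
  by rewrite /side lb0; split; try lia; move: lb2 lb1; rewrite lb0; case: (b2) (b1) => [|?] [|?].
- have [r H] := retained_side e_sym e_irr sA sB nd tA l0.
  have [rb Hb] := retained_side nsym nirr sB sA' ndb tB lb0.
  set s := Z.of_nat l - Z.of_nat m - r in H; have [H1 H2 H3 _] := H.
  set sb := Z.of_nat lb - Z.of_nat mb - rb in Hb; have [B1 B2 B3 _] := Hb.
  apply: (fin r s rb sb) => //.
  by have [[]|[]] := roots_eq (-1 - r) (-1 - s) rb sb ltac:(lia) ltac:(lia) => ? ?; [left|right].
Qed.

End SmithOrLatin.

(** * Descent through nested local graphs *)

Section FiveHomogeneous.
Variable T : finType.
Implicit Types (A : {set T}) (e : rel T).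

Definition eps (a2 a1 : nat) : Z := (Z.of_nat a2 - Z.of_nat a1)%Z.

Section Graph.
Variable e : rel T.
Hypotheses (e_sym : symmetric e) (e_irr : irreflexive e).

Section LocalData.
Variables (A : {set T}) (n k l m : nat).
Hypotheses (hA : hom 3 e A) (sA : srg e A n k l m) (nd : nondeg n k m).

Lemma compl_srg : exists kb lb mb, srg (nonadj e) A n kb lb mb.
Proof.
have [n' [kb [lb [mb sB]]]] := hom_srg (nonadj_sym e_sym) (@nonadj_irr _ e) (isT : 2 <= 3) (hom_nonadj e_irr hA).
by exists kb, lb, mb; have <- : n' = n by rewrite -(srg_n sA) -(srg_n sB).
Qed.

Local Open Scope Z_scope.

Lemma srg_local_data (r s : Z) : r + s = Z.of_nat l - Z.of_nat m ->
  r * s = Z.of_nat m - Z.of_nat k ->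
  exists r' s' a3 a2 a1, [/\ srg_triples e A a3 a2 a1, side k l m a3 a2 a1 r' s' &
    local_data (Z.of_nat k) r' s' (eps a2 a1)].
Proof.
move=> rs1 rs2; have [kb [lb [mb sB]]] := compl_srg.
have [a3 [a2 [a1 tA]]] := hom_triples e_sym e_irr (isT : (3 <= 3)%N) hA.
have [b3 [b2 [b1 tB]]] := hom_triples (nonadj_sym e_sym) (@nonadj_irr _ e) (isT : (3 <= 3)%N) (hom_nonadj e_irr hA).
have [F1 F2 F3 F4 F5] := nondeg_facts e_sym e_irr sA sB nd.
have ll : (0 < l)%N || (0 < lb)%N.
  have /and3P[m0 _ _] := nd.
  have /and3P[mb0 _ _] := nondeg_compl e_sym e_irr sA sB nd.
  case: (posnP l) => [l0|//]; case: (posnP lb) => [lb0|//]; exfalso.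
  move: F1 F2 F3 F4 F5 m0 mb0 rs1 rs2; rewrite l0 lb0; clear => F1 F2 F3 F4 F5 m0 mb0 rs1 rs2.
  have m1 : m = 1%N by lia.
  have kk : kb = k by lia.
  have k2 : k = 2%N by move: F4; rewrite m1 kk; nia.
  (* The remaining parameters are those of the pentagon, whose eigenvalues are irrational, whereas
     [r] and [s] are integers here. *)
  have E : s * (s + 1) = 1.
    have -> : s + 1 = - r by move: rs1; rewrite m1; clear; lia.
    by move: rs2; rewrite m1 k2; clear; lia.
  by case: (Z.mul_eq_1 s (s + 1) E) => Es; move: E; rewrite Es.
have [r' [s' [rb [sb [o S _ SL]]]]] := smith_or_latin e_sym e_irr sA sB nd tA tB ll.
exists r', s', a3, a2, a1; split=> //; have [S1 S2 S3 _] := S.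
have El : Z.of_nat l = Z.of_nat k + r' * s' + r' + s' by move: S1 S2; clear; lia.
split=> //; split; first by rewrite -El -S3.
by case: SL => [[_ [_ []]]|[_ _ [_ [_ []]]]]; [left|right].
Qed.

Lemma nb_mu kb lb mb a3 a2 a1 : srg (nonadj e) A n kb lb mb -> srg_triples e A a3 a2 a1 -> (0 < l)%N ->
  (l * (l - 1 - a3) = a2 * (k - 1 - l))%N.
Proof.
move=> sB tA l0; have [x [y [z [xA yA zA xy [xz yz]]]]] := nondeg_path e_sym e_irr sA sB nd.
have T0 := triple_eq e_sym e_irr sA tA xA yA yA xy xy.
have F0 := far1 e_sym e_irr sA xA yA xy.
rewrite e_irr far_diag in T0; move: T0.
have -> : cn e A [:: x; y; y] = l.
  by rewrite -(srg_l sA xA yA xy); apply: eq_card => v; rewrite !inE /= andbT andbb.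
set b := far e A x [:: y] in F0 *; have -> : (k - 1 - l = b)%N by rewrite -F0; clear; lia.
by rewrite /= subn0 subnn !mul0n add0n addn0; clear; lia.
Qed.

(** Opposite roots make [r * eps a2 a1 = a2 - l] and [(1 + r) * (1 + eps a2 a1) = 1 + a3 - l]
    negative. Counting with [nb_mu] then excludes [a2 = 0]. *)
Lemma nb_nondeg r s a3 a2 a1 : srg_triples e A a3 a2 a1 -> side k l m a3 a2 a1 r s -> (0 < l)%N ->
  opposite r (eps a2 a1) -> nondeg k l a2.
Proof.
move=> tA [_ _ _ R] l0 o; have [kb [lb [mb sB]]] := compl_srg.
have [F1 F2 F3 F4 F5] := nondeg_facts e_sym e_irr sA sB nd.
have [|R1 R2] := R; first by move: l0; clear; lia.
have E0 := nb_mu sB tA l0; rewrite -/(eps a2 a1) in R1 R2.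
have P1 : r * eps a2 a1 < 0.
  by case: o => -[? ?]; [apply: Z.mul_pos_neg | apply: Z.mul_neg_pos]; lia.
have P2 : (1 + r) * (1 + eps a2 a1) < 0.
  by case: o => -[? ?]; [apply: Z.mul_pos_neg | apply: Z.mul_neg_pos]; lia.
have Q1 : (a2 < l)%N by move: R2 P1; clear; lia.
have Q2 : (a3 + 1 < l)%N by move: R1 R2 P2; clear; lia.
apply/and3P; split=> //; last by move: F5; clear; lia.
rewrite lt0n; apply/eqP => a20; move: E0; rewrite a20 mul0n => /eqP; rewrite muln_eq0.
by case/orP => /eqP; move: l0 Q2; clear; lia.
Qed.

End LocalData.

Section Local.
Variables (A : {set T}) (n k l m : nat).
Hypotheses (hA : hom 3 e A) (sA : srg e A n k l m) (nd : nondeg n k m).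
Local Open Scope Z_scope.

Lemma nb_opposite r s a3 a2 a1 x : x \in A -> hom 4 e A -> srg_triples e A a3 a2 a1 ->
  side k l m a3 a2 a1 r s -> nondeg k l a2 -> opposite r (eps a2 a1).
Proof.
move=> xA hA4 tA [_ _ _ R] ndN; have sN := srg_nb e_sym sA tA xA.
have hN := hom_nb e_sym e_irr hA4 xA.
have [n' [kb [lb [mb sB]]]] := hom_srg (nonadj_sym e_sym) (@nonadj_irr _ e) (isT : (2 <= 3)%N) (hom_nonadj e_irr hN).
have En : n' = k by rewrite -(srg_n sN) -(srg_n sB).
rewrite En in sB; have [_ _ _ _ F] := nondeg_facts e_sym e_irr sN sB ndN.
case/and3P: ndN => m0 mk kn; have [|R1 R2] := R; first by move: mk; clear; lia.
rewrite -/(eps a2 a1) in R1 R2; apply: opposite_roots.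
  by rewrite R2; move: mk; clear; lia.
have -> : (1 + r) * (1 + eps a2 a1) = 1 + (r + eps a2 a1) + r * eps a2 a1 by clear; lia.
by rewrite R1 R2; move: F; clear; lia.
Qed.

Lemma smith_nb r s a3 a2 a1 x : x \in A -> hom 4 e A -> srg_triples e A a3 a2 a1 ->
  side k l m a3 a2 a1 r s -> smith (Z.of_nat k) r s -> r <= -2 -> 1 <= s ->
  1 <= eps a2 a1 -> r * r + r - 1 <= eps a2 a1 -> eps a2 a1 <> r * r + r ->
  nondeg k l a2 /\ exists c3 c2 c1, [/\ srg_triples e (A :&: nb e x) c3 c2 c1,
    side l a3 a2 c3 c2 c1 r (eps a2 a1), smith (Z.of_nat l) r (eps a2 a1),
    eps a2 a1 = - r * (r * r + r - 1) & 2 * eps c2 c1 = eps a2 a1 + r * r + 2 * r].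
Proof.
move=> xA hA4 tA S sm r2 s1 e1 er en; have [S1 S2 S3 S4] := S.
have [kb [lb [mb sB]]] := compl_srg hA sA.
have [la2 _] := a2_le_l e_sym e_irr sA sB nd tA.
have l0 : (0 < l)%N by move: la2 e1; rewrite /eps; clear; lia.
have o : opposite r (eps a2 a1) by right.
have ndN := nb_nondeg hA sA nd tA S l0 o; split=> //.
have sN := srg_nb e_sym sA tA xA; have hN := hom_nb e_sym e_irr hA4 xA.
have [|R1 R2] := S4; first by move: l0; clear; lia.
rewrite -/(eps a2 a1) in S3 R1 R2.
have [r' [s' [c3 [c2 [c1 [tN SN LN]]]]]] := srg_local_data hN sN ndN R1 R2.
have [N1 N2 _ _] := SN.
have El : Z.of_nat l = Z.of_nat k + r * s + r + s by move: S1 S2; clear; lia.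
have Eeps : 2 * eps a2 a1 = s + r * r + 2 * r.
  by apply: (smith_eps (Z.of_nat k)) => //; [right|rewrite -El].
have [Er [Es [Ee [sml Ee']]]] := smith_step (Z.of_nat k) r s (eps a2 a1) (Z.of_nat l) r' s' (eps c2 c1)
  r2 s1 sm Eeps El e1 er en (etrans N1 (esym R1)) (etrans N2 (esym R2)) LN.
by exists c3, c2, c1; split=> //; move: SN; rewrite Er Es.
Qed.

End Local.

Local Open Scope Z_scope.

(** A first descent fixes [eps a2 a1] and with it [eps c2 c1] one level below; a second descent with
    the same [r] requires the value excluded by [smith_twice]. *)
Lemma smith_contra A n k l m r s a3 a2 a1 x : x \in A -> hom 5 e A -> srg e A n k l m -> nondeg n k m ->
  srg_triples e A a3 a2 a1 ->
  side k l m a3 a2 a1 r s -> smith (Z.of_nat k) r s -> r <= -2 -> 1 <= s ->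
  1 <= eps a2 a1 -> r * r + r - 1 <= eps a2 a1 -> eps a2 a1 <> r * r + r -> False.
Proof.
move=> xA hA sA nd tA S sm r2 s1 e1 er en.
have h3 := hom_le (isT : (3 <= 5)%N) hA; have h4 := hom_le (isT : (4 <= 5)%N) hA.
have [ndN [c3 [c2 [c1 [tN SN smN Ee Ee']]]]] := smith_nb h3 sA nd xA h4 tA S sm r2 s1 e1 er en.
have hN := hom_nb e_sym e_irr hA xA; have sN := srg_nb e_sym sA tA xA.
have [f1 [f2 [f3 f4]]] := smith_twice r (eps a2 a1) (eps c2 c1) r2 Ee Ee'.
have : (0 < #|A :&: nb e x|)%N by rewrite (srg_n sN); case/and3P: ndN; clear; lia.
case/card_gt0P=> y yN.
have [_ [d3 [d2 [d1 [_ _ _ E _]]]]] := smith_nb (hom_le (isT : (3 <= 4)%N) hN) sN ndN yN hN tN SN smN r2 e1 f1 f2 f3.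
exact: f4 E.
Qed.

End Graph.

Section TwoSided.
Variable e : rel T.
Hypotheses (e_sym : symmetric e) (e_irr : irreflexive e).
Variables (A : {set T}) (n k l m kb lb mb a3 a2 a1 b3 b2 b1 : nat).
Hypotheses (sA : srg e A n k l m) (sB : srg (nonadj e) A n kb lb mb) (nd : nondeg n k m).
Hypotheses (tA : srg_triples e A a3 a2 a1) (tB : srg_triples (nonadj e) A b3 b2 b1).
Hypothesis hA : hom 5 e A.
Let nsym := nonadj_sym e_sym.
Let nirr := @nonadj_irr _ e.
Local Open Scope Z_scope.

Let ex_vertex : exists x, x \in A.
Proof.
have : (0 < #|A|)%N by rewrite (srg_n sA); case/and3P: nd; clear; lia.
by case/card_gt0P=> x; exists x.
Qed.

(** If [l = 0 < lb], the Smith case holds with [eps a2 a1 = 0], hence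
    [eps b2 b1 = rb * rb + rb - 1]. One descent in the complement multiplies this value by [- rb],
    which is at least 2. *)
Lemma triangle_free_compl : l = 0%N -> lb = 0%N.
Proof.
move=> l0; case: (posnP lb) => [//|lb0]; exfalso.
have ndb := nondeg_compl e_sym e_irr sA sB nd.
have [x xA] := ex_vertex.
have [|r [s [rb [sb [o S Sb SL]]]]] := smith_or_latin e_sym e_irr sA sB nd tA tB; first by rewrite lb0 orbT.
case: SL => [[Er [Es [sm smb]]]|[]]; last by rewrite l0.
have [S1 S2 S3 _] := S; have [B1 B2 B3 B4] := Sb.
have [la2 la1] := a2_le_l e_sym e_irr sA sB nd tA.
have Eps := compl_eps e_sym e_irr sA sB nd tA tB; rewrite -/(eps a2 a1) -/(eps b2 b1) in S3 B3 B4 Eps.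
have e0 : eps a2 a1 = 0 by move: la2 la1; rewrite /eps l0; clear; lia.
have E1 : 2 * eps a2 a1 = s + r * r + 2 * r.
  apply: (smith_eps (Z.of_nat k)) => //; rewrite S3; congr (_ * _).
  by move: S1 S2; clear; lia.
have r1 : 1 <= r.
  case: o => [[]//|[r2 s1]]; exfalso; move: E1; rewrite e0.
  have : 0 <= (- r) * (- r - 2) by apply: Z.mul_nonneg_nonneg; lia.
  by move: s1; clear; lia.
have E2 : eps b2 b1 = rb * rb + rb - 1.
  by rewrite Eps e0 -S1 Er; move: E1; rewrite e0; clear; lia.
have rb2 : rb <= -2 by lia.
have P : 2 <= rb * (rb + 1).
  have -> : rb * (rb + 1) = (- rb) * (- rb - 1) by clear; lia.
  have : 2 * (- rb - 1) <= (- rb) * (- rb - 1) by apply: Z.mul_le_mono_nonneg_r; lia.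
  by move: rb2; clear; lia.
have [||||] := smith_nb nsym nirr (hom_le (isT : (3 <= 5)%N) (hom_nonadj e_irr hA)) sB ndb xA
  (hom_le (isT : (4 <= 5)%N) (hom_nonadj e_irr hA)) tB Sb smb rb2.
- by case: o; rewrite Es; move: r1; clear; lia.
- by rewrite E2; move: P; clear; lia.
- by rewrite E2; clear; lia.
- by rewrite E2; clear; lia.
move=> _ [c3 [c2 [c1 [_ _ _ E _]]]].
have : (rb + 1) * (rb * rb + rb - 1) = 0 by rewrite -E2 in E *; move: E; clear; lia.
by move=> /(prod_eq0 _ _) H; have := H ltac:(lia); move: P; clear; lia.
Qed.

Lemma local_nondeg_contra : nondeg k l a2 -> nondeg kb lb b2 -> False.
Proof.
move=> ndN ndNb; have ndb := nondeg_compl e_sym e_irr sA sB nd.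
have hB := hom_nonadj e_irr hA; have [x xA] := ex_vertex.
have l0 : (0 < l)%N by case/and3P: ndN; clear; lia.
have lb0 : (0 < lb)%N by case/and3P: ndNb; clear; lia.
have [|r [s [rb [sb [o S Sb SL]]]]] := smith_or_latin e_sym e_irr sA sB nd tA tB; first by rewrite l0.
have oN := nb_opposite e_sym e_irr sA xA (hom_le (isT : (4 <= 5)%N) hA) tA S ndN.
have oNb := nb_opposite nsym nirr sB xA (hom_le (isT : (4 <= 5)%N) hB) tB Sb ndNb.
have [S1 S2 S3 S4] := S; have [B1 B2 B3 B4] := Sb.
have Eps := compl_eps e_sym e_irr sA sB nd tA tB.
rewrite -/(eps a2 a1) -/(eps b2 b1) in S3 S4 B3 B4 Eps.
have El : Z.of_nat l = Z.of_nat k + r * s + r + s by move: S1 S2; clear; lia.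
have Elb : Z.of_nat lb = Z.of_nat kb + rb * sb + rb + sb by move: B1 B2; clear; lia.
case: SL => [[Er [Es [sm smb]]]|[_ _ [Er [Es [la lab]]]]].
  have Eeps : 2 * eps a2 a1 = s + r * r + 2 * r.
    by apply: (smith_eps (Z.of_nat k)) => //; rewrite -El.
  have Eepsb : 2 * eps b2 b1 = sb + rb * rb + 2 * rb.
    by apply: (smith_eps (Z.of_nat kb)) => //; [move: o; rewrite Er Es /opposite; clear; lia|rewrite -Elb].
  have [r2|r2] : r <= -2 \/ rb <= -2 by move: o; rewrite Er /opposite; clear; lia.
    (* Here [eps b2 b1 = r * r + r - 1 - eps a2 a1]; it is at most [-2], because the other root [rb]
       of the local graphs of the complement is positive. *)
    have e2 : r * r + r + 1 <= eps a2 a1.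
      by move: Eeps Eepsb oNb r2; rewrite Er Es /opposite; clear; lia.
    apply: (smith_contra e_sym e_irr xA hA sA nd tA S sm r2); move: o oN r2 e2; rewrite /opposite; clear; lia.
  have e2 : rb * rb + rb + 1 <= eps b2 b1.
    by move: Eeps Eepsb oN r2; rewrite Er Es /opposite; clear; lia.
  have ob : opposite rb sb by move: o; rewrite Er Es /opposite; clear; lia.
  by apply: (smith_contra nsym nirr xA hB sB ndb tB Sb smb r2); move: ob oNb r2 e2; rewrite /opposite; clear; lia.
have [|R1 R2] := S4; first by move: l0; clear; lia.
have [|Q1 Q2] := B4; first by move: lb0; clear; lia.
have sN := srg_nb e_sym sA tA xA; have hN := hom_nb e_sym e_irr hA xA.
have sNb := srg_nb nsym sB tB xA; have hNb := hom_nb nsym nirr hB xA.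
have [r' [s' [c3 [c2 [c1 [_ [N1 N2 _ _] LN]]]]]] :=
  srg_local_data e_sym e_irr (hom_le (isT : (3 <= 4)%N) hN) sN ndN R1 R2.
have [r'' [s'' [d3 [d2 [d1 [_ [M1 M2 _ _] LNb]]]]]] :=
  srg_local_data nsym nirr (hom_le (isT : (3 <= 4)%N) hNb) sNb ndNb Q1 Q2.
have Eb : eps b2 b1 = eps a2 a1 - 1 - r - s by rewrite Eps -S1; clear; lia.
rewrite -R1 in N1; rewrite -R2 in N2; rewrite -Q1 in M1; rewrite -Q2 in M2.
rewrite Er Eb in oNb M1 M2; rewrite Er Es in lab.
apply: (latin_contra (Z.of_nat k) (Z.of_nat l) (Z.of_nat kb) (Z.of_nat lb) r s (eps a2 a1)
  r' s' (eps c2 c1) r'' s'' (eps d2 d1)) => //.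
by rewrite Elb Er Es; clear; lia.
Qed.

End TwoSided.
End FiveHomogeneous.

(** * Geometries with a quadrangle axiom *)

Section Collinearity.
Variables (V : eqType) (e : rel V) (nb : V -> seq V).
Hypothesis e_sym : symmetric e.
Hypotheses (nb_uniq : forall x, uniq (nb x)) (nbP : forall x y, (y \in nb x) = e x y).

(* Lines are the maximal cliques: [col a b] says that some line contains [a] and
   [b]. *)
Definition col : rel V := fun a b => (a == b) || e a b.

(** An induced tree on five vertices, hence a configuration to which homogeneity for connected
    subgraphs applies. *)
Definition spider (p q z y1 y2 : V) :=
  [/\ e p q, e p z, e z y1 & e z y2] /\
  [/\ ~~ col z q, ~~ col p y1, ~~ col p y2, ~~ col q y1 & ~~ col q y2 /\ ~~ col y1 y2].

Definition claw (z : V) (s : seq V) := all (e z) s && pairwise (fun a b => ~~ col a b) s.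

Definition centers (z y : V) (s : seq V) := count (fun w => (w != z) && all (e w) s) (nb y).

Lemma col_sym : symmetric col.
Proof. by move=> a b; rewrite /col eq_sym e_sym. Qed.

Lemma colxx a : col a a.
Proof. by rewrite /col eqxx. Qed.

Lemma adj_col a b : e a b -> col a b.
Proof. by rewrite /col orbC => ->. Qed.

Hypothesis line_trans : forall x a b c, e x a -> e x b -> e x c -> e a b -> e b c -> a != c -> e a c.
Hypothesis line_third : forall a b, e a b -> exists2 c, e a c & e b c.
Hypothesis gq_axiom : forall p a b c, ~~ col p a -> e p c -> e c a -> e a b ->
  exists q, [/\ e p q, e a q & col q b].
Hypothesis three_lines : forall z, exists y1 y2 y3, claw z [:: y1; y2; y3].
Hypothesis spider_center : forall p q z y1 y2 y2', spider p q z y1 y2 -> spider p q z y1 y2' ->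
  (exists r, [/\ e r p, e r q, e r y1 & e r y2]) -> exists r, [/\ e r p, e r q, e r y1 & e r y2'].
Hypothesis claw_centers : forall z y s z' y' s', size s <= 4 -> size s = size s' ->
  claw z (y :: s) -> claw z' (y' :: s') -> centers z y s = centers z' y' s'.

Lemma col_trans x a b c : e x a -> e x b -> e x c -> col a b -> col b c -> col a c.
Proof.
move=> xa xb xc /predU1P[->//|ab] /predU1P[<-|bc]; first exact: adj_col.
by rewrite /col; case: eqVneq => //= ac; apply: (line_trans xa xb xc).
Qed.

Lemma col_common z w a b : ~~ col z w -> e z a -> e w a -> e z b -> e w b -> a != b -> ~~ col a b.
Proof.
move=> zw za wa zb wb ab; apply: contra zw => /predU1P[E|aeb]; first by rewrite E eqxx in ab.
apply: (@col_trans a z b w); rewrite ?adj_col // 1?e_sym //.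
Qed.

Lemma noncol_nbr z a b w : e z a -> e z b -> ~~ col a b -> e w a -> e w b -> w != z -> ~~ col z w.
Proof.
move=> za zb ab wa wb wz; apply: contra ab => /predU1P[E|zw]; first by rewrite E eqxx in wz.
by apply: (@col_trans z a w b) => //; rewrite adj_col // e_sym.
Qed.

Ltac adjacency := solve [ done | by rewrite e_sym | by apply: adj_col | by apply: adj_col; rewrite e_sym
  | by rewrite col_sym ].

Lemma two_lines p z : e z p -> exists a b, [/\ e z a, e z b, ~~ col a b, ~~ col a p & ~~ col b p].
Proof.
move=> zp; have [a [b [c /andP[/and4P[za zb zc _]]]]] := three_lines z.
rewrite /= !andbT => /andP[/andP[ab ac] bc].
have tr x y : e z x -> e z y -> ~~ col x y -> col x p -> ~~ col y p.
  move=> zx zy + xp; apply: contra => yp; apply: (col_trans zx zp zy xp).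
  by rewrite col_sym.
case ap: (col a p).
  by exists b, c; split=> //; [exact: (tr a b)|exact: (tr a c)].
case bp: (col b p); last by exists a, b; rewrite ap bp.
by exists a, c; split=> //; [rewrite ap|exact: (tr b c)].
Qed.

(* On two lines through a point [z] off [p q], take [y1], [y2] adjacent to [r] and
   [y3] adjacent to [r'], with [y2], [y3] on the same line. By [spider_center] a
   point of [p q] is adjacent to [y1] and [y3]: it is [r] because of [y1], and
   [r'] because of [y3]. *)
Lemma lines_of_size_3 p q r r' : e p q -> e p r -> e q r -> e p r' -> e q r' -> r = r'.
Proof.
move=> pq pr qr pr' qr'; apply/eqP; apply: contraT => rr'.
have rr : e r r' by apply: (line_trans pr pq pr'); rewrite // e_sym.
have [z [_ [pz _ _ zq _]]] := two_lines pq.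
have zp : e z p by rewrite e_sym.
have nz x : e p x -> e q x -> ~~ col x z.
  move=> px qx; apply: contra zq => xz; apply: (@col_trans p z x q) => //; first by rewrite col_sym.
  by rewrite adj_col // e_sym.
have [k1 [k2 [zk1 zk2 k12 k1p k2p]]] := two_lines zp.
have pt x k : e p x -> e q x -> e z k -> ~~ col k p ->
    exists y, [/\ e x y, e z y, col y k & ~~ col p y /\ ~~ col q y].
  move=> px qx zk kp; have xp : e x p by rewrite e_sym.
  have [y [xy zy yk]] := gq_axiom (nz x px qx) xp pz zk.
  have py : ~~ col p y.
    by apply: contra kp => py; rewrite col_sym; apply: (@col_trans z p y k).
  exists y; split=> //; split=> //; apply: contra py => qy.
  by apply: (@col_trans x p q y); adjacency.
have [y1 [ry1 zy1 y1k1 [py1 qy1]]] := pt r k1 pr qr zk1 k1p.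
have [y2 [ry2 zy2 y2k2 [py2 qy2]]] := pt r k2 pr qr zk2 k2p.
have [y3 [ry3 zy3 y3k2 [py3 qy3]]] := pt r' k2 pr' qr' zk2 k2p.
have n12 y : e z y -> col y k2 -> ~~ col y1 y.
  move=> zy yk; apply: contra k12 => yy; apply: (@col_trans z k1 y1 k2) => //.
    by rewrite col_sym.
  exact: (@col_trans z y1 y k2).
have sp y : e z y -> col y k2 -> ~~ col p y -> ~~ col q y -> spider p q z y1 y.
  by move=> zy yk py qy; split; split=> //; split=> //; exact: n12.
have [|r2 [r2p r2q r2y1 r2y3]] := spider_center (sp y2 zy2 y2k2 py2 qy2) (sp y3 zy3 y3k2 py3 qy3).
  by exists r; split=> //; rewrite e_sym.
have rp : e r p by rewrite e_sym.
have : col r2 r by apply: (@col_trans p r2 q r); adjacency.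
case/predU1P => [E|r2r].
  rewrite E in r2y3; case/negP: py3; apply: (@col_trans r p r' y3); adjacency.
case/negP: py1; apply: (@col_trans r p r2 y1); adjacency.
Qed.

Definition third (a b : V) := head a [seq c <- nb a | e b c].

Lemma thirdP a b : e a b -> e a (third a b) /\ e b (third a b).
Proof.
move=> ab; have : third a b \in [seq c <- nb a | e b c].
  have [c ac bc] := line_third ab; rewrite /third.
  have : c \in [seq c <- nb a | e b c] by rewrite mem_filter bc nbP.
  by case: (filter _ _) => //= d s _; rewrite mem_head.
by rewrite mem_filter nbP => /andP[].
Qed.

Lemma third_uniq a b c : e a b -> e a c -> e b c -> c = third a b.
Proof. by move=> ab ac bc; have [at' bt] := thirdP ab; apply: lines_of_size_3 ab ac bc at' bt. Qed.

Lemma col_third z y w : e z y -> e z w -> col w y -> w = y \/ w = third z y.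
Proof.
by move=> zy zw /predU1P[->|wy]; [left|right; apply: third_uniq => //; rewrite e_sym].
Qed.

Lemma third_noncol z y w : e z y -> ~~ col z w -> e w y -> ~~ e w (third z y).
Proof.
move=> zy zw wy; have [zt yt] := thirdP zy; apply: contra zw => wt.
by apply: (@col_trans y z (third z y) w); adjacency.
Qed.

(** [w] is adjacent to at least one of the two points by [gq_axiom], and to at most one because
    otherwise [w] would lie on the line. *)
Lemma gq_third z y c w : e z y -> ~~ col z w -> e z c -> e w c -> e w y = ~~ e w (third z y).
Proof.
move=> zy zw zc wc; apply/idP/idP => [|wt]; first exact: third_noncol.
have cz : e c z by rewrite e_sym.
have wz : ~~ col w z by rewrite col_sym.
have [q [wq zq qy]] := gq_axiom wz wc cz zy.
by case: (col_third zy zq qy) wq => -> //; rewrite (negPf wt).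
Qed.

Lemma third_third z y : e z y -> third z (third z y) = y.
Proof. by move=> zy; have [zt yt] := thirdP zy; rewrite -(third_uniq zt zy) // e_sym. Qed.

(* Each further centre of a claw meets the line through z and y in exactly one
   of its two points other than z. *)
Lemma centers_split z y1 y2 s y : claw z [:: y1, y2 & s] -> e z y ->
  centers z y1 (y2 :: s) = centers z y1 [:: y, y2 & s] + centers z y1 [:: third z y, y2 & s].
Proof.
case/andP=> /and3P[zy1 zy2 _] /= /andP[/andP[y12 _] _] zy.
have : {in nb y1, forall w, (w != z) && all (e w) (y2 :: s) =
   ((w != z) && all (e w) [:: y, y2 & s]) + ((w != z) && all (e w) [:: third z y, y2 & s]) :> nat}.
  move=> w; rewrite nbP => y1w /=; case wz: (w != z) => //=; case wy2: (e w y2); last by rewrite !andbF.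
  have wy1 : e w y1 by rewrite e_sym.
  have zw := noncol_nbr zy1 zy2 y12 wy1 wy2 wz.
  by rewrite (gq_third zy zw zy1 wy1) /=; case: (e w (third z y)); case: (all _ s).
rewrite /centers; elim: (nb y1) => //= w t IH H.
rewrite IH; last by move=> x xt; apply: H; rewrite inE xt orbT.
by rewrite addnACA -H // mem_head.
Qed.

Lemma claw_third z y s : claw z (y :: s) -> claw z (third z y :: s).
Proof.
rewrite /claw /= => /andP[/andP[zy zs] /andP[ys ps]]; have [zt yt] := thirdP zy.
apply/andP; split; first by rewrite zt zs.
apply/andP; split=> //; apply/allP=> a as_.
have := allP ys a as_; apply: contra => ta; have za := allP zs a as_.
by apply: (@col_trans z y (third z y) a); adjacency.
Qed.

Lemma clawP z s : reflect [/\ uniq s, {in s, forall a, e z a} & {in s &, forall a b, a != b -> ~~ col a b}]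
  (claw z s).
Proof.
apply: (iffP andP) => [[/allP sz ps]|[us sz ps]].
  split=> //; first by rewrite uniq_pairwise; apply: sub_pairwise ps => a b; apply: contra => /eqP->; exact: colxx.
  move=> a b as_ bs ab; elim: s ps as_ bs {sz} => // x s IH /= /andP[/allP xs ps]; rewrite !inE.
  case/predU1P=> [Ea|as_] /predU1P[Eb|bs]; last exact: IH.
  - by rewrite Ea Eb eqxx in ab.
  - by rewrite Ea; exact: xs.
  - by rewrite Eb col_sym; exact: xs.
split; first exact/allP; elim: s us sz ps => //= x s IH /andP[xs us] sz ps.
rewrite IH // => [|a as_|a b as_ bs]; last 2 first.
- by apply: sz; rewrite inE as_ orbT.
- by apply: ps; rewrite inE ?as_ ?bs orbT.
rewrite andbT; apply/allP => a as_; apply: ps; rewrite ?mem_head // ?inE ?as_ ?orbT //.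
by apply: contraNneq xs => ->.
Qed.

Lemma claw_sub z s s' : uniq s' -> {subset s' <= s} -> claw z s -> claw z s'.
Proof.
move=> us ss' /clawP[_ zs ps]; apply/clawP; split=> // [a /ss'|a b /ss' a_s /ss' bs].
  exact: zs.
exact: ps.
Qed.

Lemma claw_swap z a b s : claw z [:: a, b & s] -> claw z [:: b, a & s].
Proof.
have p : perm_eq [:: a, b & s] [:: b, a & s] by exact/permPl/(perm_catCA [:: a] [:: b] s).
move=> cl; apply: (claw_sub _ _ cl); last by move=> x; rewrite (perm_mem p).
by have /clawP[us _ _] := cl; rewrite -(perm_uniq p).
Qed.

Lemma claw_behead z a s : claw z (a :: s) -> claw z s.
Proof. by case/andP=> /andP[_ zs] /andP[_ ps]; apply/andP. Qed.

(** Replacing [y] by the third point of its line gives a claw of the same size, so the two summands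
    of [centers_split] are equal. *)
Lemma centers_double z y1 y2 s y : claw z [:: y1, y, y2 & s] -> size s <= 2 ->
  centers z y1 (y2 :: s) = 2 * centers z y1 [:: y, y2 & s].
Proof.
move=> cl ss; have cl' := claw_swap (claw_third (claw_swap cl)).
have zy : e z y by case/andP: cl => /and3P[].
rewrite (centers_split (claw_behead (claw_swap cl)) zy).
by rewrite (claw_centers _ _ cl' cl) ?mul2n ?addnn.
Qed.

(** The point [third w y] is not collinear with [z], and adjacency to [y'] would make [y] and [y']
    collinear; so it is adjacent to the other point of the line through [z] and [y']. *)
Lemma common_third z w y y' : ~~ col z w -> e z y -> e w y -> e z y' -> e w y' -> y != y' ->
  e (third w y) (third z y').
Proof.
move=> zw zy wy zy' wy' yy'; have [wt yt] := thirdP wy.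
have yy := col_common zw zy wy zy' wy' yy'.
have zt : ~~ col z (third w y).
  by apply: contra zw => zt; apply: (@col_trans y z (third w y) w); adjacency.
have tz : ~~ e (third w y) y'.
  by apply: contra yy => ty; apply: (@col_trans w y (third w y) y'); adjacency.
by have := gq_third zy' zt zy; rewrite (negPf tz) e_sym => /(_ yt) /esym/negbFE.
Qed.

(** * Centres of claws seen from two noncollinear points *)

Section Contradiction.
Variables (z y1 y2 w : V).
Hypotheses (zy1 : e z y1) (zy2 : e z y2) (y12 : ~~ col y1 y2).
Hypotheses (wy1 : e w y1) (wy2 : e w y2) (zw : ~~ col z w).

Let J := [seq y <- nb z | [&& e w y, y != y1 & y != y2]].
Let c2 := centers z y1 [:: y2].

Lemma mem_J y : (y \in J) = [&& e z y, e w y, y != y1 & y != y2].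
Proof. by rewrite mem_filter nbP andbC. Qed.

Lemma claw_J s : uniq s -> {subset s <= J} -> claw z [:: y1, y2 & s].
Proof.
move=> us sJ; have H y : y \in [:: y1, y2 & s] -> e z y /\ e w y.
  by rewrite !inE => /or3P[/eqP->|/eqP->|/sJ] //; rewrite mem_J => /and4P[].
have U : uniq [:: y1, y2 & s].
  rewrite /= us andbT inE negb_or -andbA; apply/and3P; split.
  - by apply: contra y12 => /eqP->; exact: colxx.
  - by apply/negP => /sJ; rewrite mem_J eqxx !andbF.
  - by apply/negP => /sJ; rewrite mem_J eqxx !andbF.
apply/andP; split; first by apply/allP => y /H[].
elim: [:: y1, y2 & s] U H => //= y t IH /andP[yt ut] H; rewrite IH // => [|x xt]; last first.
  by apply: H; rewrite inE xt orbT.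
rewrite andbT; apply/allP => x xt; have [zy wy] := H y (mem_head _ _).
have [zx wx] : e z x /\ e w x by apply: H; rewrite inE xt orbT.
by apply: (col_common zw) => //; apply: contraNneq yt => ->.
Qed.

(** The pairs [y1], [y2] at [z] and [z], [w] at [y1] are claws of the same size. The further centres
    of the second one are [y2] and the points of [J]. *)
Lemma size_J : (size J).+1 = c2.
Proof.
have -> : c2 = centers y1 z [:: w].
  apply: claw_centers => //; first exact: (@claw_J [::]).
  by rewrite /claw /= !andbT e_sym zy1 e_sym wy1 zw.
rewrite /centers -size_filter.
have y2F : y2 \in [seq v <- nb z | (v != y1) && all (e v) [:: w]].
  by rewrite mem_filter nbP zy2 /= e_sym wy2 !andbT; apply: contra y12 => /eqP->; exact: colxx.
have U : uniq [seq v <- nb z | (v != y1) && all (e v) [:: w]] by exact: filter_uniq.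
rewrite (perm_size (perm_to_rem y2F)) /=; congr _.+1; apply: perm_size; apply: uniq_perm.
- exact: filter_uniq.
- exact: rem_uniq.
by move=> y; rewrite mem_J mem_rem_uniq // !inE mem_filter nbP /= andbT [e y w]e_sym; do 2!case: (y == _); case: (e z y); rewrite ?andbF ?andbT.
Qed.

Let y1' := third z y1.
Let y2' := third z y2.

Lemma claw_thirds s : uniq s -> {subset s <= J} -> claw z [:: y1', y2' & s].
Proof.
move=> us sJ; rewrite /y1' /y2'; have cl := claw_swap (claw_third (claw_J us sJ)).
exact: claw_swap (claw_third cl).
Qed.

Let W := [seq v <- nb y1' | (v != z) && all (e v) [:: y2']].

Lemma size_W : size W = c2.
Proof.
rewrite /W size_filter; apply: claw_centers => //; first exact: (@claw_thirds [::]).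
exact: (@claw_J [::]).
Qed.

Lemma third_inj : {in J &, injective (third w)}.
Proof.
move=> a b; rewrite !mem_J => /and4P[za wa _ _] /and4P[zb wb _ _] E; apply/eqP; apply: contraT => ab.
have := col_common zw za wa zb wb ab; have [wt at'] := thirdP wa; have [_ bt] := thirdP wb.
by rewrite -E in bt; rewrite (@col_trans w a (third w a) b) //; adjacency.
Qed.

Lemma third_W y : y \in J -> third w y \in [seq v <- W | e w v].
Proof.
rewrite mem_J => /and4P[zy wy n1 n2]; have [wt yt] := thirdP wy.
rewrite !mem_filter wt nbP /= andbT -andbA; apply/and3P; split.
- by apply: contra zw => /eqP E; rewrite -E col_sym adj_col.
- exact: common_third.
- by rewrite e_sym; apply: common_third.
Qed.

(** [third w] embeds [J], which has [c2 - 1] points, into the part of [W] adjacent to [w], while [W]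
    has [c2] points. *)
Lemma count_nonadj_W : count (fun v => ~~ e w v) W <= 1.
Proof.
rewrite -(leq_add2l (count (e w) W)) [X in X <= _](count_predC (e w)) size_W -size_J.
rewrite -(size_map (third w) J) addn1 ltnS -size_filter.
apply: uniq_leq_size; last by move=> v /mapP[y yJ ->]; exact: third_W.
rewrite map_inj_in_uniq; last exact: third_inj.
exact: filter_uniq.
Qed.

(** Such a centre is a point of [W] adjacent to [y]: if adjacent to [w] it is [third w y], and at
    most one point of [W] is not adjacent to [w]. *)
Lemma centers_le2 y : y \in J -> centers z y1' [:: y; y2'] <= 2.
Proof.
move=> yJ; have := yJ; rewrite mem_J => /and4P[zy wy _ _].
have -> : centers z y1' [:: y; y2'] = count (fun v => e v y) W.
  rewrite /centers /W count_filter; apply: eq_count => v /=.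
  by case: (v != z); case: (e v y).
rewrite -size_filter -(count_predC (e w)) -[2]/(1 + 1) leq_add //.
  rewrite -size_filter; apply: (@leq_trans (size [:: third w y])) => //; apply: uniq_leq_size.
    by do 3!apply: filter_uniq.
  move=> v; rewrite !mem_filter inE => /and3P[wv vy _]; apply/eqP.
  by apply: third_uniq => //; rewrite e_sym.
rewrite count_filter; apply: leq_trans count_nonadj_W; apply: sub_count => v /=.
by case/andP.
Qed.

Lemma claw_J_perm s s' : uniq s -> {subset s <= J} -> perm_eq s' [:: y1, y2 & s] -> claw z s'.
Proof.
move=> us sJ p; apply: (claw_sub _ _ (claw_J us sJ)); last by move=> x; rewrite (perm_mem p).
by rewrite (perm_uniq p); have /clawP[] := claw_J us sJ.
Qed.

Lemma size_J_double y : y \in J -> c2 = 2 * centers z y1 [:: y; y2].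
Proof.
move=> yJ; apply: centers_double => //; apply: (@claw_J_perm [:: y]) => //.
  by move=> x; rewrite inE => /eqP->.
by rewrite perm_cons; apply/permPl/(perm_catC [:: y] [:: y2]).
Qed.

Lemma centers_J y : y \in J -> centers z y1 [:: y; y2] <= 2.
Proof.
move=> yJ; have sJ : {subset [:: y] <= J} by move=> x; rewrite inE => /eqP->.
rewrite (@claw_centers z y1 [:: y; y2] z y1' [:: y; y2']) //; first exact: centers_le2.
  apply: (@claw_J_perm [:: y]) => //.
  by rewrite perm_cons; apply/permPl/(perm_catC [:: y] [:: y2]).
have p : perm_eq [:: y1'; y; y2'] [:: y1'; y2'; y].
  by rewrite perm_cons; apply/permPl/(perm_catC [:: y] [:: y2']).
have cl := @claw_thirds [:: y] isT sJ.
apply: (claw_sub _ _ cl); last by move=> x; rewrite (perm_mem p).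
by rewrite (perm_uniq p); have /clawP[] := cl.
Qed.

(** Doubling twice, up to a claw with five leaves, shows that the number is a multiple of 4. *)
Lemma J_not3 a b c : uniq [:: a; b; c] -> {subset [:: a; b; c] <= J} -> centers z y1 [:: a; y2] != 2.
Proof.
move=> u sJ.
have sub s : {subset s <= [:: a; b; c]} -> {subset s <= J} by move=> h x /h /sJ.
rewrite (@centers_double z y1 a [:: y2] b) //; last first.
  apply: (@claw_J_perm [:: b; a]) => //.
  - by move: u; rewrite /= !inE !negb_or [b == a]eq_sym => /and3P[/andP[->]].
  - by apply: sub => x; rewrite !inE => /orP[] ->; rewrite ?orbT.
  - by rewrite perm_cons; apply/permPl/(perm_catC [:: b; a] [:: y2]).
rewrite (@centers_double z y1 b [:: a; y2] c) //; last first.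
  apply: (@claw_J_perm [:: c; b; a]) => //.
  - by rewrite -(rev_uniq [:: a; b; c]) in u.
  - by apply: sub => x; rewrite !inE => /or3P[] ->; rewrite ?orbT.
  - by rewrite perm_cons; apply/permPl/(perm_catC [:: c; b; a] [:: y2]).
by case: (centers _ _ _) => [|[|[|]]].
Qed.

(** Two further centres of this claw arise, [w2] on the line [w y2] and [v] on a line through [w1].
    If they coincide, [w1] and [w2] are adjacent, which makes the lines [w y1] and [w y2] equal. *)
Lemma triangle_of_centers y : y \in J -> centers z y1' [:: y2; third z y] = 1 -> False.
Proof.
rewrite mem_J => /and4P[zy wy n1 n2] c31.
have [zy1' y1y1'] := thirdP zy1; have [zy2' y2y2'] := thirdP zy2; have [zy' yy'] := thirdP zy.
have y21 : y2 != y1 by apply: contra y12 => /eqP->; exact: colxx.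
have n1' : y1 != y by rewrite eq_sym.
have n2' : y2 != y by rewrite eq_sym.
set w1 := third w y1; set w2 := third w y2.
have [ww1 y1w1] := thirdP wy1; have [ww2 y2w2] := thirdP wy2; rewrite -/w1 -/w2 in ww1 y1w1 ww2 y2w2.
have zt v x : e z x -> e w x -> e w v -> e x v -> ~~ col z v.
  move=> zx wx wv xv; apply: contra zw => zv.
  by apply: (@col_trans x z v w); adjacency.
have zw1 : ~~ col z w1 by apply: (zt _ y1).
have zw2 : ~~ col z w2 by apply: (zt _ y2).
have w1y2 : e w1 y2' by apply: common_third => //; rewrite eq_sym.
have w1y : e w1 (third z y) by apply: common_third.
have w2y1 : e w2 y1' by apply: common_third.
have w2y : e w2 (third z y) by apply: common_third.
set v := third w1 (third z y).
have [w1v yv] := thirdP w1y; rewrite -/v in w1v yv.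
have w1y1 : e w1 y1 by rewrite e_sym.
have ny : third z y != y1.
  by apply: contraTneq y1w1 => E; have := third_noncol zy zw wy; rewrite E wy1.
have ny2 : third z y != y2'.
  apply: contra (col_common zw zy wy zy2 wy2 n2) => /eqP E.
  by rewrite -(third_third zy) E (third_third zy2) colxx.
have vy1 : e v y1' by apply: (common_third zw1).
have vy2 : e v y2 by rewrite -(third_third zy2); apply: (common_third zw1).
have zv : ~~ col z v.
  by apply: contra zw1 => zv; apply: (@col_trans (third z y) z v w1); adjacency.
have vw2 : v = w2.
  move: c31; rewrite /centers -size_filter.
  case E: [seq _ <- _ | _] => [|u [|]] // _.
  have Hc v' : ~~ col z v' -> e v' y1' -> e v' y2 -> e v' (third z y) -> v' = u.
    move=> zv' v1 v2 vt; apply/eqP; rewrite -(mem_seq1 v' u) -E mem_filter nbP /= v2 vt [e y1' _]e_sym v1 !andbT.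
    by apply: contra zv' => /eqP->; exact: colxx.
  rewrite (Hc v zv vy1 vy2 _); last by rewrite e_sym.
  by rewrite -(Hc w2 zw2 w2y1 _ w2y) // e_sym.
have : col y1 y2; last by rewrite (negPf y12).
rewrite vw2 in w1v; apply: (@col_trans w y1 w1 y2); [adjacency..|].
by apply: (@col_trans w w1 w2 y2); adjacency.
Qed.

(** [c2] is twice the number of further centres of a claw with three leaves, and that number is at
    most 2. The value 1 is excluded by [triangle_of_centers]; for the value 2, [J] has three points
    and [J_not3] applies. *)
Lemma claw_center_contra : 2 <= c2 -> False.
Proof.
rewrite -size_J; case EJ: J => [//|a s] _.
have aJ : a \in J by rewrite EJ mem_head.
have := size_J_double aJ; have := centers_J aJ; rewrite -size_J.
case C: (centers z y1 [:: a; y2]) => [|[|[|]]] //; rewrite EJ => _.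
- move=> _; apply: (triangle_of_centers aJ).
  rewrite -{}C; apply: claw_centers => //.
    have cl := claw_swap (@claw_thirds [:: a] isT _).
    have : claw z [:: y2; y1'; a].
      by rewrite -(third_third zy2); apply: claw_third; apply: cl => x; rewrite inE => /eqP->.
    move=> cl3; have : claw z [:: a; y1'; y2].
      have p : perm_eq [:: a; y1'; y2] [:: y2; y1'; a].
        by exact/permPl/(perm_rev [:: y2; y1'; a]).
      apply: (claw_sub _ _ cl3); last by move=> x; rewrite (perm_mem p).
      by rewrite (perm_uniq p); have /clawP[] := cl3.
    move/claw_third => cl4.
    have p : perm_eq [:: y1'; y2; third z a] [:: third z a; y1'; y2].
      by apply/permPl/(perm_catC [:: y1'; y2] [:: third z a]).
    apply: (claw_sub _ _ cl4); last by move=> x; rewrite (perm_mem p).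
    by rewrite (perm_uniq p); have /clawP[] := cl4.
  apply: (@claw_J_perm [:: a]) => //; first by move=> x; rewrite inE => /eqP->.
  by rewrite perm_cons; apply/permPl/(perm_catC [:: a] [:: y2]).
- case: s EJ => [|b [|c [|]]] // EJ _.
  have U : uniq [:: a; b; c] by rewrite -EJ; exact: filter_uniq.
  by have := J_not3 U; rewrite -EJ C => /(_ (fun x xJ => xJ)); rewrite eqxx.
Qed.

End Contradiction.

Theorem gq_three_lines_contra (z : V) : False.
Proof.
have [y1 [y2 [y3 cl]]] := three_lines z.
have /clawP[us zs ps] := cl.
have zy1 : e z y1 by apply: zs; rewrite mem_head.
have zy2 : e z y2 by apply: zs; rewrite !inE eqxx orbT.
have n12 : y1 != y2 by move: us => /=; rewrite inE negb_or => /andP[/andP[]].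
have y12 : ~~ col y1 y2 by apply: ps => //; rewrite !inE eqxx ?orbT.
have y2z : e y2 z by rewrite e_sym.
have y1z : e y1 z by rewrite e_sym.
have [b [_ [y2b _ _ bz _]]] := two_lines y2z.
have [w [y1w y2w wb]] := gq_axiom y12 y1z zy2 y2b.
have wz : w != z by apply: contra bz => /eqP <-; rewrite col_sym.
have wy1 : e w y1 by rewrite e_sym.
have wy2 : e w y2 by rewrite e_sym.
have zw := noncol_nbr zy1 zy2 y12 wy1 wy2 wz.
apply: (claw_center_contra zy1 zy2 y12 wy1 wy2 zw).
(* [c2] is even because of the third line, and positive because of [w], hence at least 2. *)
rewrite (@centers_double z y1 y2 [::] y3) //; last first.
  have p : perm_eq [:: y1; y3; y2] [:: y1; y2; y3].
    by rewrite perm_cons; apply/permPl/(perm_catC [:: y3] [:: y2]).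
  apply: (claw_sub _ _ cl); last by move=> x; rewrite (perm_mem p).
  by rewrite (perm_uniq p).
rewrite -{1}[2]muln1 leq_mul2l /=.
have : 0 < centers z y1 [:: y2].
  by rewrite /centers -has_count; apply/hasP; exists w; rewrite ?nbP //= wz wy2.
rewrite (@centers_double z y1 y2 [::] y3) //; last first.
  have p : perm_eq [:: y1; y3; y2] [:: y1; y2; y3].
    by rewrite perm_cons; apply/permPl/(perm_catC [:: y3] [:: y2]).
  apply: (claw_sub _ _ cl); last by move=> x; rewrite (perm_mem p).
  by rewrite (perm_uniq p).
by rewrite muln_gt0.
Qed.

End Collinearity.

Section SameTypeCol.
Variables (V : eqType) (e : rel V).
Hypotheses (e_sym : symmetric e) (e_irr : irreflexive e).

Lemma col_nonadj a b : ~~ col e a b = nonadj e a b.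
Proof. by rewrite /col negb_or. Qed.

Lemma mem_zip2 (s s' : seq V) p : p \in zip s s' -> p.1 \in s /\ p.2 \in s'.
Proof.
elim: s s' => [|x s IH] [|x' s'] //=; rewrite !inE => /predU1P[->|/IH[-> ->]]; rewrite ?eqxx ?orbT //=.
Qed.

Lemma same_type_coclique s s' : size s = size s' ->
  pairwise (fun a b => ~~ col e a b) s -> pairwise (fun a b => ~~ col e a b) s' -> same_type e s s'.
Proof.
elim: s s' => [|x s IH] [|x' s'] //= [sz] /andP[xs ps] /andP[xs' ps'].
rewrite same_type_cons // IH // andbT; apply/allP=> p /mem_zip2[p1 p2].
have := allP xs _ p1; have := allP xs' _ p2; rewrite !negb_or.
by case/andP=> /negPf-> /negPf-> /andP[/negPf-> /negPf->].
Qed.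

End SameTypeCol.

(** * Finite homogeneous graphs that are locally unions of cliques *)

Section GeneralizedQuadrangle.
Variables (T : finType) (e : rel T) (n k l m a3 a1 : nat).
Hypotheses (e_sym : symmetric e) (e_irr : irreflexive e).
Hypotheses (hA : hom 5 e [set: T]) (sA : srg e [set: T] n k l m) (nd : nondeg n k m).
Hypotheses (tA : srg_triples e [set: T] a3 0 a1) (l0 : 0 < l).

Let nbl x := [seq y <- enum T | e x y].

Let nblP x y : (y \in nbl x) = e x y.
Proof. by rewrite mem_filter mem_enum andbT. Qed.

Let nbl_uniq x : uniq (nbl x).
Proof. by apply: filter_uniq; exact: enum_uniq. Qed.

Lemma gq_line_trans x a b c : e x a -> e x b -> e x c -> e a b -> e b c -> a != c -> e a c.
Proof.
move=> xa xb xc ab bc ac; apply: contraT => aec.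
have : cn e [set: T] [:: x; a; c] = 0 by rewrite (srg_a2 tA) ?inE // /nonadj ac.
move/eqP; rewrite -leqn0 leqNgt => /negP; case; apply/cn_gt0P; exists b; rewrite ?inE //=.
by rewrite e_sym xb e_sym ab bc.
Qed.

Lemma gq_line_third a b : e a b -> exists2 c, e a c & e b c.
Proof.
move=> ab; have : 0 < cn e [set: T] [:: a; b] by rewrite (srg_l sA) ?inE.
by case/cn_gt0P => c _ /and3P[ca cb _]; exists c; rewrite e_sym.
Qed.

Let homE k' s s' : k' <= 5 -> size s <= k' -> same_type e s s' ->
  exists2 g : {perm T}, forall x y, e (g x) (g y) = e x y & map g s = s'.
Proof.
move=> k5 sk st.
have [g [ge _ gs]] := hA (leq_trans sk k5) (fun x _ => in_setT x) (fun x _ => in_setT x) st.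
by exists g.
Qed.

Let ctrans := col_trans gq_line_trans.

Ltac adjacency := solve [ done | by rewrite e_sym | by apply: adj_col | by apply: adj_col; rewrite e_sym
  | by rewrite col_sym ].

Lemma col_neg a b : ~~ col e a b -> ((a == b) = false) * (e a b = false).
Proof. by rewrite negb_or => /andP[/negPf-> /negPf->]. Qed.

Lemma col_negC a b : ~~ col e a b -> ~~ col e b a.
Proof. by rewrite col_sym. Qed.

(** Let [c'] be a third point on the line [a c]. An automorphism fixing [a] and [p] and moving [c']
    to [b] moves [c] to the required point. *)
Lemma gq_gq_axiom p a b c : ~~ col e p a -> e p c -> e c a -> e a b ->
  exists q, [/\ e p q, e a q & col e q b].
Proof.
move=> pa pc ca ab; have ac : e a c by rewrite e_sym.
case pb : (e p b); first by exists b; rewrite pb ab colxx.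
case cb : (col e c b); first by exists c.
have [c' ac' cc'] := gq_line_third ac.
have pc' : ~~ col e p c'.
  by apply: contra pa => pc'; apply: (@ctrans c p c' a); adjacency.
have bp : ~~ col e p b.
  by rewrite negb_or pb andbT; apply: contraTneq ab => <-; rewrite e_sym; case/norP: pa.
have [|g ge [ga gc gp]] := homE (k' := 3) (s := [:: a; c'; p]) (s' := [:: a; b; p]) isT isT.
  rewrite !same_type_cons //= ?eqxx ac' ab ?(adj_neq e_irr ac') ?(adj_neq e_irr ab) !(e_sym _ p) !(eq_sym _ p).
  by rewrite ?(col_neg pa) ?(col_neg pc') ?(col_neg bp).
exists (g c); rewrite -{1}gp ge pc -{1}ga ge ac -gc; split=> //.
by rewrite /col ge cc' orbT.
Qed.

Lemma gq_spider p q z y1 y2 y2' : spider e p q z y1 y2 -> spider e p q z y1 y2' ->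
  (exists r, [/\ e r p, e r q, e r y1 & e r y2]) -> exists r, [/\ e r p, e r q, e r y1 & e r y2'].
Proof.
case=> [[pq pz zy1 zy2] [zq py1 py2 qy1 [qy2 y12]]] [[_ _ _ zy2'] [_ _ py2' _ [qy2' y12']]].
have [|g ge [gp gq gz gy gy2]] := homE (k' := 5) (s := [:: p; q; z; y1; y2]) (s' := [:: p; q; z; y1; y2']) isT isT.
  rewrite !same_type_cons //= ?eqxx ?pq ?pz ?zy1 ?zy2 ?zy2' ?(adj_neq e_irr zy2) ?(adj_neq e_irr zy2') ?eqxx /=.
  by rewrite ?(col_neg (col_negC zq)) ?(col_neg py1) ?(col_neg py2) ?(col_neg qy1) ?(col_neg qy2)
    ?(col_neg y12) ?(col_neg py2') ?(col_neg qy2') ?(col_neg y12').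
by case=> r [rp rq r1 r2]; exists (g r); rewrite -gp -gq -gy -gy2 !ge.
Qed.

Lemma centers_cn z y s : claw e z (y :: s) -> cn e [set: T] (y :: s) = (centers e nbl z y s).+1.
Proof.
move=> /andP[/= /andP[zy zs] _]; rewrite /centers /nbl -size_filter -filter_predI.
have U (P : pred T) : uniq [seq x <- enum T | P x] by apply: filter_uniq; exact: enum_uniq.
rewrite -[LHS]addn0 -addn1.
have -> : cn e [set: T] (y :: s) = size [seq w <- enum T | all (e w) (y :: s)].
  rewrite /cn -(card_uniqP (U _)); apply: eq_card => w.
  by rewrite !inE mem_filter mem_enum andbT.
have zF : z \in [seq w <- enum T | all (e w) (y :: s)] by rewrite mem_filter mem_enum /= zy zs.
rewrite (perm_size (perm_to_rem zF)) addn0 addn1 /=; congr _.+1; apply: perm_size; apply: uniq_perm.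
- exact: rem_uniq.
- exact: U.
move=> w; rewrite mem_rem_uniq // !inE !mem_filter /= [e y w]e_sym.
by case: (w != z); case: (e w y); case: (all _ s); rewrite ?andbF ?andbT.
Qed.

Lemma gq_claw_centers z y s z' y' s' : size s <= 4 -> size s = size s' ->
  claw e z (y :: s) -> claw e z' (y' :: s') -> centers e nbl z y s = centers e nbl z' y' s'.
Proof.
move=> s4 ss cl cl'; apply: succn_inj; rewrite -!centers_cn //.
apply: (hom_cn hA) => //; try by move=> x _; rewrite inE.
apply: same_type_coclique => //=; first by rewrite ss.
  by case/andP: cl.
by case/andP: cl'.
Qed.

Lemma gq_no_claw z y1 y2 y3 : ~~ claw e z [:: y1; y2; y3].
Proof.
apply/negP => cl; apply: (gq_three_lines_contra e_sym nbl_uniq nblP gq_line_trans gq_line_third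
  gq_gq_axiom _ gq_spider gq_claw_centers z) => z'.
have [|g ge [gz]] := homE (k' := 1) (s := [:: z]) (s' := [:: z']) isT isT.
  by rewrite same_type_cons.
exists (g y1), (g y2), (g y3); move: cl; rewrite /claw /= -gz !ge.
by rewrite /col !ge !(inj_eq perm_inj).
Qed.

Lemma gq_two_lines z x : e z x -> exists2 y, e z y & ~~ col e x y.
Proof.
move=> zx; have [kb [lb [mb sB]]] := compl_srg e_sym e_irr (hom_le (isT : 3 <= 5) hA) sA.
have [_ _ _ _ F] := nondeg_facts e_sym e_irr sA sB nd.
have := cn_split e_sym e_irr (A := [set: T]) (x := x) (s := [:: z]) (in_setT _).
rewrite /= e_sym zx => /(_ isT); rewrite (srg_k sA (in_setT _)) (srg_l sA) ?inE // 1?e_sym // => E.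
have : 0 < far e [set: T] x [:: z] by lia.
case/card_gt0P => y; rewrite !inE /= andbT => /andP[xy yz].
by exists y; rewrite ?col_nonadj // e_sym.
Qed.

Let gq_path : exists x y z, [/\ x \in [set: T], y \in [set: T], z \in [set: T], e x y & e x z /\ nonadj e y z].
Proof.
have [kb [lb [mb sB]]] := compl_srg e_sym e_irr (hom_le (isT : 3 <= 5) hA) sA.
exact: nondeg_path e_sym e_irr sA sB nd.
Qed.

Lemma gq_k : k = 2 * l.+1.
Proof.
have [x [y [z [_ _ _ xy [xz yz]]]]] := gq_path.
rewrite -col_nonadj in yz.
have C v : e x v -> (l.+1 = #|[set w | e x w && col e v w]|)%N.
  move=> xv; rewrite -(srg_l sA (in_setT x) (in_setT v) xv) (cardsD1 v) !inE xv colxx /=; congr _.+1.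
  apply: eq_card => w; rewrite !inE /= andbT [e w x]e_sym [e w v]e_sym /col.
  by case: eqVneq => [->|_] /=; rewrite ?eqxx ?e_irr ?andbF // eq_sym.
rewrite mul2n -addnn {1}(C y xy) (C z xz) -cardsUI -(srg_k sA (in_setT x)).
have -> : [set w | e x w && col e y w] :&: [set w | e x w && col e z w] = set0.
  apply/setP => w; rewrite !inE; apply/negP => /andP[/andP[xw yw] /andP[_ zw]].
  by case/negP: yz; apply: (@ctrans x y w z); adjacency.
rewrite cards0 addn0; apply: eq_card => w; rewrite !inE /= andbT [e w x]e_sym -andb_orr.
case xw: (e x w) => //=; apply/esym; apply: contraT; rewrite negb_or => /andP[yw zw].
by have /negP[] := gq_no_claw x y z w; rewrite /claw /= xy xz xw yz yw zw.
Qed.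

Lemma gq_m : m = 2.
Proof.
have [c [p [a [_ _ _ cp [ca pa]]]]] := gq_path.
rewrite -col_nonadj in pa; have ac : e a c by rewrite e_sym.
have pc : e p c by rewrite e_sym.
have [b ab cb] := gq_two_lines ac.
have [q [pq aq qb]] := gq_gq_axiom pa pc ca ab.
have cq : ~~ col e c q by apply: contra cb => cq; apply: (@ctrans a c q b).
rewrite -(srg_m sA (in_setT p) (in_setT a)) -?col_nonadj //.
have -> : 2 = #|[set c; q]|.
  by rewrite cards2; case/norP: cq => ->.
apply: eq_card => w; rewrite !inE /= andbT; apply/idP/idP => [/andP[wp wa]|]; last first.
  by case/orP=> /eqP->; rewrite e_sym ?pc ?pq e_sym.
apply: contraT; rewrite negb_or => /andP[wc wq].
have aw : e a w by rewrite e_sym.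
have pw : e p w by rewrite e_sym.
have [n1 n2] : ~~ col e c w /\ ~~ col e q w.
  by split; apply: (col_common e_sym gq_line_trans pa) => //; rewrite eq_sym.
by have /negP[] := gq_no_claw a c q w; rewrite /claw /= ac aq aw cq n1 n2.
Qed.

(** Otherwise some line has four points [p], [q], [r], [r']. With [y] adjacent to [r], [y2] on the
    line [r y] and [y1] on another line through [y], an automorphism fixing [p], [q], [y] moves [y2]
    to [y1]; but [r] is the only point of the line [p q] adjacent to [y]. *)
Lemma gq_l : l = 1.
Proof.
apply/eqP; rewrite eqn_leq l0 andbT leqNgt; apply/negP => l2.
have [p [q [_ [_ _ _ pq _]]]] := gq_path.
have [r [r' [pr qr pr' qr' rr']]] : exists r r', [/\ e p r, e q r, e p r', e q r' & r != r'].
  move: l2; rewrite -(srg_l sA (in_setT p) (in_setT q) pq) => /card_gt1P[r [r' []]].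
  rewrite !inE /= !andbT => /andP[rp rq] /andP[rp' rq'] rr'.
  by exists r, r'; split; rewrite // e_sym.
have rp : e r p by rewrite e_sym.
have rq : e r q by rewrite e_sym.
have err : e r r' by apply: (gq_line_trans pr pq pr') => //.
have [y ry py] := gq_two_lines rp.
have qy : ~~ col e q y.
  by apply: contra py => qy; apply: (@ctrans r p q y); adjacency.
have r'y : ~~ col e r' y.
  by apply: contra py => yr; apply: (@ctrans r p r' y); adjacency.
have [y2 ry2 yy2] := gq_line_third ry.
have nb2 v : e r v -> ~~ col e v y -> ~~ col e v y2.
  by move=> rv; apply: contra => vy; apply: (@ctrans r v y2 y); adjacency.
have yr : e y r by rewrite e_sym.
have r'r : e r' r by rewrite e_sym.
have [k' yk rk] := gq_two_lines yr.
have [y1 [r'y1 yy1 y1k]] := gq_gq_axiom r'y r'r ry yk.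
have ry1 : ~~ col e r y1.
  by apply: contra rk => ry1; apply: (@ctrans y r y1 k').
have nb1 v : e r v -> e r' v -> ~~ col e v y1.
  by move=> rv r'v; apply: contra ry1 => vy; apply: (@ctrans r' r v y1); adjacency.
have r'p : e r' p by rewrite e_sym.
have r'q : e r' q by rewrite e_sym.
have [|g ge [gp gq gy gy2]] := homE (k' := 4) (s := [:: p; q; y; y2]) (s' := [:: p; q; y; y1]) isT isT.
  rewrite !same_type_cons //= ?eqxx ?pq ?yy2 ?yy1 ?(adj_neq e_irr yy1) ?(adj_neq e_irr yy2).
  by rewrite ?(col_neg py) ?(col_neg qy) ?(col_neg (nb2 _ rp py)) ?(col_neg (nb2 _ rq qy))
    ?(col_neg (nb1 _ rp r'p)) ?(col_neg (nb1 _ rq r'q)).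
have gp' : e p (g r) by rewrite -{1}gp ge.
have gq' : e q (g r) by rewrite -{1}gq ge.
have gy' : e y (g r) by rewrite -{1}gy ge.
have gy1 : e y1 (g r) by rewrite -{1}gy2 ge e_sym.
have : col e (g r) r by apply: (@ctrans p (g r) q r); adjacency.
case/predU1P => [E|gr]; first by case/norP: ry1 => _; rewrite -E e_sym gy1.
by case/negP: py; apply: (@ctrans r p (g r) y); adjacency.
Qed.

Lemma gq_parameters : [/\ n = 9, k = 4, l = 1 & m = 2].
Proof.
have [kb [lb [mb sB]]] := compl_srg e_sym e_irr (hom_le (isT : 3 <= 5) hA) sA.
have [F1 _ _ F4 _] := nondeg_facts e_sym e_irr sA sB nd.
move: gq_k gq_l gq_m F1 F4; clear => -> -> -> F1 F4; split; lia.
Qed.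

End GeneralizedQuadrangle.

Theorem hom5_parameters (T : finType) (e : rel T) n k l m : symmetric e -> irreflexive e ->
  hom 5 e [set: T] -> srg e [set: T] n k l m -> nondeg n k m ->
  [/\ n = 5, k = 2, l = 0 & m = 1] \/ [/\ n = 9, k = 4, l = 1 & m = 2].
Proof.
move=> es ei h sA nd; have ns := nonadj_sym es; have ni := @nonadj_irr _ e.
have hB := hom_nonadj ei h.
have [kb [lb [mb sB]]] := compl_srg es ei (hom_le (isT : 3 <= 5) h) sA.
have [a3 [a2 [a1 tA]]] := hom_triples es ei (isT : 3 <= 5) h.
have [b3 [b2 [b1 tB]]] := hom_triples ns ni (isT : 3 <= 5) hB.
have sA' : srg (nonadj (nonadj e)) [set: T] n k l m by rewrite nonadj_nonadj.
have tA' : srg_triples (nonadj (nonadj e)) [set: T] a3 a2 a1 by rewrite nonadj_nonadj.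
have ndb := nondeg_compl es ei sA sB nd.
have [F1 F2 F3 F4 F5] := nondeg_facts es ei sA sB nd.
have [_ _ _ _ F5'] := nondeg_facts ns ni sB sA' ndb.
have /and3P[m0 _ _] := nd; have /and3P[mb0 _ _] := ndb.
have L1 := triangle_free_compl es ei sA sB nd tA tB h.
have L2 := triangle_free_compl ns ni sB sA' ndb tB tA' hB.
have pos0 (i : nat) : i = 0 \/ 0 < i by case: i => [|i]; [left|right].
have [l0|l0] := pos0 l; last have [lb0|lb0] := pos0 lb; last first.
- right; have [a20|a20] := pos0 a2.
    by rewrite a20 in tA; exact: gq_parameters tA l0.
  have [b20|b20] := pos0 b2.
    (* The parameters 9, 4, 1, 2 are self-complementary. *)
    rewrite b20 in tB; have [] := gq_parameters ns ni hB sB ndb tB lb0.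
    by move: F1 F2 F3; clear => F1 F2 F3 ? ? ? ?; subst n kb lb mb; split; lia.
  have [la2 _] := a2_le_l es ei sA sB nd tA; have [lb2 _] := a2_le_l ns ni sB sA' ndb tB.
  have na2 := nondeg_a2_neq es ei sA sB nd tA l0; have nb2 := nondeg_a2_neq ns ni sB sA' ndb tB lb0.
  exfalso; apply: (local_nondeg_contra es ei sA sB nd tA tB h); rewrite /nondeg.
    by move: a20 la2 na2 F5; clear; lia.
  by move: b20 lb2 nb2 F5'; clear; lia.
- by move: l0; rewrite (L2 lb0).
left; have lb0 := L1 l0; move: F1 F2 F3 F4 F5 m0 mb0; rewrite l0 lb0; clear => F1 F2 F3 F4 F5 m0 mb0.
have m1 : m = 1 by lia.
have kk : kb = k by lia.
have k2 : k = 2 by move: F4; rewrite m1 kk; nia.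
by split; lia.
Qed.

From mathcomp Require Import classical_sets functions cardinality finmap.

(** * Extending isomorphisms between vertex lists *)

Section Extension.
Local Open Scope classical_set_scope.
Local Open Scope card_scope.
Variable G : graph.

Let V : choiceType := {classic G}.
Definition gadj : rel V := @adj G.

Lemma gadj_sym : symmetric gadj. Proof. exact: adj_sym. Qed.
Lemma gadj_irr : irreflexive gadj. Proof. exact: adj_irrefl. Qed.

(* Every vertex but the last is adjacent to a later one, so that lists can be
   extended one vertex at a time at the head. *)
Fixpoint connected_seq (s : seq V) : bool :=
  if s is x :: t then nilp t || connected_seq t && has (gadj x) t else true.

Definition extends_seq k := forall s s' : seq V, size s <= k -> connected_seq s ->
  same_type gadj s s' -> exists2 g : V -> V, @is_iso G G g & map g s = s'.

Lemma same_type_nth (s s' : seq V) x0 i j : same_type gadj s s' -> i < size s -> j < size s ->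
  (nth x0 s i == nth x0 s j) = (nth x0 s' i == nth x0 s' j) /\
  gadj (nth x0 s i) (nth x0 s j) = gadj (nth x0 s' i) (nth x0 s' j).
Proof.
case/andP=> /eqP sz /allrelP H is_ js; have zi k : k < size s -> (nth x0 s k, nth x0 s' k) \in zip s s'.
  move=> ks; rewrite -nth_zip // mem_nth // size_zip -sz minnn //.
by have /andP[/eqP -> /eqP ->] := H _ _ (zi i is_) (zi j js).
Qed.

Lemma same_type_sym (s s' : seq V) : same_type gadj s s' -> same_type gadj s' s.
Proof.
case/andP=> /eqP sz /allrelP H; rewrite /same_type sz eqxx /=; apply/allrelP => p q.
have zipE : zip s' s = [seq (x.2, x.1) | x <- zip s s'] by elim: (s) (s') {H sz} => [|x t IH] [|x' t'] //=; rewrite IH.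
rewrite zipE => /mapP[x xz ->] /mapP[y yz ->] /=.
by have /andP[/eqP -> /eqP ->] := H _ _ xz yz; rewrite !eqxx.
Qed.

Section Walk.
Variables (A : set G) (A0 : A !=set0).

Lemma walk_cat (H : graph) (x y z : H) n m : walk x y n -> walk y z m -> walk x z (n + m).
Proof.
case=> p [px lx <-] [q [qy ly <-]]; exists (p ++ q).
by rewrite cat_path last_cat size_cat px lx qy.
Qed.

Lemma walk1 (H : graph) (x y : H) : adj x y -> walk x y 1.
Proof. by move=> xy; exists [:: y]; rewrite /= xy. Qed.

Lemma connected_seq_induced (s : seq V) : connected_seq s -> (forall x, x \in s <-> A x) ->
  connected (induced A0).
Proof.
move=> cs sA.
have sub : forall t, connected_seq t -> {subset t <= s} -> forall x y : induced A0,
    (set_val x : V) \in t -> (set_val y : V) \in t -> exists n, walk x y n.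
  elim=> [//|a t IH] /= /orP[/nilP ->|/andP[ct /hasP[b bt ab]]] ts x y.
    rewrite !inE => /eqP xa /eqP ya; exists 0; have -> : x = y by apply: val_inj; exact: (etrans xa (esym ya)).
    by exists [::].
  have Ab : A b by apply/sA/ts; rewrite inE bt orbT.
  pose b' : induced A0 := SigSub (mem_set Ab).
  have IH' := IH ct (fun z zt => ts z (mem_behead (s := a :: t) zt)).
  rewrite !inE => /predU1P[xa|xt] /predU1P[ya|yt].
  - by exists 0; have -> : x = y by [apply: val_inj; exact: (etrans xa (esym ya))]; exists [::].
  - have [n w] := IH' b' y bt yt; exists (1 + n); apply: walk_cat w; apply: walk1.
    by move: ab; rewrite -xa.
  - have [n w] := IH' x b' xt bt; exists (n + 1); apply: (walk_cat w); apply: walk1.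
    by move: ab; rewrite -ya gadj_sym.
  - exact: IH'.
move=> x y; apply: (sub s) => //; apply/sA; exact: set_valP.
Qed.
End Walk.

Lemma order_at_most_seq (A : set V) (A0 : A !=set0) (s : seq V) :
  (forall x, x \in s <-> A x) -> order_at_most (@induced G A A0) (size s).
Proof.
move=> sA; rewrite /order_at_most (card_le_eql (card_setT A)).
have -> : A = [set` [fset x in s]%fset] by apply/seteqP; split=> x /=; rewrite inE => /sA.
have /card_eq_fsetP : #|` [fset x in s]%fset| = #|` [fset x in s]%fset| by [].
rewrite card_eq_le => /andP[le _].
by apply: card_le_trans le _; rewrite card_le_II card_fseq size_undup.
Qed.

Lemma order_at_most_size (A : set V) (A0 : A !=set0) (s : seq V) k :
  order_at_most (@induced G A A0) k -> uniq s -> (forall x, x \in s -> A x) -> size s <= k.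
Proof.
rewrite /order_at_most (card_le_eql (card_setT A)) => Ak us sA.
apply: leq_trans (geq_card_fset_set Ak); apply: uniq_leq_size => // x xs.
rewrite in_fset_set; first exact/mem_set/sA.
by apply/finite_set_leP; exists k.
Qed.

Section SeqIso.
Variables (s s' : seq V).
Hypothesis st : same_type gadj s s'.
Let A : set G := [set x : V | x \in s].
Let B : set G := [set x : V | x \in s'].

Lemma transport_subproof (x : set_type A) : B (nth (set_val x : V) s' (index (set_val x : V) s)).
Proof.
rewrite /B /= mem_nth // -(same_type_size st) index_mem.
by have := set_valP x.
Qed.

Definition transport (x : set_type A) : set_type B := SigSub (mem_set (transport_subproof x)).

End SeqIso.

Lemma transportE (s s' : seq V) (st : same_type gadj s s') a x0 :
  set_val (transport st a) = nth x0 s' (index (set_val a : V) s) :> V.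
Proof.
rewrite -[LHS]/(nth (set_val a : V) s' (index (set_val a : V) s)); apply: set_nth_default.
rewrite -(same_type_size st) index_mem; exact: (set_valP a).
Qed.

Lemma transportK (s s' : seq V) (st : same_type gadj s s') (st' : same_type gadj s' s) :
  cancel (transport st) (transport st').
Proof.
move=> x; apply: val_inj; set i := index (set_val x : V) s; set y := nth (set_val x : V) s' i.
rewrite -[LHS]/(nth y s (index y s')) -[RHS]/(set_val x : V).
have xs : (set_val x : V) \in s by exact: (set_valP x).
have is_ : i < size s by rewrite index_mem.
have is' : i < size s' by rewrite -(same_type_size st).
have js' : index y s' < size s' by rewrite index_mem mem_nth.
have js : index y s' < size s by rewrite (same_type_size st).
have [E _] := same_type_nth y st js is_.
have : nth y s (index y s') == nth y s i.
  rewrite E nth_index ?mem_nth // (set_nth_default (set_val x : V)) //.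
by rewrite /i (nth_index _ xs) => /eqP.
Qed.

(** The correspondence of entries is an isomorphism of the induced subgraphs, with inverse
    [transport st']. Only the first list is assumed connected; connectedness of the second is
    transported. *)
Lemma kCH_extends_seq k : kCH k G -> extends_seq k.
Proof.
move=> ch [|x s] s' sk cs st.
  by exists id; [split; [exists id|]|case/andP: st; case: s'].
have st' := same_type_sym st.
have A0 : [set y : V | y \in x :: s] !=set0 by exists x; rewrite /= mem_head.
have B0 : [set y : V | y \in s'] !=set0.
  by case: s' st {st'} => [/andP[]//|y t _]; exists y; rewrite /= mem_head.
have iso : @is_iso (induced A0) (induced B0) (transport st).
  split; first by exists (transport st'); exact: transportK.
  move=> a b.
  have as_ : (set_val a : V) \in x :: s by exact: (set_valP a).
  have bs : (set_val b : V) \in x :: s by exact: (set_valP b).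
  have ia : index (set_val a : V) (x :: s) < size (x :: s) by rewrite index_mem.
  have ib : index (set_val b : V) (x :: s) < size (x :: s) by rewrite index_mem.
  rewrite -[LHS]/(gadj (set_val (transport st a)) (set_val (transport st b))).
  rewrite !(transportE st _ x); have [_ <-] := same_type_nth x st ia ib.
  by rewrite (nth_index x as_) (nth_index x bs).
have cA : connected (induced A0) by apply: (connected_seq_induced cs).
have cB : connected (induced B0).
  move=> a b; have [fK gK] := (transportK st st', transportK st' st).
  have [n [p [pa pl pn]]] := cA (transport st' a) (transport st' b).
  exists n, (map (transport st) p); rewrite size_map; split=> //.
    have [_ ie] := iso; rewrite -[a]gK; apply: (homo_path _ pa) => u v uv.
    exact: (etrans (ie u v) uv).
  by rewrite -[a]gK last_map pl gK.
have oA : order_at_most (induced A0) k.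
  by apply: card_le_trans (order_at_most_seq (s := x :: s) A0 _) _; rewrite ?card_le_II.
have oB : order_at_most (induced B0) k.
  apply: card_le_trans (order_at_most_seq (s := s') B0 _) _ => //.
  by rewrite card_le_II -(same_type_size st).
have [g [gi ge]] := ch _ _ A0 B0 (transport st) cA cB oA oB iso.
exists g => //; apply: (@eq_from_nth _ x); first by rewrite size_map (same_type_size st).
rewrite size_map => i is_; rewrite (nth_map x) //.
have xi : nth x (x :: s) i \in x :: s by rewrite mem_nth.
have xi' : [set y : V | y \in x :: s] (nth x (x :: s) i) by [].
rewrite -[nth x (x :: s) i]/(set_val (SigSub (mem_set xi') : induced A0)) ge (transportE st _ x) /=.
have js : index (nth x (x :: s) i) (x :: s) < size (x :: s) by rewrite index_mem.
have [E _] := same_type_nth x st js is_.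
by apply/eqP; rewrite -E nth_index.
Qed.

Lemma frontier (A : set V) (A0 : A !=set0) (s : seq V) a y : connected (@induced G A A0) ->
  a \in s -> (forall x, x \in s -> A x) -> A y -> y \notin s ->
  exists z w, [/\ z \in s, w \notin s, A w & gadj w z].
Proof.
move=> cA as_ sA Ay ys; have Aa := sA a as_.
have [n [p [pa la _]]] := cA (SigSub (mem_set Aa)) (SigSub (mem_set Ay)).
have : (set_val (SigSub (mem_set Aa) : induced A0) : V) \in s by [].
elim: p (SigSub (mem_set Aa) : induced A0) pa la => [|v p IH] u /=.
  by move=> _ -> /=; rewrite (negPf ys).
move=> /andP[uv pv] lv us; case vs : ((set_val v : V) \in s); first exact: (IH v).
exists (set_val u), (set_val v); split=> //; first by rewrite vs.
  exact: set_valP.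
by rewrite gadj_sym.
Qed.

Lemma connected_seq_exists (A : set V) (A0 : A !=set0) k : connected (@induced G A A0) ->
  order_at_most (@induced G A A0) k ->
  exists s, [/\ connected_seq s, size s <= k & forall x, x \in s <-> A x].
Proof.
move=> cA oA; have szk s : uniq s -> (forall x, x \in s -> A x) -> size s <= k.
  exact: order_at_most_size oA.
(* [d] is fuel: it bounds the number of vertices by which [s] can still grow. *)
have grow d s a : k - size s <= d -> a \in s -> connected_seq s -> uniq s ->
    (forall x, x \in s -> A x) -> exists s', [/\ connected_seq s', size s' <= k & forall x, x \in s' <-> A x].
  elim: d s a => [|d IH] s a sd as_ cs us sA;
    (have [full|] := pselect (forall x, A x -> x \in s);
     [by exists s; split=> //; [exact: szk|move=> x; split; [exact: sA|exact: full]]|]);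
    move=> /existsNP[y /not_implyP[Ay /negP ys]];
    have [z [w [zs ws Aw wz]]] := frontier cA as_ sA Ay ys;
    (have wA x : x \in w :: s -> A x by rewrite inE => /predU1P[->|/sA]);
    (have := szk (w :: s); rewrite /= ws us => /(_ isT wA) sk).
    by move: sd; rewrite leqn0 subn_eq0 leqNgt sk.
  apply: (IH (w :: s) w) => //=; rewrite ?mem_head ?ws ?us ?cs //=.
    by rewrite subnS; move: sd; case: (k - size s).
  by apply/orP; right; apply/hasP; exists z.
have [a Aa] := A0; apply: (grow k [:: a] a) => //; first exact: leq_subr.
  by rewrite mem_head.
by move=> x; rewrite inE => /eqP->.
Qed.

Lemma extends_seq_kCH k : extends_seq k -> kCH k G.
Proof.
move=> ext A B A0 B0 f cA cB oA oB [fb fe].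
have [s [cs sk sA]] := connected_seq_exists cA oA.
have fi := bij_inj fb.
pose F (x : V) : V := if pselect (A x) is left Ax then set_val (f (SigSub (mem_set Ax))) else x.
have FE (x : induced A0) : F (set_val x) = set_val (f x).
  rewrite /F; case: pselect => [Ax|[]]; last exact: set_valP.
  by congr (set_val (f _)); apply: val_inj.
have [|g giso gs] := ext s (map F s) sk cs.
  rewrite /same_type size_map eqxx /=; apply/allrelP => p q.
  have -> : zip s (map F s) = [seq (x, F x) | x <- s] by elim: (s) => //= x t ->.
  move=> /mapP[x /sA Ax ->] /mapP[y /sA Ay ->] /=.
  have Fx := FE (SigSub (mem_set Ax)); have Fy := FE (SigSub (mem_set Ay)).
  rewrite /= in Fx Fy; rewrite Fx Fy; apply/andP; split; last first.
    by apply/eqP; have := fe (SigSub (mem_set Ax)) (SigSub (mem_set Ay)).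
  apply/eqP; apply/eqP/eqP => [E|/val_inj/fi E]; last by move/(congr1 val): E.
  by congr (set_val (f _)); apply: val_inj.
exists g; split=> // x; rewrite -FE.
have xs : (set_val x : V) \in s by apply/sA; exact: set_valP.
have sz : size (map g s) = size (map F s) by rewrite gs.
have := congr1 (fun t => nth (set_val x : V) t (index (set_val x : V) s)) gs.
by rewrite !(nth_map (set_val x : V)) ?index_mem // nth_index.
Qed.

End Extension.

(** * Local graphs *)

Section SameTypeCone.
Variables (V : eqType) (e : rel V).
Hypotheses (e_sym : symmetric e) (e_irr : irreflexive e).

Lemma same_type_rcons_cone u u' s s' : all (e u) s -> all (e u') s' -> same_type e s s' ->
  same_type e (rcons s u) (rcons s' u').
Proof.
elim: s s' => [|x s IH] [|x' s'] // => [_ _ _|]; first by rewrite /= same_type_cons.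
move=> /= /andP[ux us] /andP[ux' us']; rewrite !same_type_cons // => /andP[xs st].
rewrite IH // zip_rcons ?(same_type_size st) // all_rcons xs /= !(e_sym _ u) (e_sym _ u').
by rewrite ux ux' eqxx !(adj_neq e_irr) // e_sym.
Qed.

Lemma same_type_image (W : eqType) (f : W -> V) s s' : injective f ->
  same_type (fun x y => e (f x) (f y)) s s' -> same_type e (map f s) (map f s').
Proof.
move=> fi; rewrite /same_type !size_map => /andP[-> /allrelP H] /=.
have -> : zip (map f s) (map f s') = [seq (f p.1, f p.2) | p <- zip s s'].
  by elim: s s' {H} => [|x s IH] [|x' s'] //=; rewrite IH.
apply/allrelP => _ _ /mapP[p ps ->] /mapP[q qs ->] /=.
by rewrite !(inj_eq fi); apply: H.
Qed.

End SameTypeCone.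

Lemma nonadjP (V : eqType) (e : rel V) x y : nonadj e x y -> (x == y) = false /\ e x y = false.
Proof. by case/andP=> /negPf ? /negPf. Qed.

Ltac adjacencies := repeat match goal with
  | H : is_true (nonadj ?e ?a ?b) |- _ => lazymatch goal with
    | _ : e a b = false |- _ => fail
    | _ => have [? ?] := nonadjP H
    end
  end; rewrite /= ?eqxx; repeat match goal with
  | H : is_true (@gadj _ ?a ?b) |- context [@gadj _ ?a ?b] => rewrite H
  | H : is_true (@gadj _ ?a ?b) |- context [@gadj _ ?b ?a] => rewrite (gadj_sym b a) H
  | H : is_true (@gadj _ ?a ?b) |- context [?a == ?b] => rewrite (adj_neq (@gadj_irr _) H)
  | H : is_true (@gadj _ ?a ?b) |- context [?b == ?a] => rewrite (eq_sym b a) (adj_neq (@gadj_irr _) H)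
  | H : is_true (~~ @gadj _ ?a ?b) |- context [@gadj _ ?a ?b] => rewrite (negPf H)
  | H : is_true (~~ @gadj _ ?a ?b) |- context [@gadj _ ?b ?a] => rewrite (gadj_sym b a) (negPf H)
  | H : @gadj _ ?a ?b = false |- context [@gadj _ ?a ?b] => rewrite H
  | H : @gadj _ ?a ?b = false |- context [@gadj _ ?b ?a] => rewrite (gadj_sym b a) H
  | H : is_true (?a != ?b) |- context [?a == ?b] => rewrite (negPf H)
  | H : is_true (?a != ?b) |- context [?b == ?a] => rewrite (eq_sym b a) (negPf H)
  | H : (?a == ?b) = false |- context [?a == ?b] => rewrite H
  | H : (?a == ?b) = false |- context [?b == ?a] => rewrite (eq_sym b a) H
  end; rewrite /= ?eqxx ?andbT ?orbT.

Ltac same_types := rewrite !(same_type_cons (@gadj_sym _) (@gadj_irr _)); adjacencies; try done.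

Section LocalGraphs.
Variable G : graph.
Let V : choiceType := {classic G}.
Local Notation e := (@gadj G).
Let e_sym : symmetric e := @gadj_sym G.
Let e_irr : irreflexive e := @gadj_irr G.
Variable nb : V -> seq V.
Hypotheses (nb_uniq : forall x, uniq (nb x)) (nbP : forall x y, (y \in nb x) = e x y).

Definition automorphism (g : V -> V) := bijective g /\ forall x y, e (g x) (g y) = e x y.

Definition common_nbrs (x : V) (s : seq V) := count (fun w => all (e w) s) (nb x).

Lemma automorphism_inv g : automorphism g -> exists2 h, automorphism h & cancel g h /\ cancel h g.
Proof.
case=> [[h gh hg] ge]; exists h => //; split; first by exists g.
by move=> x y; rewrite -ge !hg.
Qed.

Lemma automorphism_comp g h : automorphism g -> automorphism h -> automorphism (g \o h).
Proof. by move=> [gb ge] [hb he]; split; [exact: bij_comp|move=> x y /=; rewrite ge he]. Qed.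

Lemma automorphism_inj g : automorphism g -> injective g.
Proof. by case=> /bij_inj. Qed.

Lemma common_aut g x s : automorphism g -> common_nbrs (g x) (map g s) = common_nbrs x s.
Proof.
move=> ga; have [h [_ he] [gh hg]] := automorphism_inv ga; have [_ ge] := ga.
have p : perm_eq (nb (g x)) (map g (nb x)).
  apply: uniq_perm; rewrite ?nb_uniq ?(map_inj_uniq (automorphism_inj ga)) // => y.
  by rewrite -[y]hg nbP ge (mem_map (automorphism_inj ga)) nbP.
rewrite /common_nbrs (seq.permP p) count_map; apply: eq_count => w /=.
by rewrite all_map; apply: eq_all => y /=; rewrite ge.
Qed.

Lemma common_gt0 x s : reflect (exists2 w, e x w & all (e w) s) (0 < common_nbrs x s).
Proof.
rewrite /common_nbrs -has_count; apply: (iffP hasP) => [[w]|[w xw ws]]; first by rewrite nbP; exists w.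
by exists w; rewrite ?nbP.
Qed.

Section LocalGraph.
Variable u : V.

Definition local_vertex : finType := seq_sub (nb u).
Definition local_adj : rel local_vertex := fun x y => e (val x) (val y).

Lemma local_sym : symmetric local_adj.
Proof. by move=> x y; apply: e_sym. Qed.

Lemma local_irr : irreflexive local_adj.
Proof. by move=> x; apply: e_irr. Qed.

Lemma local_adjacent (x : local_vertex) : e u (val x).
Proof. by rewrite -nbP; exact: (valP x). Qed.

Lemma card_local (P : pred V) : #|[set x : local_vertex | P (val x)]%SET| = count P (nb u).
Proof.
have p : perm_eq (map val (enum local_vertex)) (nb u).
  apply: uniq_perm; rewrite ?nb_uniq ?(map_inj_uniq val_inj) ?enum_uniq // => x.
  apply/mapP/idP => [[y _ ->]|xu]; first exact: (valP y).
  by exists (SeqSub xu); rewrite ?mem_enum.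
rewrite -(seq.permP p) count_map -size_filter cardE; apply/perm_size/uniq_perm; rewrite ?enum_uniq ?(filter_uniq _ (enum_uniq _)) // => x.
by rewrite mem_enum mem_filter mem_enum finset.in_set andbT.
Qed.

Lemma cn_local s : cn local_adj [set: local_vertex]%SET s = common_nbrs u (map val s).
Proof.
rewrite /cn /common_nbrs -(card_local (fun w => all (e w) (map val s))); apply: eq_card => x.
by rewrite !finset.inE all_map.
Qed.

Lemma connected_cone s : all (e u) s -> connected_seq (rcons s u).
Proof.
elim: s => //= x s IH /andP[ux us]; rewrite IH // orbC has_rcons.
by rewrite -[gadj x u]/(e x u) e_sym ux.
Qed.

(** Putting [u] at the end of both lists makes every earlier vertex adjacent to a later one, so the
    lists are connected whatever their entries in the neighbourhood are. *)
Lemma hom_local k : @extends_seq G k.+1 -> hom k local_adj [set: local_vertex]%SET.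
Proof.
move=> ext s s' sk _ _ st.
have cone (t : seq local_vertex) : all (e u) (map val t).
  by rewrite all_map; apply/allP => x _; apply: local_adjacent.
have [|||g [gb ge] gs] := ext (rcons (map val s) u) (rcons (map val s') u).
- by rewrite size_rcons size_map.
- exact: connected_cone.
- have st' := @same_type_image V e _ val s s' val_inj st.
  exact: same_type_rcons_cone.
move: gs; rewrite map_rcons => /rcons_inj[gs gu].
have gnb x : x \in nb u -> g x \in nb u by rewrite !nbP -{2}gu => ux; rewrite [e _ _]ge.
pose f (x : local_vertex) : local_vertex := SeqSub (gnb _ (valP x)).
have fi : injective f by move=> x y [] /(bij_inj gb) xy; apply: val_inj.
exists (perm fi); split=> [x y|x|]; rewrite ?inE // ?permE //; first exact: ge.
apply: (inj_map val_inj); rewrite -gs -!map_comp; apply: eq_map => x /=.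
by rewrite permE.
Qed.

End LocalGraph.

Definition locally_srg n k l m := [/\ forall u, size (nb u) = n,
  forall u x, e u x -> common_nbrs u [:: x] = k,
  forall u x y, e u x -> e u y -> e x y -> common_nbrs u [:: x; y] = l &
  forall u x y, e u x -> e u y -> nonadj e x y -> common_nbrs u [:: x; y] = m].

(** Single vertices can be moved to [u], so the parameters found there hold at every vertex. *)
Lemma locally_srg_exists (u : V) : @extends_seq G 6 -> exists n k l m,
  locally_srg n k l m /\ srg (@local_adj u) [set: local_vertex u]%SET n k l m.
Proof.
move=> ext; have [n [k [l [m H]]]] := hom_srg (@local_sym u) (@local_irr u) (isT : 2 <= 5) (hom_local (u:=u) ext).
exists n, k, l, m; split=> //.
have vt w : exists2 g, automorphism g & g w = u.
  have [||//|g ga [gw]] := ext [:: w] [:: u] => //; first by rewrite same_type_cons.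
  by exists g.
have [Hn Hk Hl Hm] := H; split.
- move=> w; have [g ga gw] := vt w.
  have := common_aut w [::] ga; rewrite gw /common_nbrs !count_predT => <-.
  by rewrite -Hn cardsE card_seq_sub.
- move=> w x wx; have [g ga gw] := vt w; have [_ ge] := ga.
  have ux : g x \in nb u by rewrite nbP -gw ge.
  by rewrite -(common_aut w _ ga) gw -(Hk (SeqSub ux)) ?inE // cn_local.
- move=> w x y wx wy xy; have [g ga gw] := vt w; have [_ ge] := ga.
  have ux : g x \in nb u by rewrite nbP -gw ge.
  have uy : g y \in nb u by rewrite nbP -gw ge.
  rewrite -(common_aut w _ ga) gw -(Hl (SeqSub ux) (SeqSub uy)) ?inE ?cn_local //.
  by rewrite /local_adj /= ge.
- move=> w x y wx wy xy; have [g ga gw] := vt w; have [_ ge] := ga.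
  have ux : g x \in nb u by rewrite nbP -gw ge.
  have uy : g y \in nb u by rewrite nbP -gw ge.
  rewrite -(common_aut w _ ga) gw -(Hm (SeqSub ux) (SeqSub uy)) ?inE ?cn_local //.
  rewrite /local_adj /nonadj /= ge -(inj_eq val_inj) /= (inj_eq (automorphism_inj ga)).
  exact: xy.
Qed.

End LocalGraphs.

(** * Exclusion of the pentagon and the rook graph *)

Section CommonNeighbours.
Variable G : graph.
Let V : choiceType := {classic G}.
Local Notation e := (@gadj G).
Let e_sym : symmetric e := @gadj_sym G.
Let e_irr : irreflexive e := @gadj_irr G.
Variable nb : V -> seq V.
Hypotheses (nb_uniq : forall x, uniq (nb x)) (nbP : forall x y, (y \in nb x) = e x y).
Hypothesis ext : @extends_seq G 6.
Variables n k l m : nat.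
Hypothesis loc : @locally_srg G nb n k l m.
Local Notation common := (@common_nbrs G nb).

Lemma common_swap x y s : common x (y :: s) = common y (x :: s).
Proof.
rewrite /common_nbrs -!size_filter; apply/perm_size/uniq_perm; rewrite ?filter_uniq ?nb_uniq // => w.
rewrite !mem_filter /= !nbP (e_sym w x) (e_sym w y).
by case: (e y w); case: (e x w); rewrite ?andbT ?andbF.
Qed.

Lemma common_perm x s s' : perm_eq s s' -> common x s = common x s'.
Proof. by move=> p; apply: eq_count => w; apply: perm_all. Qed.

Lemma commonC x a b : common x [:: a; b] = common x [:: b; a].
Proof. by apply/common_perm/permPl/(perm_catC [:: a] [:: b]). Qed.

Lemma common_sub x s s' : {subset s <= s'} -> common x s' <= common x s.
Proof. by move=> ss; apply: sub_count => z /allP H; apply/allP => y /ss/H. Qed.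

Lemma sum_nat_seq_const (s : seq V) F c : {in s, forall z, F z = c} -> \sum_(z <- s) F z = size s * c.
Proof.
move=> Fc; rewrite big_seq (eq_bigr (fun=> c)) // -big_seq big_const_seq count_predT.
by rewrite iter_addn_0 mulnC.
Qed.

Lemma sum_indicator (p : pred V) (s : seq V) : \sum_(x <- s) (p x : nat) = count p s.
Proof. by rewrite -sum1_count [RHS]big_mkcond; apply: eq_bigr => r _; case: (p r). Qed.

Lemma sum_count_sym (A B : seq V) : \sum_(z <- A) count (e z) B = \sum_(r <- B) count (e r) A.
Proof.
under eq_bigr do rewrite -sum_indicator; under [RHS]eq_bigr do rewrite -sum_indicator.
by rewrite exchange_big; apply: eq_bigr => r _; apply: eq_bigr => z _; rewrite e_sym.
Qed.

Variables u w : V.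
Hypothesis uw : nonadj e u w.
(* In the neighbourhood of [w], the common neighbours [C] of [u] and [w] induce a
   graph of valency [m], and every vertex of [D] has the same number of
   neighbours in [C]. *)
Let C := [seq z <- nb w | e u z].
Let D := [seq z <- nb w | ~~ e u z].

Lemma deg_C z : count (e z) C = common w [:: u; z].
Proof.
by rewrite count_filter; apply: eq_count => x /=; rewrite andbT andbC !(e_sym x).
Qed.

Lemma mem_C z : (z \in C) = e u z && e w z.
Proof. by rewrite mem_filter nbP. Qed.

Lemma mem_D z : (z \in D) = ~~ e u z && e w z.
Proof. by rewrite mem_filter nbP. Qed.

Lemma count_CD p : count p (nb w) = count p C + count p D.
Proof. by rewrite -count_cat; apply/esym/seq.permP; rewrite perm_filterC. Qed.

Lemma deg_C_mem z : z \in C -> count (e z) C = m.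
Proof.
rewrite mem_C deg_C => /andP[uz wz]; have [_ _ _ Hm] := loc.
rewrite commonC common_swap commonC.
by apply: Hm; rewrite // e_sym.
Qed.

Lemma size_CD : size C + size D = n.
Proof. by have [Hn _ _ _] := loc; rewrite -(Hn w) -(count_predT (nb w)) count_CD !count_predT. Qed.

Lemma deg_w z : e w z -> count (e z) (nb w) = k.
Proof.
move=> wz; have [_ Hk _ _] := loc; rewrite -(Hk w z wz).
by apply: eq_count => x /=; rewrite andbT e_sym.
Qed.

Lemma deg_D z : z \in C -> count (e z) D = k - m.
Proof.
move=> zC; rewrite -(deg_C_mem zC) -(@deg_w z); last by move: zC; rewrite mem_C => /andP[].
by rewrite count_CD addKn.
Qed.

(** The vertices [u], [z], [w], [r] form an induced path, which an automorphism takes to [u], [z'],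
    [w], [r']. *)
Lemma deg_const r r' z z' : r \in D -> r' \in D -> z \in C -> z' \in C -> ~~ e r z -> ~~ e r' z' ->
  count (e r) C = count (e r') C.
Proof.
rewrite !mem_C !mem_D !deg_C => /andP[ur wr] /andP[ur' wr'] /andP[uz wz] /andP[uz' wz'] rz rz'.
have neq x y : ~~ e u x -> e u y -> x != y by move=> ux; apply: contraTneq => <-.
have rz1 := neq _ _ ur uz; have rz1' := neq _ _ ur' uz'.
have uwr x : e w x -> u != x by apply: contraTneq => <-; rewrite e_sym; case/nonadjP: uw => _ ->.
have ur1 := uwr _ wr; have ur1' := uwr _ wr'.
have [|||g ga [gr gw _ gu]] := ext (s := [:: r; w; z; u]) (s' := [:: r'; w; z'; u]) => //.
- by adjacencies.
- by same_types.
by rewrite -(common_aut nb_uniq nbP w [:: u; r] ga) /= gw gu gr.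
Qed.

Hypothesis lm : l < m.

(** If [r] were adjacent to all of [C], the [m] neighbours of [z0] in [C] would be among the [l]
    common neighbours of [w], [z0] and [r]. *)
Lemma D_nonadj z0 r : z0 \in C -> r \in D -> exists2 z, z \in C & ~~ e r z.
Proof.
move=> z0C rD; apply/hasP/negPn; rewrite has_predC negbK; apply/negP => /allP rC.
have := z0C; rewrite mem_C => /andP[uz0 wz0]; have := rD; rewrite mem_D => /andP[_ wr].
have [_ _ Hl _] := loc; have := Hl w z0 r wz0 wr.
rewrite e_sym rC // => /(_ isT) cl; move: lm; rewrite -cl -(deg_C_mem z0C) ltnNge => /negP; apply.
rewrite -[X in _ <= X]size_filter -size_filter; apply: uniq_leq_size => [|x]; first by rewrite !filter_uniq ?nb_uniq.
rewrite !mem_filter /= nbP => /and3P[zx ux wx]; rewrite wx (e_sym x z0) zx (e_sym x r) rC //.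
by rewrite mem_C ux.
Qed.

Lemma edges_C_D z0 : z0 \in C -> exists2 h, size C * (k - m) = size D * h &
  forall r, r \in D -> count (e r) C = h.
Proof.
move=> z0C; rewrite -(sum_nat_seq_const deg_D) sum_count_sym.
case: (D) deg_const (fun r => @D_nonadj z0 r z0C) => [_ _|r0 D' cst nadj]; first by exists 0; rewrite ?big_nil.
have [z1 z1C rz1] := nadj r0 (mem_head _ _).
have H r : r \in r0 :: D' -> count (e r) C = count (e r0) C.
  by move=> rD; have [z zC rz] := nadj r rD; apply: (cst r r0 z z1) => //; apply: mem_head.
by exists (count (e r0) C) => //; apply: sum_nat_seq_const.
Qed.

Lemma edges_C_D_le z0 : z0 \in C -> m < k ->
  exists h, [/\ size C * (k - m) = size D * h, h <= k, 0 < size C & 0 < size D].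
Proof.
move=> z0C mk; have [h dc hD] := edges_C_D z0C; have C0 : 0 < size C by case: (C) z0C.
have D0 : 0 < size D by rewrite lt0n; apply: contra_eqN dc => /eqP ->; rewrite mul0n -lt0n muln_gt0 C0 subn_gt0.
exists h; split=> //; case: (D) D0 hD (fun r => @mem_D r) => // r D' _ hD memD.
rewrite -(hD r (mem_head _ _)) -(@deg_w r); last by have := memD r; rewrite mem_head => /esym/andP[].
by rewrite [leqRHS]count_CD leq_addr.
Qed.

Lemma pentagon_contra z0 : z0 \in C -> [/\ n = 5, k = 2, l = 0 & m = 1] -> False.
Proof.
move=> z0C [n5 k2 _ m1]; have mk : m < k by rewrite k2 m1.
have [h [dc hk C0 D0]] := edges_C_D_le z0C mk; have := size_CD.
move: dc hk C0 D0; rewrite n5 k2 m1; case: h => [|[|[|//]]]; clear; lia.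
Qed.

Hypothesis params : [/\ n = 9, k = 4, l = 1 & m = 2].

(** A triangle has just [l = 1] common neighbour, but one inside [C] would have both [u] and [w]. *)
Lemma C_triangle_free z z' : z \in C -> z' \in C -> e z z' -> count (predI (e z) (e z')) C = 0.
Proof.
rewrite !mem_C => /andP[uz wz] /andP[uz' wz'] zz'; apply/eqP; rewrite -leqn0 leqNgt -has_count.
apply/hasP => -[y]; rewrite mem_C => /andP[uy wy] /= /andP[zy z'y].
have [_ _ Hl _] := loc; have [_ _ l1 _] := params.
have := Hl z z' y zz' zy z'y; rewrite l1 /common_nbrs -size_filter => s1.
have := @uniq_leq_size _ [:: u; w] [seq x <- nb z | all (e x) [:: z'; y]]; rewrite s1 /= inE andbT.
case/nonadjP: uw => -> _ /(_ isT) H; suff: 1 < 1 by [].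
apply: H => x; rewrite !inE mem_filter /= nbP => /orP[] /eqP ->; by rewrite ?uz' ?uy ?wz' ?wy /= e_sym.
Qed.

Lemma size_C_neq3 z0 : z0 \in C -> size C != 3.
Proof.
move=> z0C; apply/eqP => C3; have [_ _ _ m2] := params.
have := deg_C_mem z0C; rewrite m2 => d0; have : 0 < count (e z0) C by rewrite d0.
rewrite -has_count => /hasP[z1 z1C z01]; have := deg_C_mem z1C; rewrite m2 => d1.
have := count_predUI (e z0) (e z1) C; rewrite d0 d1 C_triangle_free // addn0 => s4.
by have := count_size (predU (e z0) (e z1)) C; rewrite s4 C3.
Qed.

Lemma pair_const z x x' : z \in C -> x \in C -> x' \in C -> nonadj e z x -> nonadj e z x' ->
  count (predI (e z) (e x)) C = count (predI (e z) (e x')) C.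
Proof.
have cE y : count (predI (e z) (e y)) C = common w [:: u; z; y].
  by rewrite count_filter; apply: eq_count => v /=; rewrite andbT andbC !(e_sym v).
rewrite !mem_C !cE => /andP[uz wz] /andP[ux wx] /andP[ux' wx'] zx zx'.
have [|||g ga [gx gw gz gu]] := ext (s := [:: x; w; z; u]) (s' := [:: x'; w; z; u]) => //.
- by adjacencies.
- by same_types.
by rewrite -(common_aut nb_uniq nbP w [:: u; z; x] ga) /= gw gu gz gx.
Qed.

(** [C] would be 2-regular and without triangles. The four walks of length two from [z] return
    twice; the other two end among the three vertices not adjacent to [z], each of which is reached
    equally often by [pair_const], so that 3 would divide 2. *)
Lemma size_C_neq6 z : z \in C -> size C != 6.
Proof.
move=> zC; apply/eqP => C6; have [_ _ _ m2] := params.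
pose h x := count (predI (e z) (e x)) C.
have dC x : x \in C -> count (e x) C = 2 by move=> xC; rewrite deg_C_mem.
have total : \sum_(x <- C) h x = 4.
  have -> : \sum_(x <- C) h x = \sum_(x <- C) count (e x) [seq y <- C | e z y].
    by apply: eq_bigr => x _; rewrite count_filter; apply: eq_count => y /=; rewrite andbC.
  rewrite sum_count_sym (sum_nat_seq_const (c := 2)) ?size_filter ?dC // => x.
  by rewrite mem_filter => /andP[_ /dC].
have Cu : uniq C by rewrite filter_uniq ?nb_uniq.
have hz : h z = 2 by rewrite /h -(dC z zC); apply: eq_count => y /=; rewrite andbb.
have [c hc] : exists c, forall x, x \in C -> nonadj e z x -> h x = c.
  have [/hasP[x0 x0C zx0]|/hasPn none] := boolP (has (nonadj e z) C).
    by exists (h x0) => x xC zx; apply: pair_const.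
  by exists 0 => x xC zx; case/negP: (none x xC).
have : \sum_(x <- C) h x = \sum_(x <- C) (2 * (x == z) + c * nonadj e z x).
  rewrite !big_seq; apply: eq_bigr => x xC; rewrite /nonadj eq_sym; case: eqVneq => [<-|zx].
    by rewrite hz /= muln0 addn0.
  have [zx'|zx'] := boolP (e z x); first by rewrite /h C_triangle_free //= !muln0.
  by rewrite hc /nonadj ?zx ?zx' //= muln1.
have parts : \sum_(x <- C) ((x == z) + (e z x + nonadj e z x)) = 6.
  rewrite -C6 -sum1_size; apply: eq_bigr => x _; rewrite /nonadj eq_sym; case: eqVneq => [<-|_] /=.
    by rewrite e_irr.
  by case: (e z x).
have cz : count (fun x => x == z) C = 1 by rewrite (count_uniq_mem _ Cu) zC.
rewrite total big_split -!big_distrr /=; move: parts.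
rewrite !big_split !(sum_indicator (fun x => x == z)) (sum_indicator (e z)) (sum_indicator (nonadj e z)).
by rewrite cz dC //=; move: (count _ _) => j; clear; lia.
Qed.

(** The edge count [2 |C| = h |D|] with [|C| + |D| = 9] and [h <= 4] leaves only 3 and 6 for the
    size of [C]. *)
Lemma rook_contra z : z \in C -> False.
Proof.
move=> zC; have [n9 k4 _ m2] := params; have mk : m < k by rewrite k4 m2.
have [h [dc hk C0 D0]] := edges_C_D_le zC mk; have := size_CD.
have := size_C_neq3 zC; have := size_C_neq6 zC.
move: dc hk C0 D0; rewrite n9 k4 m2; move: (size C) (size D) => c d.
case: h => [|[|[|[|[|//]]]]]; clear; lia.
Qed.

End CommonNeighbours.

(** * From [k]-CH to [(k+1)]-CH *)

(** The correction needed to extend an isomorphism by one vertex: [v] is where the automorphism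
    found so far sends that vertex, [w] where it should go. The edge [x y] records that the set has
    further vertices near [v]; the grid case relies on it. *)
Definition swap_property (G : graph) := forall (s : seq {classic G}) v w x y,
  v \notin s -> w \notin s -> v != w -> {in s, forall a, gadj v a = gadj w a} ->
  x \in s -> y \in s -> gadj v x -> gadj x y ->
  exists h, [/\ @automorphism G h, {in s, forall a, h a = a} & h v = w].

(** * Locally complete multipartite graphs *)

Section Multipartite.
Variable G : graph.
Let V : choiceType := {classic G}.
Local Notation e := (@gadj G).
Let e_sym : symmetric e := @gadj_sym G.
Let e_irr : irreflexive e := @gadj_irr G.
Variable nb : V -> seq V.
Hypotheses (nb_uniq : forall x, uniq (nb x)) (nbP : forall x y, (y \in nb x) = e x y).
Hypothesis ext : @extends_seq G 6.
Variables n k l : nat.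
Hypothesis loc : @locally_srg G nb n k l k.
Hypothesis k0 : 0 < k.
Local Notation common := (@common_nbrs G nb).

(** The neighbours that [z] shares with both [x] and [y] are as many as those it shares with [x], so
    the two sets coincide. *)
Lemma multipartite_closed x y z a : nonadj e x y -> e x z -> e y z -> e z a -> e x a -> e y a.
Proof.
move=> xy xz yz za xa; have [_ Hk _ Hm] := loc.
have zx : e z x by rewrite e_sym.
have zy : e z y by rewrite e_sym.
have := Hm z x y zx zy xy; rewrite -(Hk z x zx) /common_nbrs -!size_filter => sz.
have [||_ /(_ a)] := uniq_min_size (s1 := [seq w <- nb z | all (e w) [:: x; y]])
  (s2 := [seq w <- nb z | all (e w) [:: x]]) _ _ (eq_leq (esym sz)).
- by rewrite filter_uniq ?nb_uniq.
- by move=> w; rewrite !mem_filter /= => /andP[/and3P[-> _ _] ->].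
rewrite !mem_filter nbP /= za (e_sym a x) xa /= !andbT => /idP.
by rewrite e_sym.
Qed.

(** If [a] is not adjacent to [z], then [x], [z], [a] have a common neighbour [b] since [k > 0];
    [multipartite_closed] is applied first to reach [b], then to pass from [b] to [a]. *)
Lemma twins x y z a : nonadj e x y -> e x z -> e y z -> e x a -> e y a.
Proof.
move=> xy xz yz xa; have [za|nza] := boolP (e z a); first exact: multipartite_closed za xa.
have [<-//|az] := eqVneq z a; have [_ _ _ Hm] := loc.
have := Hm x z a xz xa; rewrite /nonadj az nza => /(_ isT) ck.
have : 0 < common x [:: z; a] by rewrite ck.
case/(common_gt0 nbP) => b xb /and3P[bz ba _].
have yb : e y b by apply: (multipartite_closed xy xz yz _ xb); rewrite e_sym.
exact: (multipartite_closed xy xb yb).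
Qed.

Lemma twins_eq x y z a : nonadj e x y -> e x z -> e y z -> e x a = e y a.
Proof.
move=> xy xz yz; apply/idP/idP; first exact: twins xy xz yz.
by apply: twins yz xz; rewrite nonadj_sym.
Qed.

(* [e v x != e w x] says that [x] is a twin of [v] or of [w]. *)
Definition swap_classes (v w : V) (g : V -> V) (x : V) := if e v x != e w x then g x else x.

Lemma class_twin v w x a : e v w -> e w x -> ~~ e v x -> e x a = e v a.
Proof.
move=> vw wx nvx; have [->//|vx] := eqVneq v x.
by apply/esym/(@twins_eq _ _ w) => //; [rewrite /nonadj vx|rewrite e_sym].
Qed.

Lemma swap_classes_adj v w g : e v w -> automorphism g -> g v = w -> g w = v ->
  forall x y, e (swap_classes v w g x) (swap_classes v w g y) = e x y.
Proof.
move=> vw [_ ge] gv gw; have wv : e w v by rewrite e_sym.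
have gvE x : e v (g x) = e w x by rewrite -gw ge.
have gwE x : e w (g x) = e v x by rewrite -gv ge.
have mixed x y : e v x != e w x -> e v y = e w y -> e (g x) y = e x y.
  have := gvE x; have := gwE x; case vx: (e v x); case wx: (e w x) => // gwx gvx _ yE.
    by rewrite (class_twin _ wv vx) ?wx // (class_twin _ vw gwx) ?gvx.
  by rewrite (class_twin _ vw wx) ?vx // (class_twin _ wv gvx) ?gwx.
move=> x y; rewrite /swap_classes; have [xE|xE] := eqVneq (e v x); have [yE|yE] := eqVneq (e v y) => //=.
- by rewrite e_sym mixed // e_sym.
- exact: mixed.
Qed.

Lemma swap_classesK v w g g' : g v = w -> g w = v -> (forall x y, e (g x) (g y) = e x y) ->
  cancel g g' -> cancel (swap_classes v w g) (swap_classes v w g').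
Proof.
move=> gv gw ge gK x; rewrite /swap_classes; case: (eqVneq (e v x)) => [xE|xE] /=.
  by rewrite xE eqxx.
by rewrite -{1}gw -{2}gv !ge eq_sym xE gK.
Qed.

Lemma multipartite_swap : swap_property G.
Proof.
move=> s v w x y vs ws vw_neq svw xs ys vx xy; have [vw|nvw] := boolP (e v w).
  have [|||g ga [gv gw]] := ext (s := [:: v; w]) (s' := [:: w; v]) => //; [by adjacencies|by same_types|].
  have wv : e w v by rewrite e_sym.
  have [g' ga' [gK g'K]] := automorphism_inv ga; have [_ ge] := ga; have [_ ge'] := ga'.
  have gv' : g' v = w by rewrite -gw gK.
  have gw' : g' w = v by rewrite -gv gK.
  exists (swap_classes v w g); split; first split.
  - by exists (swap_classes v w g'); apply: swap_classesK.
  - exact: swap_classes_adj.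
  - by move=> a /svw E; rewrite /swap_classes E eqxx.
  - by rewrite /swap_classes e_irr wv.
pose h a := if a == v then w else if a == w then v else a.
have hK : involutive h.
  move=> a; rewrite /h; case: (eqVneq a v) => [->|av]; first by rewrite eq_sym (negPf vw_neq) eqxx.
  by case: (eqVneq a w) => [->|aw]; rewrite ?eqxx // (negPf av) (negPf aw).
have wx : e w x by rewrite -svw.
have E : nonadj e v w by rewrite /nonadj vw_neq.
have T a : e v a = e w a by apply: (twins_eq _ E vx wx).
have hE a b : e (h a) b = e a b.
  by rewrite /h; case: (eqVneq a v) => [->|av]; [|case: (eqVneq a w) => [->|aw]]; rewrite ?T.
exists h; split; first split.
- exact: inv_bij.
- by move=> a b; rewrite hE e_sym hE e_sym.
- move=> a as_; rewrite /h; case: eqVneq => [av|_]; first by rewrite -av as_ in vs.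
  by case: eqVneq => // aw; rewrite -aw as_ in ws.
- by rewrite /h eqxx.
Qed.

End Multipartite.

Section Step.
Variable G : graph.
Let V : choiceType := {classic G}.
Local Notation e := (@gadj G).
Let e_sym : symmetric e := @gadj_sym G.
Let e_irr : irreflexive e := @gadj_irr G.

Lemma extends_seq_le k k' : k' <= k -> @extends_seq G k -> @extends_seq G k'.
Proof. by move=> kk ext s s' sk; apply: ext; apply: leq_trans kk. Qed.

Lemma connected_seq_nbr (s : seq V) x : connected_seq s -> 1 < size s -> x \in s -> has (e x) s.
Proof.
elim: s => // a t IH /= /orP[/nilP -> //|/andP[ct at_]] _; rewrite inE => /predU1P[->|xt].
  by rewrite at_ orbT.
case: (ltnP 1 (size t)) => [t1|t1]; first by rewrite IH ?orbT.
case: t {IH} ct at_ xt t1 => [|b [|//]] //= _; rewrite orbF inE => ab /eqP -> _.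
by rewrite -[gadj b a]/(e b a) e_sym ab.
Qed.

(** After extending the isomorphism of the tails, the image of [v] and the desired [v'] have the
    same neighbours in [s']; a map fixing [s'] and taking one to the other repairs the
    difference. *)
Lemma extends_seq_step k : 2 < k -> swap_property G -> @extends_seq G k -> @extends_seq G k.+1.
Proof.
move=> k2 swp ext [|v s] s' sk cs st; first exact: (ext [::]).
have := same_type_size st; case: s' st => // v' s' st _.
have [sk'|sk'] := leqP (size (v :: s)) k; first exact: ext.
have s2 : 1 < size s by apply: leq_trans (ltnW k2) _.
move: st cs; rewrite same_type_cons // => /andP[vv' st] /= /orP[/nilP s0|/andP[cs /hasP[x xs vx]]].
  by rewrite s0 in s2.
have [g ga gs] := ext s s' sk cs st; have [gb ge0] := ga; have gi := bij_inj gb.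
have ge a b : e (g a) (g b) = e a b := ge0 a b.
have {}vv' y : y \in s -> (v == y) = (v' == g y) /\ e v y = e v' (g y).
  have zE : zip s s' = [seq (y, g y) | y <- s] by rewrite -gs; elim: (s) => //= a t ->.
  move=> ys; have := allP vv' (y, g y); rewrite zE map_f // => /(_ isT) /andP[/eqP -> /eqP ->] //.
have [gv|gv] := eqVneq (g v) v'; first by exists g; rewrite //= gv gs.
have vs : v \notin s by apply: contra gv => /vv'[]; rewrite eqxx eq_sym.
have [y ys xy] := hasP (connected_seq_nbr cs s2 xs).
have [||||||||h [ha hs hv]] := swp s' (g v) v' (g x) (g y).
- by rewrite -gs mem_map.
- rewrite -gs; apply/mapP => -[a as_ v'a]; have [] := vv' a as_.
  by rewrite v'a eqxx => /eqP va; rewrite va as_ in vs.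
- by [].
- by rewrite -gs => a /mapP[b bs ->]; have [_ <-] := vv' b bs; rewrite ge.
- by rewrite -gs map_f.
- by rewrite -gs map_f.
- by rewrite ge.
- by rewrite ge.
exists (h \o g); first exact: automorphism_comp.
rewrite /= hv map_comp gs; congr cons; rewrite -[RHS]map_id.
exact/eq_in_map.
Qed.

End Step.

(** * Graphs that are locally unions of cliques *)

Section Grid.
Variable G : graph.
Let V : choiceType := {classic G}.
Local Notation e := (@gadj G).
Let e_sym : symmetric e := @gadj_sym G.
Let e_irr : irreflexive e := @gadj_irr G.
Variable nb : V -> seq V.
Hypotheses (nb_uniq : forall x, uniq (nb x)) (nbP : forall x y, (y \in nb x) = e x y).
Hypothesis ext : @extends_seq G 6.
Variables n k l : nat.
Hypothesis loc : @locally_srg G nb n k l 0.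
Hypothesis k0 : 0 < k.
Hypothesis two_common : forall x y z, nonadj e x y -> e z x -> e z y ->
  exists z', [/\ z' != z, e z' x & e z' y].
Local Notation common := (@common_nbrs G nb).

Lemma grid_line_trans x a b c : e x a -> e x b -> e x c -> e a b -> e b c -> a != c -> e a c.
Proof.
move=> xa xb xc ab bc ac; apply: contraT => nac; have [_ _ _ Hm] := loc.
have := Hm x a c xa xc; rewrite /nonadj ac nac => /(_ isT) c0.
suff : 0 < common x [:: a; c] by rewrite c0.
by apply/(common_gt0 nbP); exists b; rewrite //= bc e_sym ab.
Qed.

Lemma grid_line_third a b : e a b -> exists2 c, e a c & e b c.
Proof.
move=> ab; have [_ Hk _ _] := loc; have : 0 < common a [:: b] by rewrite (Hk a b ab).
by case/(common_gt0 nbP) => c ac /andP[cb _]; exists c; rewrite // e_sym.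
Qed.

Lemma grid_diamond z x y : nonadj e x y -> e z x -> e z y -> forall z', e z' x -> e z' y -> ~~ e z z'.
Proof.
move=> xy zx zy z' z'x z'y; apply/negP => zz'; have [neq nxy] := nonadjP xy.
suff : e x y by rewrite nxy.
by apply: (@grid_line_trans z' x z y) => //; rewrite ?neq // e_sym.
Qed.

Lemma grid_gq_axiom p a b c : ~~ col e p a -> e p c -> e c a -> e a b ->
  exists q, [/\ e p q, e a q & col e q b].
Proof.
move=> pa pc ca ab; have ac : e a c by rewrite e_sym.
have cp : e c p by rewrite e_sym.
have ba : e b a by rewrite e_sym.
have npa : nonadj e p a by rewrite -col_nonadj.
have [pb|pb] := boolP (e p b); first by exists b; rewrite pb ab colxx.
have [cb|cb] := boolP (col e c b); first by exists c.
have [z [zc zp za]] := two_common npa cp ca.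
have [pz az] : e p z /\ e a z by rewrite ![e _ z]e_sym.
have [zb|zb] := boolP (col e z b); first by exists z.
have [z' az' zz'] := grid_line_third az.
have ncz : nonadj e c z by rewrite /nonadj eq_sym zc (grid_diamond npa).
have z'z : e z' z by rewrite e_sym.
have z'a : e z' a by rewrite e_sym.
have cz' : c != z' by apply: contraTneq zz' => <-; rewrite e_sym; case/nonadjP: ncz => _ ->.
have ncz' : nonadj e c z'.
  rewrite /nonadj cz'; apply/negP => cz''; have [neq nadj] := nonadjP ncz.
  by move: nadj; rewrite (@grid_line_trans a c z' z) ?neq.
have npz' : ~~ e p z'.
  apply/negP => pz'; have [neq nadj] := nonadjP npa; move: nadj.
  by rewrite (@grid_line_trans z p z' a) // ?neq // e_sym.
have pz'_neq : p != z' by apply: contraTneq az' => <-; rewrite e_sym; case/nonadjP: npa => _ ->.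
have pb_neq : p != b by apply: contraTneq ab => <-; rewrite e_sym; case/nonadjP: npa => _ ->.
have ncb : nonadj e c b by rewrite -col_nonadj.
(* The vertex [c] keeps the lists connected. Since [z] is adjacent to [p], [a] and [z'], its image
   is adjacent to [p], [a] and [b]. *)
have [|||g [_ ge0] [gz' ga gc gp]] := ext (s := [:: z'; a; c; p]) (s' := [:: b; a; c; p]) => //.
- by adjacencies.
- by same_types.
have ge x y : e (g x) (g y) = e x y := ge0 x y.
exists (g z); rewrite -{1}gp -{1}ga -{1}gz' !ge; split=> //.
by apply: adj_col; rewrite ge.
Qed.

Lemma grid_spider p q z y1 y2 y2' : spider e p q z y1 y2 -> spider e p q z y1 y2' ->
  (exists r, [/\ e r p, e r q, e r y1 & e r y2]) -> exists r, [/\ e r p, e r q, e r y1 & e r y2'].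
Proof.
rewrite /spider !col_nonadj => -[[pq pz zy1 zy2] [zq py1 py2 qy1 [qy2 y12]]].
move=> [[_ _ _ zy2'] [_ _ py2' _ [qy2' y12']]] [r [rp rq ry1 ry2]].
have [|||g [_ ge0] [gy2 gy1 gz gp gq]] := ext (s := [:: y2; y1; z; p; q]) (s' := [:: y2'; y1; z; p; q]) => //.
- by adjacencies.
- by same_types.
have ge x y : e (g x) (g y) = e x y := ge0 x y.
by exists (g r); rewrite -{1}gp -{1}gq -{1}gy1 -gy2 !ge.
Qed.

Lemma centersE z y s : claw e z (y :: s) -> (centers e nb z y s).+1 = common y s.
Proof.
case/andP=> /= /andP[zy zs] _; set P := fun w => all (e w) s.
have u : uniq [seq w <- nb y | P w] by rewrite filter_uniq ?nb_uniq.
have := count_predC (pred1 z) [seq w <- nb y | P w].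
rewrite (count_uniq_mem _ u) mem_filter nbP e_sym zy [P z]zs size_filter count_filter add1n.
exact.
Qed.

(** Five leaves and the centre exhaust the six vertices available. *)
Lemma claw_transport z z' s s' : size s <= 5 -> size s = size s' -> claw e z s -> claw e z' s' ->
  exists g, [/\ automorphism g, g z = z' & map g s = s'].
Proof.
move=> s5 sz /andP[zs ps] /andP[zs' ps'].
have [|||g ga gs] := ext (s := rcons s z) (s' := rcons s' z').
- by rewrite size_rcons.
- exact: connected_cone.
- by apply: same_type_rcons_cone => //; apply: same_type_coclique.
by move: gs; rewrite map_rcons => /rcons_inj[gs gz]; exists g.
Qed.

Lemma grid_claw_centers z y s z' y' s' : size s <= 4 -> size s = size s' ->
  claw e z (y :: s) -> claw e z' (y' :: s') -> centers e nb z y s = centers e nb z' y' s'.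
Proof.
move=> s4 sz cl cl'; have [||g [ga _ gs]] := claw_transport _ _ cl cl'; rewrite /= -?sz //.
apply/eqP; rewrite -eqSS (centersE cl) (centersE cl'); case: gs => <- <-.
by rewrite (common_aut nb_uniq nbP).
Qed.

Lemma grid_no_claw z y1 y2 y3 : ~~ claw e z [:: y1; y2; y3].
Proof.
apply/negP => cl; apply: (gq_three_lines_contra e_sym nb_uniq nbP grid_line_trans grid_line_third
  grid_gq_axiom _ grid_spider grid_claw_centers z) => z'.
have [|||g [gb ge0] [gz]] := ext (s := [:: z]) (s' := [:: z']) => //; first by same_types.
have ge x y : e (g x) (g y) = e x y := ge0 x y.
exists (g y1), (g y2), (g y3); move: cl; rewrite /claw /= -gz !ge.
have gi : @injective V V g by exact: bij_inj.
by rewrite /col !ge !(inj_eq gi).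
Qed.

Lemma grid_claw3 z a b c : e z a -> e z b -> e z c -> nonadj e a b -> nonadj e a c -> b != c -> e b c.
Proof.
move=> za zb zc; rewrite -!col_nonadj => ab ac bc; have := grid_no_claw z a b c.
by rewrite /claw /= za zb zc ab ac /= !andbT negbK /col (negPf bc).
Qed.

(* The points other than [v] of the line through [v] that avoids [w]. *)
Definition off_line v w : pred V := fun a => e v a && nonadj e w a.

(** A third common neighbour [x] would not be adjacent to [v]; as there are no claws at [w], it
    would be adjacent to [b], giving adjacent common neighbours of the nonadjacent [a] and [w]. *)
Lemma off_line_common v w a b : off_line v w a -> off_line w v b -> e a b -> e v w ->
  forall x, e a x -> e w x -> x = v \/ x = b.
Proof.
case/andP=> va wa /andP[wb vb] ab vw x ax wx.
have wv : e w v by rewrite e_sym.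
have av : e a v by rewrite e_sym.
have [->|xv] := eqVneq x v; first by left.
have [->|xb] := eqVneq x b; first by right.
have ba : e b a by rewrite e_sym.
have bw : e b w by rewrite e_sym.
have xa : e x a by rewrite e_sym.
have xw : e x w by rewrite e_sym.
have vx : nonadj e v x by rewrite /nonadj eq_sym xv (grid_diamond wa vw va xw xa).
suff bx : e b x by have := grid_diamond wa bw ba xw xa; rewrite bx.
by apply: (grid_claw3 wv wb wx) => //; rewrite eq_sym.
Qed.

(* For [x] off the line [v w], the common neighbour of [x] and [w] that completes
   the quadrangle [x v w]. *)
Definition mate (v w x : V) := head x [seq b <- nb w | e x b && (b != v)].

Lemma mateP v w x : e v w -> off_line v w x -> off_line w v (mate v w x) /\ e x (mate v w x).
Proof.
move=> vw /andP[vx wx].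
have [b [bv bw bx]] := two_common wx vw vx.
have : b \in [seq b <- nb w | e x b && (b != v)] by rewrite mem_filter nbP bv !(e_sym _ b) bw bx.
rewrite /mate; set s := [seq _ <- _ | _] => bs.
have : head x s \in s by case: (s) bs => // c t _; apply: mem_head.
rewrite mem_filter nbP => /andP[/andP[xh hv] wh]; rewrite /off_line wh; split=> //.
rewrite /nonadj eq_sym hv /=.
by apply: (grid_diamond wx vw vx); rewrite e_sym.
Qed.

Lemma mate_uniq v w x b : e v w -> off_line v w x -> off_line w v b -> e x b -> b = mate v w x.
Proof.
move=> vw vwx wvb xb; have [hm xm] := mateP vw vwx.
have /andP[wm _] := hm; have /andP[_ vb] := hm.
have [mv|//] := off_line_common vwx wvb xb vw xm wm.
by move: vb; rewrite mv /nonadj eqxx.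
Qed.

Lemma mateK v w x : e v w -> off_line v w x -> mate w v (mate v w x) = x.
Proof.
move=> vw vwx; have [hm xm] := mateP vw vwx; have wv : e w v by rewrite e_sym.
by apply/esym/mate_uniq => //; rewrite e_sym.
Qed.

(** In the grid, this exchanges the two parallel lines through [v] and [w] that are transverse to
    the line [v w], and fixes every other vertex. *)
Definition swap_lines (v w x : V) :=
  if x == v then w else if x == w then v else
  if off_line v w x then mate v w x else if off_line w v x then mate w v x else x.

Lemma off_line_neq v w x : e v w -> off_line v w x -> (x == v) = false /\ (x == w) = false.
Proof.
move=> vw /andP[vx wx]; have [neq _] := nonadjP wx.
by rewrite eq_sym (adj_neq e_irr vx) eq_sym neq.
Qed.

Lemma swap_lines_end v w : swap_lines v w v = w.
Proof. by rewrite /swap_lines eqxx. Qed.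

Lemma swap_lines_off v w x : e v w -> off_line v w x -> swap_lines v w x = mate v w x.
Proof. by move=> vw vwx; have [xv xw] := off_line_neq vw vwx; rewrite /swap_lines xv xw vwx. Qed.

Lemma swap_linesC v w x : e v w -> swap_lines v w x = swap_lines w v x.
Proof.
move=> vw; rewrite /swap_lines; case: (eqVneq x v) => [->|xv]; first by rewrite (adj_neq e_irr vw).
case: eqVneq => // _; case: (boolP (off_line v w x)) => [/andP[vx _]|//].
by rewrite /off_line /nonadj vx /= !andbF.
Qed.

Lemma swap_lines_cases v w x : e v w ->
  [\/ x = v, x = w, off_line v w x | off_line w v x] \/
  (swap_lines v w x = x /\ [/\ x != v, x != w, ~~ off_line v w x & ~~ off_line w v x]).
Proof.
move=> vw; have [->|xv] := eqVneq x v; first by left; constructor 1.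
have [->|xw] := eqVneq x w; first by left; constructor 2.
have [|nvw] := boolP (off_line v w x); first by left; constructor 3.
have [|nwv] := boolP (off_line w v x); first by left; constructor 4.
by right; rewrite /swap_lines (negPf xv) (negPf xw) (negPf nvw) (negPf nwv).
Qed.

Lemma swap_linesK v w : e v w -> involutive (swap_lines v w).
Proof.
move=> vw x; have wv : e w v by rewrite e_sym.
have offK v' w' : e v' w' -> off_line v' w' x -> swap_lines v' w' (swap_lines v' w' x) = x.
  move=> vw' vwx; have wv' : e w' v' by rewrite e_sym.
  have [hm _] := mateP vw' vwx.
  by rewrite (swap_lines_off vw' vwx) (swap_linesC _ vw') (swap_lines_off wv' hm) (mateK vw' vwx).
case: (swap_lines_cases x vw) => [[->|->|/(offK _ _ vw)//|/(offK _ _ wv)]|[E _]].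
- by rewrite swap_lines_end swap_linesC // swap_lines_end.
- by rewrite [swap_lines v w w]swap_linesC // !swap_lines_end.
- by rewrite -!(swap_linesC _ vw).
- by rewrite !E.
Qed.

Lemma swap_lines_end_adj v w y : e v w -> e v y -> e w (swap_lines v w y).
Proof.
move=> vw vy; have wv : e w v by rewrite e_sym.
case: (swap_lines_cases y vw) => [[E|->|vwy|/andP[_ /andP[_]]]|[-> [yv yw nvw _]]].
- by rewrite E e_irr in vy.
- by rewrite swap_linesC // swap_lines_end.
- by rewrite swap_lines_off //; have [/andP[]] := mateP vw vwy.
- by rewrite vy.
- by move: nvw; rewrite /off_line /nonadj vy eq_sym yw /= negbK.
Qed.

Lemma swap_lines_off_adj v w x y : e v w -> off_line v w x -> e x y ->
  e (mate v w x) (swap_lines v w y).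
Proof.
move=> vw vwx xy; have wv : e w v by rewrite e_sym.
have [hm xm] := mateP vw vwx; have /andP[wm vm] := hm; have /andP[vx wx] := vwx.
case: (swap_lines_cases y vw) => [[->|E|vwy|wvy]|[-> [yv yw nvw nwv]]].
- by rewrite swap_lines_end e_sym.
- by have [_] := nonadjP wx; rewrite e_sym -E xy.
- rewrite swap_lines_off //; have [hm' ym'] := mateP vw vwy; have /andP[wm' vm'] := hm'.
  apply: (grid_claw3 wv wm wm') => //; apply: contraTneq xy => mm.
  by rewrite -(mateK vw vwx) mm mateK // e_irr.
- rewrite swap_linesC // swap_lines_off // (mate_uniq vw vwx wvy xy) mateK //.
  by rewrite e_sym.
- have xv : e x v by rewrite e_sym.
  have nvy : nonadj e v y.
    rewrite /nonadj eq_sym yv; apply/negP => vy; have [wxn wxa] := nonadjP wx.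
    have wy : e w y by move: nvw; rewrite /off_line /nonadj vy eq_sym yw /= negbK.
    by move: wxa; rewrite (@grid_line_trans v w y x) ?wxn // e_sym.
  (* Among the neighbours [v], [mate v w x] and [y] of [x], [v] is adjacent to neither of the
     others, so these are adjacent. *)
  by apply: (grid_claw3 xv xm xy) => //; apply: contraNneq nwv => <-.
Qed.

Lemma swap_lines_adj v w x y : e v w -> e x y -> e (swap_lines v w x) (swap_lines v w y).
Proof.
move=> vw xy; have wv : e w v by rewrite e_sym.
have sC z := swap_linesC z vw.
have special x' y' : ~~ (swap_lines v w x' == x') -> e x' y' -> e (swap_lines v w x') (swap_lines v w y').
  move=> + xy'; case: (swap_lines_cases x' vw) => [[E|E|vwx|wvx]|[-> _]]; last by rewrite eqxx.
  - by move=> _; rewrite E swap_lines_end swap_lines_end_adj // -E.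
  - by move=> _; rewrite !sC E swap_lines_end swap_lines_end_adj // -E.
  - by move=> _; rewrite (swap_lines_off vw) // swap_lines_off_adj.
  - by move=> _; rewrite !sC (swap_lines_off wv) // swap_lines_off_adj.
have [xE|/special] := eqVneq (swap_lines v w x) x; last exact.
have [yE|/special H] := eqVneq (swap_lines v w y) y; first by rewrite xE yE.
by rewrite e_sym H // e_sym.
Qed.

Lemma grid_swap : swap_property G.
Proof.
move=> s v w x y vs ws vw_neq svw xs ys vx xy; have wx : e w x by rewrite -svw.
have xv : e x v by rewrite e_sym.
have xw : e x w by rewrite e_sym.
have [vw|nvw] := boolP (e v w).
  have wv : e w v by rewrite e_sym.
  have swK := swap_linesK vw.
  exists (swap_lines v w); split; first split.
  - exact: inv_bij.
  - move=> a b; apply/idP/idP; last exact: swap_lines_adj.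
    by rewrite -{2}[a]swK -{2}[b]swK; apply: swap_lines_adj.
  - move=> a as_; have E := svw a as_.
    case: (swap_lines_cases a vw) => [[av|aw|/andP[va /nonadjP[_]]|/andP[wa /nonadjP[_]]]|[]//].
    + by rewrite -av as_ in vs.
    + by rewrite -aw as_ in ws.
    + by rewrite -E va.
    + by rewrite E wa.
  - exact: swap_lines_end.
(* This case is contradictory: only two lines pass through [x], and [v], [w] lie on different ones.
   So [y] would be adjacent to exactly one of [v], [w], against [svw]. *)
have nadj : nonadj e v w by rewrite /nonadj vw_neq.
have yv : y != v by apply: contraNneq vs => <-.
have yw : y != w by apply: contraNneq ws => <-.
have [vy|nvy] := boolP (e v y).
  have wy : e w y by rewrite -svw.
  by move: nvw; rewrite (@grid_line_trans x v y w) // e_sym.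
have nadjy : nonadj e v y by rewrite /nonadj eq_sym yv.
have := grid_claw3 xv xw xy nadj nadjy; rewrite eq_sym yw => /(_ isT) wy.
by rewrite svw // wy in nvy.
Qed.

End Grid.

(** * Girth, distance and local finiteness in terms of adjacency *)

Section Translation.
Local Open Scope classical_set_scope.
Local Open Scope card_scope.
Variable G : graph.
Let V : choiceType := {classic G}.
Local Notation e := (@gadj G).
Let e_sym : symmetric e := @gadj_sym G.
Let e_irr : irreflexive e := @gadj_irr G.

Lemma neighbour_lists : locally_finite G ->
  exists nb : V -> seq V, (forall x, uniq (nb x)) /\ forall x y, (y \in nb x) = e x y.
Proof.
move=> lf; have [|nb nbP] := @choice V (seq V) (fun x s => uniq s /\ forall y, (y \in s) = e x y).
  move=> x; have /(@finite_seqP V) [s sE] := lf x.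
  exists (undup s); split=> [|y]; first exact: undup_uniq.
  rewrite mem_undup; apply/idP/idP => ys.
    by have : @nbrs G x y by rewrite sE.
  by have : [set` s] y by rewrite -sE.
by exists nb; split=> [x|x y]; have [? ?] := nbP x.
Qed.

Lemma at_distance2P (x y : V) : @at_distance G x y 2 <-> nonadj e x y /\ exists2 z, e z x & e z y.
Proof.
split=> [[[p [pp lp sp]] dmin]|[/andP[xy nxy] [z zx zy]]].
  case: p sp pp lp => [//|z [//|y' [|//]]] _ /= /and3P[xz zy _] yE; subst y'.
  split; last by exists z => //; rewrite e_sym.
  rewrite /nonadj; apply/andP; split.
    apply/eqP => xy; suff : 2 <= 0 by [].
    by apply: dmin; exists [::].
  apply/negP => xy; suff : 2 <= 1 by [].
  by apply: dmin; exists [:: y]; rewrite /= andbT.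
split.
  by exists [:: z; y]; split=> //=; rewrite andbT; apply/andP; split; [rewrite [adj _ _]e_sym|].
case=> [|[|//]] [p [pp lp sp]].
  by case: p sp pp lp => // _ _ /= xE; rewrite xE eqxx in xy.
case: p sp pp lp => [//|y' [|//]] _ /=; rewrite andbT => xy' yE; subst y'.
by move: nxy; rewrite [e x y]xy'.
Qed.

Lemma other_common c2 (x y z : V) : is_c2 G c2 -> 1 < c2 -> nonadj e x y -> e z x -> e z y ->
  exists z', [/\ z' != z, e z' x & e z' y].
Proof.
move=> [_ Hc] c2_gt1 xy zx zy; apply: contrapT => none.
have cE : @at_distance G x y 2 by apply/at_distance2P; split=> //; exists z.
have sE : @nbrs G x `&` @nbrs G y = [set (z : G)].
  apply/seteqP; split=> [t [xt yt]|t ->]; last by split; rewrite /nbrs /= -/(e _ z) e_sym.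
  apply: contrapT => tz; apply: none; exists t; split; [exact/eqP|rewrite e_sym; exact: xt|rewrite e_sym; exact: yt].
have := Hc _ _ cE; rewrite sE => /card_esym c1.
by have /card_eq_II c2E := card_eq_trans c1 (@card_set1 G z); rewrite c2E in c2_gt1.
Qed.

Lemma triangle : has_cycle G 3 -> exists a b c : V, [/\ e a b, e b c & e a c].
Proof.
case=> _ [c [_ H]]; exists (c ord0), (c (ordS ord0)), (c (ordS (ordS ord0))).
have E : ordS (ordS (ordS ord0)) = ord0 :> 'I_3 by apply: val_inj.
split; [exact: H|exact: H|rewrite e_sym; have := H (ordS (ordS ord0)); rewrite E; exact].
Qed.

End Translation.

Section Conclusion.
Variable G : graph.
Let V : choiceType := {classic G}.
Local Notation e := (@gadj G).
Let e_sym : symmetric e := @gadj_sym G.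
Let e_irr : irreflexive e := @gadj_irr G.

(** The common neighbour [z] of [x] and [y] sees a nonadjacent pair in its local graph, which is
    therefore not complete; the triangle gives [k > 0]. What remains is [m = 0], [m = k] or a
    nondegenerate local graph. *)
Lemma swap_property_of_6CH (nb : V -> seq V) (a b c x y z : V) :
  (forall x, uniq (nb x)) -> (forall x y, (y \in nb x) = e x y) -> @extends_seq G 6 ->
  [/\ e a b, e b c & e a c] -> nonadj e x y -> e z x -> e z y ->
  (forall x y z : V, nonadj e x y -> e z x -> e z y -> exists z', [/\ z' != z, e z' x & e z' y]) ->
  swap_property G.
Proof.
move=> nb_uniq nbP ext [ab bc ac] xy zx zy two.
have [n [k [l [m [loc H]]]]] := locally_srg_exists nb_uniq nbP a ext.
have [Hn Hk Hl Hm] := loc.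
have k0 : 0 < k.
  by rewrite -(Hk a b ab); apply/(common_gt0 nbP); exists c; rewrite //= e_sym bc.
have mk : m <= k by rewrite -(Hk z x zx) -(Hm z x y zx zy xy); apply: common_sub => t; rewrite mem_seq1 => /eqP ->; apply: mem_head.
have kn : k.+1 < n.
  rewrite -(Hn z) -(Hk z x zx) /common_nbrs -size_filter; have [xy1 xy2] := nonadjP xy.
  apply: (@uniq_leq_size _ (x :: y :: [seq t <- nb z | all (e t) [:: x]])) => /=.
    by rewrite !inE !mem_filter /= xy1 e_irr e_sym xy2 /= filter_uniq.
  by move=> t; rewrite !inE mem_filter => /or3P[/eqP ->|/eqP ->|/andP[]//]; rewrite nbP.
case: (posnP m) => [m0|m_gt0].
  by move: loc; rewrite m0 => loc; exact (grid_swap nb_uniq nbP ext loc k0 two).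
move: mk; rewrite leq_eqVlt => /predU1P[mk|mk].
  by move: loc; rewrite mk => loc; exact (multipartite_swap nb_uniq nbP ext loc k0).
have nd : nondeg n k m by rewrite /nondeg m_gt0 mk.
have zC : z \in [seq t <- nb y | e x t] by rewrite mem_filter nbP !(e_sym _ z) zx zy.
have [P|P] := hom5_parameters (@local_sym _ nb a) (@local_irr _ nb a) (hom_local nbP ext) H nd.
  have lm : l < m by case: P => _ _ -> ->.
  by have := pentagon_contra nb_uniq nbP ext loc xy lm zC P.
have lm : l < m by case: P => _ _ -> ->.
by have := rook_contra nb_uniq nbP ext loc xy lm P zC.
Qed.

End Conclusion.

Theorem corollary1p5 (G : graph) (c2 : nat) :
  locally_finite G -> kCH 6 G -> has_girth G 3 -> is_c2 G c2 -> 1 < c2 ->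
  CH G.
Proof.
move=> /neighbour_lists[nb [nb_uniq nbP]] /kCH_extends_seq ext [/triangle[a [b [c abc]]] _] Hc2 c2_gt1.
have [[x [y /at_distance2P[xy [z zx zy]]]] _] := Hc2.
have two (p q r : {classic G}) := @other_common G c2 p q r Hc2 c2_gt1.
have swp := swap_property_of_6CH nb_uniq nbP ext abc xy zx zy two.
have ext_all k : extends_seq G (k + 6).
  by elim: k => // k IH; apply: extends_seq_step => //; apply: leq_trans (leq_addl _ _).
by move=> k _; apply/extends_seq_kCH/extends_seq_le/(ext_all k); apply: leq_addr.
Qed.
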